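(* Let $\mathbb{G}$ be a stratified group with first layer $V_1$, equipped with a homogeneous distance $d$, and let $\mathbb{M}=H_1\oplus\cdots\oplus H_\nu$ be a Banach homogeneous group equipped with its Banach homogeneous distance $\rho$. Suppose $H_1\subset\mathbb{M}$ has the Radon-Nikodym property (RNP). Let $A\subset\mathbb{G}$ be measurable and let $\zeta\in V_1\setminus\{0\}$. If $f\colon A\to\mathbb{M}$ is Lipschitz, then for almost every point $x\in A$: 1. $A$ is dense at $x$ in direction $\zeta$; 2. $f$ is differentiable at $x$ in direction $\zeta$.
   Context: **Banach homogeneous groups.** A Banach Lie algebra is a (real) Banach space $\mathbb{M}$ with norm $|\cdot|$ and a continuous, bilinear, skew-symmetric bracket $[\cdot,\cdot]$ satisfying the Jacobi identity. It is nilpotent of step $\nu\in\mathbb{N}$ if all iterated left-nested brackets of $\nu+1$ elements vanish and some iterated left-nested bracket of $\nu$ elements is nonzero. It carries the group operation $xy=x+y+\sum_{m=2}^{\nu}P_m(x,y)$ given by the truncated Baker-Campbell-Hausdorff series ($P_m$ is the homogeneous term of degree $m$, written with iterated brackets; e.g. $P_2(x,y)=[x,y]/2$); the identity is $0$ and $x^{-1}=-x$. $\mathbb{M}$ is a Banach homogeneous group if there are closed subspaces $H_1,\dots,H_\nu$ with $\mathbb{M}=H_1\oplus\cdots\oplus H_\nu$ (the sum map $H_1\times\cdots\times H_\nu\to\mathbb{M}$ is a continuous linear bijection), $[x,y]\in H_{i+j}$ for $x\in H_i,y\in H_j$, $i+j\le\nu$, and $[x,y]=0$ if $i+j>\nu$.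 Let $\pi_i\colon\mathbb{M}\to H_i$ be the projections. Dilations $\delta_r$, $r>0$, are the linear maps acting as multiplication by $r^i$ on $H_i$. Fixed positive constants $\sigma_1=1,\sigma_2,\dots,\sigma_\nu$ are chosen so that the Banach homogeneous norm $\|x\|=\max_{1\le i\le\nu}\sigma_i|\pi_i(x)|^{1/i}$ satisfies $\|xy\|\le\|x\|+\|y\|$ (such constants exist); the Banach homogeneous distance is $\rho(x,y)=\|x^{-1}y\|$. **Stratified groups.** A stratified group $\mathbb{G}$ is a finite dimensional Banach homogeneous group, with layers $\mathbb{G}=V_1\oplus\cdots\oplus V_s$, such that $[V_1,V_j]=V_{j+1}$ for $j\ge1$ and $V_j=\{0\}$ for $j>s$. A homogeneous distance $d$ on $\mathbb{G}$ is a distance with $d(zx,zy)=d(x,y)$ and $d(\delta_rx,\delta_ry)=r\,d(x,y)$ for all $x,y,z\in\mathbb{G}$, $r>0$. ''Measurable'' and ''almost every'' refer to a Haar measure $\mu$ on $\mathbb{G}$ (Lebesgue measure up to a constant), and ''Lipschitz'' refers to $d$ and $\rho$. **RNP.** A Banach space $X$ has the Radon-Nikodym property if every Lipschitz map $[0,1]\to X$ is differentiable almost everywhere. A closed subspace has the RNP if it does as a Banach space in its own right. **Directional density.** $A$ is dense at $x$ in direction $\zeta$ if $\mathcal{L}^1(\{0<\theta<t: x\delta_\theta\zeta\notin A\})/t\to0$ as $t\downarrow0$, where $\mathcal{L}^1$ is Lebesgue measure on $\mathbb{R}$. **Directional derivatives.** Points $\zeta_x^t\in\mathbb{G}$, $t>0$,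 approximate in $A$ the direction $\zeta\in\mathbb{G}$ at $x$ if $x\zeta_x^t\in A$ for every $t>0$ and $d(\zeta_x^t,\delta_t\zeta)/t\to0$ as $t\downarrow0$. Let $f\colon A\to\mathbb{M}$, $x\in A$, $\zeta\ne0$, and suppose there exist points approximating in $A$ the direction $\zeta$ at $x$. Then $f$ is differentiable at $x$ in direction $\zeta$, with directional derivative $\partial^+f(x,\zeta)\in\mathbb{M}$, if for every choice $t\mapsto\zeta_x^t$ of points approximating in $A$ the direction $\zeta$ at $x$ one has $\lim_{t\downarrow0}\delta_{1/t}\big(f(x)^{-1}f(x\zeta_x^t)\big)=\partial^+f(x,\zeta)$. *)

(* Defs.v *)
From HB Require Import structures.
From mathcomp Require Import all_boot all_order all_algebra.
From mathcomp Require Import all_classical all_reals all_analysis measurable_realfun.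
Set Implicit Arguments.
Unset Strict Implicit.
Unset Printing Implicit Defensive.
Import Order.TTheory GRing.Theory Num.Theory.
Import numFieldNormedType.Exports.
Local Open Scope classical_set_scope.
Local Open Scope ring_scope.

Section subspaces.
Context {R : realType} {X : completeNormedModType R}.

Definition linear_subspace (S : set X) : Prop :=
  S 0 /\ forall (a : R) (x y : X), S x -> S y -> S (a *: x + y).

Definition linear_span (S : set X) : set X := smallest linear_subspace S.

(* For a closed linear subspace S this is the Radon-Nikodym property of S with
   the restricted norm. The Lipschitz map [0, 1] -> S is given by a function on
   R whose values outside [0, 1] are irrelevant. *)
Definition radon_nikodym_property (S : set X) : Prop :=
  forall g : R -> X,
    (forall t, t \in `[0, 1] -> S (g t)) ->
    [lipschitz g t | t in `[0, 1] ] ->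
    {ae lebesgue_measure, forall t : R,
       t \in `]0, 1[ -> exists2 v, S v & is_derive t 1 g v}.

End subspaces.

Section brackets.
Context {R : realType} {X : completeNormedModType R}.
Implicit Types (br : X -> X -> X) (x y z : X).

Record banach_lie_bracket br : Prop := BanachLieBracket {
  bracket_linearl : forall y, linear (br^~ y) ;
  bracket_linearr : forall x, linear (br x) ;
  bracket_continuous : continuous (fun p : X * X => br p.1 p.2) ;
  bracket_skew : forall x y, br x y = - br y x ;
  bracket_jacobi : forall x y z,
    br x (br y z) + br y (br z x) + br z (br x y) = 0
}.

(* [[...[[x_1, x_2], x_3], ...], x_n] for the sequence x_1, ..., x_n *)
Definition nested_bracket br (w : seq X) : X :=
  if w is x :: w' then foldl br x w' else 0.

(* no br is nilpotent of step 0, as nested_bracket br [::] = 0 *)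
Definition nilpotent_of_step br (nu : nat) : Prop :=
  (forall w, size w = nu.+1 -> nested_bracket br w = 0) /\
  (exists2 w, size w = nu & nested_bracket br w != 0).

(* Dynkin's form of the homogeneous term of degree m of log (exp x exp y):
     1/m * sum over k >= 1 and pairs (p_i, q_i), i < k, with p_i + q_i > 0 and
     sum_i (p_i + q_i) = m, of
     (-1)^(k-1)/k * [x^p_1 y^q_1 ... x^p_k y^q_k] / prod_i (p_i! q_i!),
   where pq i = (p_i, q_i) and [...] is the nested bracket of the word. *)
Definition dynkin_word x y (k m : nat)
    (pq : {ffun 'I_k -> 'I_m.+1 * 'I_m.+1}) : seq X :=
  flatten [seq nseq (pq i).1 x ++ nseq (pq i).2 y | i <- enum 'I_k].

Definition bch_term br (m : nat) x y : X :=
  m%:R^-1 *: \sum_(1 <= k < m.+1) ((-1) ^+ k.-1 / k%:R) *: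
    \sum_(pq : {ffun 'I_k -> 'I_m.+1 * 'I_m.+1} |
          [forall i, 0 < (pq i).1 + (pq i).2]%N &&
          (\sum_i ((pq i).1 + (pq i).2) == m)%N)
      (\prod_i ((pq i).1`! * (pq i).2`!))%N%:R^-1 *:
        nested_bracket br (dynkin_word x y pq).

Definition bch_mul br (nu : nat) x y : X :=
  x + y + \sum_(2 <= m < nu.+1) bch_term br m x y.

End brackets.

(* The layers are H_1, ..., H_nu; the values of layer and layer_proj at other
   indices are unconstrained. The last three fields say that
   x |-> (layer_proj 1 x, ..., layer_proj nu x) is a two-sided inverse of the
   sum map H_1 x ... x H_nu -> X. Since the layers are closed, this inverse is
   automatically continuous. *)
Record banach_homogeneous_group (R : realType) (nu : nat) :=
  BanachHomogeneousGroup {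
  bhg_space :> completeNormedModType R ;
  bracket : bhg_space -> bhg_space -> bhg_space ;
  layer : nat -> set bhg_space ;
  layer_proj : nat -> bhg_space -> bhg_space ;
  bracket_lie : banach_lie_bracket bracket ;
  bracket_nilpotent : nilpotent_of_step bracket nu ;
  layer_subspace : forall i, (1 <= i <= nu)%N -> linear_subspace (layer i) ;
  layer_closed : forall i, (1 <= i <= nu)%N -> closed (layer i) ;
  layer_bracket : forall i j x y,
    (1 <= i)%N -> (1 <= j)%N -> (i + j <= nu)%N ->
    layer i x -> layer j y -> layer (i + j)%N (bracket x y) ;
  layer_bracket0 : forall i j x y,
    (1 <= i <= nu)%N -> (1 <= j <= nu)%N -> (nu < i + j)%N ->
    layer i x -> layer j y -> bracket x y = 0 ;
  proj_layer : forall i x, (1 <= i <= nu)%N -> layer i (layer_proj i x) ;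
  proj_sum : forall x, \sum_(1 <= i < nu.+1) layer_proj i x = x ;
  proj_uniq : forall h : nat -> bhg_space,
    (forall i, (1 <= i <= nu)%N -> layer i (h i)) ->
    forall i, (1 <= i <= nu)%N -> layer_proj i (\sum_(1 <= j < nu.+1) h j) = h i
}.

Arguments bracket {R nu b}.
Arguments layer {R nu} b.
Arguments layer_proj {R nu b}.

Section homogeneous_groups.
Context {R : realType} {nu : nat} (X : banach_homogeneous_group R nu).
Implicit Types (x y z : X) (r t : R).

Definition gmul x y : X := bch_mul bracket nu x y.
Definition ginv x : X := - x.

Definition dilation r x : X := \sum_(1 <= i < nu.+1) r ^+ i *: layer_proj i x.

Definition homogeneous_norm (sigma : nat -> R) x : R :=
  \big[Num.max/0]_(1 <= i < nu.+1) (sigma i * `|layer_proj i x| `^ (i%:R^-1)).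

Definition norm_constants (sigma : nat -> R) : Prop :=
  [/\ sigma 1%N = 1,
      forall i, (1 <= i <= nu)%N -> 0 < sigma i &
      forall x y, homogeneous_norm sigma (gmul x y) <=
                  homogeneous_norm sigma x + homogeneous_norm sigma y].

Definition homogeneous_norm_dist (sigma : nat -> R) x y : R :=
  homogeneous_norm sigma (gmul (ginv x) y).

Definition finite_dimensional : Prop :=
  exists (n : nat) (e : 'I_n -> X),
    forall x, exists c : 'I_n -> R, x = \sum_i c i *: e i.

Definition stratified : Prop :=
  [/\ finite_dimensional,
      forall j, (1 <= j)%N ->
        linear_span [set bracket x y | x in layer X 1 & y in layer X j]
        = layer X j.+1 &
      forall j, (nu < j)%N -> layer X j = [set 0]].

Record homogeneous_distance (d : X -> X -> R) : Prop := HomogeneousDistance {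
  hdist_eq0 : forall x y, d x y = 0 <-> x = y ;
  hdist_sym : forall x y, d x y = d y x ;
  hdist_triangle : forall x y z, d x z <= d x y + d y z ;
  hdist_gmul : forall x y z, d (gmul z x) (gmul z y) = d x y ;
  hdist_dilation : forall x y r, 0 < r ->
    d (dilation r x) (dilation r y) = r * d x y
}.

Definition borel := g_sigma_algebraType (@open X).

Record haar_measure (mu : {measure set borel -> \bar R}) : Prop := HaarMeasure {
  haar_left_invariant : forall x (B : set borel),
    measurable B -> mu (gmul x @` B) = mu B ;
  haar_compact : forall K : set X, compact K -> (mu K < +oo)%E ;
  haar_neq0 : mu setT != 0%E
}.

Definition missed (A : set X) x (zeta : X) t : set R :=
  [set th | 0 < th < t /\ ~ A (gmul x (dilation th zeta))].

(* lebesgue_measure is defined on all subsets of R as the outer measure, so no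
   measurability of the set is needed here. *)
Definition dense_in_direction (A : set X) x (zeta : X) : Prop :=
  (lebesgue_measure (missed A x zeta t) * (t^-1)%:E)%E
    @[t --> (0 : R)^'+] --> 0%E.

Definition approximating (d : X -> X -> R) (A : set X) x (zeta : X)
    (z : R -> X) : Prop :=
  (forall t, 0 < t -> A (gmul x (z t))) /\
  d (z t) (dilation t zeta) / t @[t --> (0 : R)^'+] --> (0 : R).

End homogeneous_groups.

Section maps.
Context {R : realType} {s nu : nat}.
Context (G : banach_homogeneous_group R s) (M : banach_homogeneous_group R nu).
Variables (d : G -> G -> R) (rho : M -> M -> R).

(* Maps A -> M are given by functions on G; their values outside A are never
   used. *)
Definition lipschitz_map (A : set G) (f : G -> M) : Prop :=
  exists L : R, forall x y, A x -> A y -> rho (f x) (f y) <= L * d x y.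

Definition directional_derivative (A : set G) (f : G -> M) (x zeta : G)
    (v : M) : Prop :=
  forall z : R -> G, approximating d A x zeta z ->
    dilation t^-1 (gmul (ginv (f x)) (f (gmul x (z t)))) @[t --> (0 : R)^'+] --> v.

Definition differentiable_in_direction (A : set G) (f : G -> M)
    (x zeta : G) : Prop :=
  [/\ A x, zeta != 0,
      exists z, approximating d A x zeta z &
      exists v, directional_derivative A f x zeta v].

End maps.

(* Main.v *)
(* Pansu's blow-up argument, localized to one direction. The first component
   F = pi_1 o f is Lipschitz along each line t |-> x (t zeta) with values in H_1,
   so by the RNP it has a derivative at almost every parameter at which the line
   meets A; lines being one-parameter subgroups, Fubini and the left invariance of
   mu turn this into a statement about almost every x. At a density point x with
   derivative v, join x to a point near x (t zeta) by N points of A on the line, at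
   parameters about k t / N. After rescaling by 1/t, each increment of f has first
   component v / N + O(N^-2), and its components in H_i, i >= 2, are O(N^-2) because
   f is Lipschitz for the homogeneous distance. The product of these increments is
   therefore v + O(1/N). *)
Require Import Defs.
From HB Require Import structures.
From mathcomp Require Import all_boot all_order all_algebra ring lra zify.
From mathcomp Require Import all_classical all_reals all_analysis measurable_realfun.
Set Implicit Arguments.
Unset Strict Implicit.
Unset Printing Implicit Defensive.
Import Order.TTheory GRing.Theory Num.Theory.
Import numFieldNormedType.Exports.
Local Open Scope classical_set_scope.
Local Open Scope ring_scope.

#[local] Obligation Tactic := idtac.

(** * Nilpotent exponentials *)

(** [gmul] is only a formula: that Dynkin's truncated series defines a group is proved here. The Lie
    algebra acts by nilpotent operators on [R * L], faithfully thanks to the degree derivation, and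
    Dynkin's formula is proved for exponentials of operators, so that associativity is inherited
    from composition. Three obstacles shape the rest. A chain has N factors, so an ordinary
    Lipschitz constant of the product would be raised to the power N; the estimate used instead
    costs a factor 1 + O(1/N) per step. Fubini needs measurable sets: the first component of [f] is
    continuous for the norm only once [d] is, which comes from Baire's theorem and from the
    generation of the group by horizontal segments, and the set of points without a derivative is
    replaced by one defined through measures of sections. Finally, moving along a line multiplies on
    the right, while [mu] is invariant on the left; that right translations preserve null sets is
    itself drawn from Fubini. *)

Section truncated_series.
Context {R : numFieldType}.
Implicit Types p q : {poly R}.

Definition exp_poly (N : nat) : {poly R} := \poly_(k < N) (k`!%:R)^-1.
Definition log_poly (N : nat) : {poly R} :=
  \poly_(k < N) (if k == 0%N then 0 else (-1) ^+ k.-1 / k%:R).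

Lemma deriv_exp_poly N : (exp_poly N.+1)^`() = exp_poly N.
Proof.
apply/polyP => i; rewrite coef_deriv !coef_poly ltnS.
case: ltnP => // _; last by rewrite mul0rn.
by rewrite factS natrM invfM -[RHS]mul1r -[LHS]mulr_natr mulrAC mulVf ?pnatr_eq0.
Qed.

Lemma exp_polyS N : exp_poly N.+1 = exp_poly N + (N`!%:R)^-1 *: 'X^N.
Proof.
apply/polyP => i; rewrite coefD coefZ coefXn !coef_poly ltnS leq_eqVlt.
by case: ltngtP => //= h; rewrite ?mulr0 ?mulr1 ?addr0 ?add0r ?h.
Qed.

(** The derivative is the geometric sum of the powers of [- 'X], which [1 + 'X] telescopes;
    [(- 'X) ^+ N] is the exact truncation error. *)
Lemma deriv_log_poly N : (1 + 'X) * (log_poly N.+1)^`() = 1 - (- 'X) ^+ N.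
Proof.
have NXE j : (- 'X : {poly R}) ^+ j = (-1) ^+ j *: 'X^j.
  by rewrite [LHS]exprNn -mul_polyC rmorphXn rmorphN rmorph1.
have -> : (log_poly N.+1)^`() = \sum_(i < N) (- 'X) ^+ i.
  apply/polyP => i; rewrite coef_deriv coef_poly ltnS coef_sum.
  under eq_bigr do rewrite NXE coefZ coefXn.
  case: ltnP => iN.
    rewrite (bigD1 (Ordinal iN)) //= big1 => [|j /eqP jN].
      by rewrite eqxx mulr1 addr0 -[LHS]mulr_natr /= divfK ?pnatr_eq0.
    case: eqP => [ij|]; last by rewrite mulr0.
    by exfalso; apply: jN; apply: val_inj.
  rewrite mul0rn big1// => j _.
  by rewrite gtn_eqF ?mulr0// (leq_trans (ltn_ord j)).
by rewrite -opprB subrX1 -mulNr opprB opprK.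
Qed.

Lemma eq_deriv_coef M p q : p`_0 = q`_0 ->
  (forall i, (i < M)%N -> (p^`())`_i = (q^`())`_i) ->
  forall i, (i < M.+1)%N -> p`_i = q`_i.
Proof.
move=> pq0 pq [//|i]; rewrite ltnS => iM.
have := pq i iM; rewrite !coef_deriv -(mulr_natr p`_i.+1) -(mulr_natr q`_i.+1).
have i0 : i.+1%:R != 0 :> R by rewrite pnatr_eq0.
by move/(mulIf i0).
Qed.

Lemma exp_poly_subr1 N : exists h : {poly R}, exp_poly N.+1 - 1 = h * 'X.
Proof.
exists (\poly_(i < N) (i.+1`!%:R)^-1).
apply/polyP => i; rewrite coefB coefMX coef1 !coef_poly.
by case: i => [|i]; rewrite /= ?ltnS ?subr0// fact0 invr1 subrr.
Qed.

Lemma log_poly_factor N : exists h : {poly R}, log_poly N.+1 = h * 'X.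
Proof.
exists (\poly_(i < N) ((-1) ^+ i / i.+1%:R)).
apply/polyP => i; rewrite coefMX !coef_poly.
by case: i => [|i].
Qed.

Lemma modX_coef M p q : (forall i, (i < M)%N -> p`_i = q`_i) ->
  exists h : {poly R}, p = q + h * 'X^M.
Proof.
move=> pq; exists (drop_poly M (p - q)).
rewrite -[LHS](subrK q) addrC; congr +%R.
rewrite -[LHS](poly_take_drop M) [X in X + _](_ : _ = 0) ?add0r//.
apply/polyP => i; rewrite coef_take_poly coef0 coefB.
by case: ltnP => // /pq ->; rewrite subrr.
Qed.

(** Both sides vanish at 0, so derivatives are compared, to one degree less. The chain rule gives
    the inverse of the exponential times the exponential; both truncation errors are multiples of
    the required power of ['X], since the exponential minus 1 is divisible by ['X]. *)
Lemma log_exp_poly N : exists h : {poly R},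
  log_poly N \Po (exp_poly N - 1) = 'X + h * 'X^N.
Proof.
case: N => [|N]; apply: modX_coef => // i iN.
have [h eh] := exp_poly_subr1 N; have [k lk] := log_poly_factor N.
apply: (@eq_deriv_coef N) iN => [|{}i iN].
  by rewrite -horner_coef0 horner_comp eh lk !hornerE coefX.
set e := exp_poly N.+1; set l := log_poly N.+1.
set c := (N`!%:R^-1)%:P : {poly R}.
have -> : (l \Po (e - 1))^`() = 1 + (- (- h) ^+ N - c * (l^`() \Po (e - 1))) * 'X^N.
  rewrite deriv_comp derivB -polyC1 derivC subr0 polyC1 deriv_exp_poly.
  have := exp_polyS N; rewrite -/e -mul_polyC -/c => /esym /(canRL (addrK _)) ->.
  have := deriv_log_poly N; rewrite -/l => /(congr1 (fun p => p \Po (e - 1))).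
  rewrite comp_polyM comp_polyD comp_polyX -polyC1 comp_polyC comp_polyB.
  rewrite comp_polyC rmorphXn rmorphN /= comp_polyX polyC1.
  set m := comp_poly _ _ => E.
  have -> : m * (e - c * 'X^N) = (1 + (e - 1)) * m - c * m * 'X^N by ring.
  rewrite E; have -> : - (e - 1) = - h * 'X by rewrite eh mulNr.
  by rewrite exprMn; ring.
by rewrite derivX coefD coefMXn iN addr0.
Qed.

(** The composite solves the differential equation (1 + X) h' = h modulo X^N, with h(0) = 1. On
    coefficients this is the recurrence [hS], which forces h to agree with 1 + X. *)
Lemma exp_log_poly N : exists h : {poly R},
  exp_poly N.+1 \Po log_poly N.+1 = 1 + 'X + h * 'X^(N.+1).
Proof.
have [k lk] := log_poly_factor N.
apply: modX_coef => i iN.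
set e := exp_poly N.+1; set l := log_poly N.+1; set h := e \Po l.
set c := (N`!%:R^-1)%:P : {poly R}.
have h0 : h`_0 = 1.
  rewrite -horner_coef0 /h horner_comp /l lk !hornerE horner_coef0.
  by rewrite /e coef_poly /= fact0 invr1.
have lN : l ^+ N = k ^+ N * 'X^N by rewrite /l lk exprMn.
have hS j : (j < N)%N -> h`_j = j.+1%:R * h`_j.+1 + j%:R * h`_j.
  move=> jN; have : ((1 + 'X) * h^`())`_j = h`_j.
    have -> : (1 + 'X) * h^`() =
        h + (- c * k ^+ N * (1 - (- 'X) ^+ N) - h * (-1) ^+ N) * 'X^N.
      rewrite deriv_comp deriv_exp_poly.
      have := exp_polyS N; rewrite -/e -mul_polyC -/c => /esym /(canRL (addrK _)) ->.
      rewrite comp_polyB comp_polyM comp_polyC rmorphXn /= comp_polyX -/h lN.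
      rewrite mulrCA deriv_log_poly (exprNn 'X).
      by move: ((-1) ^+ N) => u; ring.
    by rewrite coefD coefMXn jN addr0.
  move=> {1}<-; rewrite mulrDl mul1r coefD coefXM !coef_deriv.
  case: j jN => [|j] jN /=; first by rewrite mul0r mul1r mulr1n.
  by rewrite !mulr_natl.
rewrite coefD coef1 coefX; case: i iN => [|i] iN.
  by rewrite h0 addr0.
have h1 : (0 < N)%N -> h`_1 = 1 by move=> /hS; rewrite h0 mul0r addr0 mul1r.
elim: i iN => [|i IH] iN; first by rewrite h1 // add0r.
have /hS : (i.+1 < N)%N by [].
rewrite (IH (ltnW iN)); case: i {IH} iN => [|i] iN.
  rewrite /= add0r mul1r => /eqP; rewrite -subr_eq0 opprD addrCA subrr addr0.
  by rewrite oppr_eq0 mulf_eq0 pnatr_eq0 /= => /eqP ->; rewrite addr0.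
rewrite /= addr0 mulr0 addr0 => /esym/eqP.
by rewrite mulf_eq0 pnatr_eq0 /= => /eqP ->.
Qed.

End truncated_series.

Section nilpotent_exp_log.
Context {R : numFieldType} {A : algType R}.
Implicit Types (x y : A) (p q : {poly R}).

Definition nil_exp N x : A := \sum_(k < N) (k`!%:R)^-1 *: x ^+ k.
Definition nil_log N x : A := \sum_(1 <= k < N) ((-1) ^+ k.-1 / k%:R) *: x ^+ k.

Lemma horner_alg_sum x N (c : nat -> R) :
  horner_alg x (\poly_(k < N) c k) = \sum_(k < N) c k *: x ^+ k.
Proof.
rewrite poly_def rmorph_sum /=; apply: eq_bigr => i _.
by rewrite linearZ rmorphXn /= horner_algX mulr_algl.
Qed.

Lemma nil_expE N x : nil_exp N x = horner_alg x (exp_poly N).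
Proof. by rewrite horner_alg_sum. Qed.

Lemma nil_logE N x : nil_log N x = horner_alg x (log_poly N).
Proof.
rewrite horner_alg_sum /nil_log.
case: N => [|N]; first by rewrite big_geq// big_ord0.
rewrite -(big_mkord xpredT (fun k => (if k == 0%N then 0 else (-1) ^+ k.-1 / k%:R) *: x ^+ k)).
rewrite big_ltn// scale0r add0r; apply: eq_big_nat => k /andP[k0 _].
by rewrite gtn_eqF.
Qed.

Lemma horner_alg_comp x p q : horner_alg x (p \Po q) = horner_alg (horner_alg x q) p.
Proof.
elim/poly_ind: p => [|p c IH]; first by rewrite comp_poly0 !rmorph0.
rewrite comp_polyD comp_polyM comp_polyX comp_polyC !rmorphD !rmorphM /= IH.
by rewrite !horner_algX !horner_algC.
Qed.

Lemma nil_logK N x : x ^+ N = 0 -> nil_log N (nil_exp N x - 1) = x.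
Proof.
move=> xN; rewrite nil_logE nil_expE -(rmorph1 (horner_alg x)) -rmorphB.
rewrite -horner_alg_comp; have [h ->] := @log_exp_poly R N.
by rewrite rmorphD rmorphM rmorphXn /= horner_algX xN mulr0 addr0.
Qed.

Lemma nil_expK N x : (0 < N)%N -> x ^+ N = 0 -> nil_exp N (nil_log N x) = 1 + x.
Proof.
case: N => // N _ xN; rewrite nil_logE nil_expE.
rewrite -horner_alg_comp; have [h ->] := @exp_log_poly R N.
by rewrite !rmorphD rmorphM rmorphXn /= rmorph1 horner_algX xN mulr0 addr0.
Qed.

(** The binomial theorem turns the left side into the part [i + j < N] of the double sum on the
    right; the hypothesis removes the remaining corner of the square. *)
Lemma nil_expD N x y : GRing.comm x y ->
  (forall i j, (N <= i + j)%N -> x ^+ i * y ^+ j = 0) ->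
  nil_exp N (x + y) = nil_exp N x * nil_exp N y.
Proof.
move=> cxy xy0; rewrite /nil_exp.
pose a i j : A := (j`! * i`!)%:R^-1 *: (x ^+ j * y ^+ i).
transitivity (\sum_(0 <= k < N) \sum_(0 <= i < N | (i <= k)%N) a i (k - i)%N).
  rewrite big_mkord; apply: eq_bigr => -[k kN] _ /=.
  rewrite exprDn_comm// scaler_sumr.
  rewrite (big_cat_nat (n := k.+1))//= [X in _ + X]big1_seq ?addr0; last first.
    by move=> i; rewrite mem_index_iota => /and3P[ik ki _]; lia.
  rewrite big_mkord; apply: eq_big => [i|[i ik] _] /=.
    by rewrite -ltnS ltn_ord.
  rewrite /a -[X in _ *: X = _]scaler_nat scalerA; congr (_ *: _).
  have kf : k`!%:R = 'C(k, i)%:R * (i`! * (k - i)`!)%:R :> R.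
    by rewrite -natrM bin_fact.
  rewrite kf invfM mulrAC mulVf ?mul1r 1?mulnC// pnatr_eq0 -lt0n bin_gt0; lia.
rewrite (exchange_big_dep xpredT)//= mulr_sumr big_mkord.
apply: eq_bigr => -[i iN] _ /=; rewrite mulr_suml.
rewrite (big_cat_nat (n := i))//= ?(ltnW iN)// big1_seq ?add0r; last first.
  by move=> k; rewrite mem_index_iota => /and3P[ik _ ki]; lia.
rewrite big_nat_cond (eq_bigl (fun k => (i <= k < N)%N)); last first.
  by move=> k /=; lia.
rewrite -big_nat -[X in index_iota X](add0n i) big_addn.
rewrite -(big_mkord xpredT (fun j => (j`!%:R^-1 *: x ^+ j) * (i`!%:R^-1 *: y ^+ i))).
rewrite [RHS](big_cat_nat (leq0n (N - i)%N) (leq_subr _ _))/=.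
rewrite [X in _ + X]big1_seq ?addr0; last first.
  move=> j /andP[_]; rewrite mem_index_iota => ji.
  rewrite -scalerAl -scalerAr xy0 ?scaler0//; lia.
apply: eq_bigr => j _; rewrite addnK /a -scalerAl -scalerAr scalerA.
by rewrite natrM invfM.
Qed.

Lemma nil_exp0 N : nil_exp N.+1 0 = 1.
Proof.
rewrite /nil_exp big_ord_recl big1 => [|i _]; last by rewrite expr0n scaler0.
by rewrite expr0 fact0 invr1 scale1r addr0.
Qed.

End nilpotent_exp_log.

(** * Homogeneous sums over words and the Dynkin form of the BCH series *)

Section words.
Context {T : Type}.
Implicit Types (x y : T).

Definition word_of x y (k M : nat) (pq : {ffun 'I_k -> 'I_M.+1 * 'I_M.+1}) : seq T :=
  flatten [seq nseq (pq i).1 x ++ nseq (pq i).2 y | i <- enum 'I_k].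

Lemma index_enum_ord k : index_enum 'I_k = enum 'I_k.
Proof. by rewrite [index_enum _]unlock -enumT. Qed.

Lemma size_word_of x y k M (pq : {ffun 'I_k -> 'I_M.+1 * 'I_M.+1}) :
  size (word_of x y pq) = (\sum_i ((pq i).1 + (pq i).2))%N.
Proof.
rewrite /word_of size_flatten /shape sumnE big_map big_map index_enum_ord.
by apply: eq_bigr => i _; rewrite size_cat !size_nseq.
Qed.

End words.

Lemma map_word_of (T U : Type) (f : T -> U) x y k M
    (pq : {ffun 'I_k -> 'I_M.+1 * 'I_M.+1}) :
  map f (word_of x y pq) = word_of (f x) (f y) pq.
Proof.
rewrite /word_of map_flatten -map_comp; congr flatten; apply: eq_map => i /=.
by rewrite map_cat !map_nseq.
Qed.

Section word_sums.
Context {R : numFieldType} {U : lmodType R}.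
Implicit Types (th : seq bool -> U).

Definition log_word_coef k M (pq : {ffun 'I_k -> 'I_M.+1 * 'I_M.+1}) : R :=
  (\prod_i ((pq i).1`! * (pq i).2`!))%N%:R^-1.

(** The expansion of log (exp x exp y) into words in two letters, with at most [M] blocks and
    exponents at most [M]. The evaluation [th] of words is left free, so that the same coefficients
    serve for products, nested brackets and operators. *)
Definition log_word_sum M th : U :=
  \sum_(1 <= k < M.+1) ((-1) ^+ k.-1 / k%:R) *:
    \sum_(pq : {ffun 'I_k -> 'I_M.+1 * 'I_M.+1} | [forall i, 0 < (pq i).1 + (pq i).2]%N)
      log_word_coef pq *: th (word_of true false pq).

Definition homogeneous_word_sum m th : U :=
  \sum_(1 <= k < m.+1) ((-1) ^+ k.-1 / k%:R) *:
    \sum_(pq : {ffun 'I_k -> 'I_m.+1 * 'I_m.+1} |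
          [forall i, 0 < (pq i).1 + (pq i).2]%N &&
          (\sum_i ((pq i).1 + (pq i).2) == m)%N)
      log_word_coef pq *: th (word_of true false pq).

Lemma eq_log_word_sum M th th' :
  (forall w, (0 < size w)%N -> th w = th' w) -> log_word_sum M th = log_word_sum M th'.
Proof.
move=> E; apply: eq_big_nat => k /andP[k0 _]; congr (_ *: _).
apply: eq_bigr => pq /forallP pq0; congr (_ *: _); apply: E.
case: k k0 pq pq0 => // k _ pq pq0.
rewrite size_word_of big_ord_recl; have := pq0 ord0; lia.
Qed.

Lemma log_word_sumD M th th' :
  log_word_sum M (fun w => th w + th' w) = log_word_sum M th + log_word_sum M th'.
Proof.
rewrite /log_word_sum -big_split; apply: eq_bigr => k _ /=.
rewrite -scalerDr -big_split; congr (_ *: _); apply: eq_bigr => pq _.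
by rewrite scalerDr.
Qed.

Lemma log_word_sum0 M : log_word_sum M (fun=> 0) = 0.
Proof.
by rewrite /log_word_sum big1// => k _; rewrite big1 ?scaler0// => pq _; rewrite scaler0.
Qed.

Lemma log_word_sum_sum M (I : Type) (r : seq I) (th : I -> seq bool -> U) :
  log_word_sum M (fun w => \sum_(i <- r) th i w) = \sum_(i <- r) log_word_sum M (th i).
Proof.
elim: r => [|i r IH].
  by under [LHS]eq_log_word_sum do rewrite big_nil; rewrite log_word_sum0 big_nil.
under [LHS]eq_log_word_sum do rewrite big_cons.
by rewrite log_word_sumD IH big_cons.
Qed.

(** A word of length [m] has at most [m] nonempty blocks, with exponents at most [m], so the larger
    bounds add no term. This links the logarithm, cut uniformly at [M], to Dynkin's terms, whose
    index types depend on their degree. *)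
Lemma log_word_sum_homogeneous M m th : (0 < m <= M)%N ->
  log_word_sum M (fun w => if size w == m then th w else 0) = homogeneous_word_sum m th.
Proof.
move=> /andP[m0 mM]; rewrite /log_word_sum /homogeneous_word_sum.
rewrite (big_cat_nat (n := m.+1))//= [X in _ + X]big_nat [X in _ + X]big1 ?addr0; last first.
  move=> k /andP[mk _]; rewrite big1 ?scaler0// => pq /forallP pq0.
  rewrite size_word_of gtn_eqF ?scaler0//.
  apply: (leq_trans mk); rewrite -[X in (X <= _)%N]card_ord -sum1_card.
  by apply: leq_sum => i _; exact: pq0.
apply: eq_big_nat => k /andP[k0 km]; congr (_ *: _).
under eq_bigr do rewrite size_word_of.
rewrite (bigID (fun pq : {ffun 'I_k -> 'I_M.+1 * 'I_M.+1} =>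
  (\sum_i ((pq i).1 + (pq i).2) == m)%N))/= [X in _ + X]big1 ?addr0; last first.
  by move=> pq /andP[_ /negbTE ->]; rewrite scaler0.
have mM1 : (m.+1 <= M.+1)%N by [].
pose h (pq : {ffun 'I_k -> 'I_m.+1 * 'I_m.+1}) : {ffun 'I_k -> 'I_M.+1 * 'I_M.+1} :=
  [ffun i => (widen_ord mM1 (pq i).1, widen_ord mM1 (pq i).2)].
pose h' (pq : {ffun 'I_k -> 'I_M.+1 * 'I_M.+1}) : {ffun 'I_k -> 'I_m.+1 * 'I_m.+1} :=
  [ffun i => (inord (pq i).1, inord (pq i).2)].
rewrite (reindex_onto h h')/=; last first.
  move=> pq /andP[_ /eqP spq]; apply/ffunP => i; rewrite !ffunE.
  have : ((pq i).1 + (pq i).2 <= m)%N.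
    by rewrite -spq (bigD1 i)//= leq_addr.
  move=> pqm; rewrite [RHS]surjective_pairing; congr pair; apply: val_inj => /=;
    rewrite inordK//; lia.
apply: eq_big => [pq|pq /andP[/andP[_ /eqP spq] _]].
  have -> : h' (h pq) == pq.
    apply/eqP/ffunP => i; rewrite !ffunE /= [RHS]surjective_pairing.
    by congr pair; apply: val_inj; rewrite /= inordK.
  rewrite andbT; congr andb.
    by apply: eq_forallb => i; rewrite ffunE.
  by congr (_ == _); apply: eq_bigr => i _; rewrite ffunE.
rewrite spq eqxx; congr (_ *: _).
  by congr (_%:R^-1); apply: eq_bigr => i _; rewrite ffunE.
congr th; rewrite /word_of; congr flatten; apply: eq_map => i.
by rewrite ffunE.
Qed.

Lemma log_word_sum_split M n th : (n <= M.+1)%N ->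
  (forall w, (n <= size w)%N -> th w = 0) ->
  log_word_sum M th = \sum_(1 <= m < n) homogeneous_word_sum m th.
Proof.
move=> nM th0.
rewrite (@eq_log_word_sum _ _
  (fun w => \sum_(1 <= m < n) if size w == m then th w else 0)); last first.
  move=> w w0; case: (ltnP (size w) n) => wn.
    rewrite (bigD1_seq (size w)) ?iota_uniq ?mem_index_iota ?w0//= eqxx.
    by rewrite big1 ?addr0// => i /negbTE; rewrite eq_sym => ->.
  by rewrite th0// big1// => i _; rewrite if_same.
rewrite log_word_sum_sum; apply: eq_big_nat => m /andP[m0 mn].
by apply: log_word_sum_homogeneous; rewrite m0; lia.
Qed.

Lemma eq_homogeneous_word_sum m th th' :
  (forall w, size w = m -> th w = th' w) ->
  homogeneous_word_sum m th = homogeneous_word_sum m th'.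
Proof.
move=> E; apply: eq_bigr => k _; congr (_ *: _); apply: eq_bigr => pq /andP[_ /eqP pqm].
by rewrite E// size_word_of.
Qed.

Lemma homogeneous_word_sum1 th : homogeneous_word_sum 1 th = th [:: true] + th [:: false].
Proof.
rewrite /homogeneous_word_sum big_nat1 expr0 divr1 scale1r.
pose h (j : 'I_2 * 'I_2) : {ffun 'I_1 -> 'I_2 * 'I_2} := [ffun=> j].
rewrite (reindex_onto h (fun f => f ord0)); last first.
  by move=> f _; apply/ffunP => i; rewrite ffunE (ord1 i).
rewrite (eq_bigl (fun j : 'I_2 * 'I_2 => ((j.1 : nat) + j.2 == 1)%N)); last first.
  move=> j; rewrite big_ord1 !ffunE eqxx andbT andb_idl// => /eqP j1.
  by apply/forallP => i; rewrite ffunE j1.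
transitivity (\sum_(a : 'I_2) \sum_(b : 'I_2) if ((a : nat) + b == 1)%N then
    log_word_coef (h (a, b)) *: th (word_of true false (h (a, b))) else 0).
  by rewrite pair_bigA big_mkcond; apply: eq_bigr => -[a b].
have wE j : word_of true false (h j) = nseq j.1 true ++ nseq j.2 false.
  by rewrite /word_of enum_ordSl enum_ord0 /= ffunE cats0.
have cE j : log_word_coef (h j) = ((j.1)`! * (j.2)`!)%:R^-1 :> R.
  by rewrite /log_word_coef big_ord1 ffunE.
by rewrite !big_ord_recl !big_ord0 /= !wE !cE /= !fact0 ?invr1 ?scale1r !addr0 !add0r addrC.
Qed.

End word_sums.

Lemma homogeneous_word_sum_linear (R : numFieldType) (U W : lmodType R) (f : U -> W) m th :
  linear f -> f (homogeneous_word_sum m th) = homogeneous_word_sum m (fun w => f (th w)).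
Proof.
move=> lf.
have f0 : f 0 = 0.
  by have := lf (-1) 0 0; rewrite scaler0 addr0 scaleN1r addNr.
have fD : {morph f : u v / u + v} by move=> u v; have := lf 1 u v; rewrite !scale1r.
have fZ c u : f (c *: u) = c *: f u by have := lf c u 0; rewrite f0 !addr0.
rewrite /homogeneous_word_sum (big_morph f fD f0); apply: eq_bigr => k _.
rewrite fZ (big_morph f fD f0); congr (_ *: _); apply: eq_bigr => pq _.
exact: fZ.
Qed.

(** Carries continuity and norm estimates from single words to whole BCH terms. *)
Lemma homogeneous_word_sum_closed (R : numFieldType) (U : lmodType R) (T : Type)
    (Q : (T -> U) -> Prop) m (th : T -> seq bool -> U) :
  Q (fun=> 0) -> (forall f g, Q f -> Q g -> Q (fun t => f t + g t)) ->
  (forall c f, Q f -> Q (fun t => c *: f t)) ->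
  (forall w, size w = m -> Q (th^~ w)) ->
  Q (fun t => homogeneous_word_sum m (th t)).
Proof.
move=> Q0 QD QZ Qw.
have Qsum (I : Type) (r : seq I) (P : pred I) (f : I -> T -> U) :
    (forall i, P i -> Q (f i)) -> Q (fun t => \sum_(i <- r | P i) f i t).
  move=> Qf; elim: r => [|i r IH].
    by rewrite (_ : (fun _ => _) = fun=> 0)//; apply/funext => t; rewrite big_nil.
  case: (boolP (P i)) => Pi.
    rewrite (_ : (fun _ => _) = fun t => f i t + \sum_(i <- r | P i) f i t).
      by apply: QD => //; exact: Qf.
    by apply/funext => t; rewrite big_cons Pi.
  rewrite (_ : (fun _ => _) = fun t => \sum_(i <- r | P i) f i t)//.
  by apply/funext => t; rewrite big_cons (negbTE Pi).
apply: (Qsum) => k _; apply: (QZ); apply: (Qsum) => pq /andP[_ /eqP pqm].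
by apply: (QZ); apply: Qw; rewrite size_word_of.
Qed.

Section brackets.
Context {R : numFieldType} {L : lmodType R}.
Variable br : L -> L -> L.

(* Versions of nested_bracket and bch_term for a bracket on a bare module: they are
   applied to the commutators of endomorphisms, which carry no norm. *)
Definition left_bracket (w : seq L) : L := if w is x :: w' then foldl br x w' else 0.

Lemma left_bracket_rcons w a : (0 < size w)%N ->
  left_bracket (rcons w a) = br (left_bracket w) a.
Proof. by case: w => //= b w _; rewrite foldl_rcons. Qed.

Definition bch m (x y : L) : L :=
  m%:R^-1 *: homogeneous_word_sum m
    (fun w => left_bracket [seq (if b then x else y) | b <- w]).

End brackets.

Section log_words.
Context {R : numFieldType} {A : algType R}.

(** Powers of exp x exp y - 1 are expanded by distributivity: each factor contributes one block x^i
    y^j, and the blocks are nonempty because the term (0, 0) cancels the 1. *)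
Lemma log_exp_words M (x y : A) :
  nil_log M.+1 (nil_exp M.+1 x * nil_exp M.+1 y - 1) =
  log_word_sum M (fun w => \prod_(b <- w) (if b then x else y)).
Proof.
apply: eq_big_nat => k _; congr (_ *: _).
pose c (j : 'I_M.+1 * 'I_M.+1) : A := (j.1`! * j.2`!)%:R^-1 *: (x ^+ j.1 * y ^+ j.2).
have -> : nil_exp M.+1 x * nil_exp M.+1 y - 1 = \sum_(j : 'I_M.+1 * 'I_M.+1 | (0 < j.1 + j.2)%N) c j.
  rewrite mulr_suml; under eq_bigr do rewrite mulr_sumr.
  rewrite pair_bigA (bigD1 (ord0, ord0))//= !expr0 fact0 invr1 !scale1r mulr1.
  rewrite addrAC subrr add0r; apply: eq_big => [[[i iM] [j jM]]|[i j] _]/=.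
    by rewrite xpair_eqE -!val_eqE /=; lia.
  by rewrite /c /= -scalerAl -scalerAr scalerA natrM invfM.
rewrite -[k in _ ^+ k]card_ord -prodr_const bigA_distr_big.
apply: eq_big => [pq|pq _].
  by apply/ffun_onP/forallP => /= h i; exact: h.
rewrite /c GRing.scaler_prod; congr (_ *: _).
  by rewrite /log_word_coef natr_prod -prodfV.
rewrite /word_of big_flatten big_map index_enum_ord; apply: eq_bigr => i _.
by rewrite big_cat !big_nseq !iter_mulr !mulr1.
Qed.

End log_words.

(** * The algebra of endomorphisms of a module *)

Section endomorphisms.
Context {R : numFieldType} {V : lmodType R}.

(* Endomorphisms act on the right: f * g is "f, then g". The parameter makes the
   ring nontrivial. *)
Record endo (nzV : exists v : V, v != 0) :=
  Endo { endo_fun :> V -> V ; endo_linear : linear endo_fun }.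

Variable nzV : exists v : V, v != 0.
Implicit Types f g h : endo nzV.

Lemma endoP f g : (forall v, f v = g v) -> f = g.
Proof.
case: f g => f lf [g lg] /= fg; have E : f = g by exact/funext.
by case: _ / E lg => lg; congr Endo; exact: Prop_irrelevance.
Qed.

HB.instance Definition _ := gen_eqMixin (endo nzV).
HB.instance Definition _ := gen_choiceMixin (endo nzV).

Lemma endoD f v w : f (v + w) = f v + f w.
Proof. by have := endo_linear f 1 v w; rewrite !scale1r. Qed.
Lemma endo0 f : f 0 = 0.
Proof. by have := endoD f 0 0; rewrite addr0 => /eqP; rewrite addrC -subr_eq subrr => /eqP. Qed.
Lemma endoZ f a v : f (a *: v) = a *: f v.
Proof. by have := endo_linear f a v 0; rewrite endo0 !addr0. Qed.
Lemma endoN f v : f (- v) = - f v.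
Proof. by rewrite -scaleN1r endoZ scaleN1r. Qed.
Lemma endoB f v w : f (v - w) = f v - f w.
Proof. by rewrite endoD endoN. Qed.
Lemma endo_sum f (I : Type) (r : seq I) (P : pred I) (v : I -> V) :
  f (\sum_(i <- r | P i) v i) = \sum_(i <- r | P i) f (v i).
Proof. exact: (big_morph f (endoD f) (endo0 f)). Qed.

Program Definition endo_zero : endo nzV := @Endo _ (fun=> 0) _.
Next Obligation. by move=> a v w; rewrite scaler0 addr0. Qed.
Program Definition endo_one : endo nzV := @Endo _ (fun v => v) _.
Next Obligation. by []. Qed.
Program Definition endo_add f g : endo nzV := @Endo _ (fun v => f v + g v) _.
Next Obligation. by move=> f g a v w; rewrite !endoD !endoZ scalerDr addrACA. Qed.
Program Definition endo_opp f : endo nzV := @Endo _ (fun v => - f v) _.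
Next Obligation. by move=> f a v w; rewrite !endoD !endoZ scalerN opprD. Qed.
Program Definition endo_mul f g : endo nzV := @Endo _ (fun v => g (f v)) _.
Next Obligation. by move=> f g a v w; rewrite !endoD !endoZ. Qed.
Program Definition endo_scale (c : R) f : endo nzV := @Endo _ (fun v => c *: f v) _.
Next Obligation. by move=> c f a v w; rewrite !endoD !endoZ scalerDr !scalerA mulrC. Qed.

Lemma endo_addA : associative endo_add.
Proof. by move=> f g h; apply: endoP => v /=; rewrite addrA. Qed.
Lemma endo_addC : commutative endo_add.
Proof. by move=> f g; apply: endoP => v /=; rewrite addrC. Qed.
Lemma endo_add0 : left_id endo_zero endo_add.
Proof. by move=> f; apply: endoP => v /=; rewrite add0r. Qed.
Lemma endo_addN : left_inverse endo_zero endo_opp endo_add.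
Proof. by move=> f; apply: endoP => v /=; rewrite addNr. Qed.

HB.instance Definition _ := GRing.isZmodule.Build (endo nzV)
  endo_addA endo_addC endo_add0 endo_addN.

Lemma endo_mulA : associative endo_mul.
Proof. by move=> f g h; apply: endoP. Qed.
Lemma endo_mul1 : left_id endo_one endo_mul.
Proof. by move=> f; apply: endoP. Qed.
Lemma endo_1mul : right_id endo_one endo_mul.
Proof. by move=> f; apply: endoP. Qed.
Lemma endo_mulDl : left_distributive endo_mul +%R.
Proof. by move=> f g h; apply: endoP => v /=; rewrite endoD. Qed.
Lemma endo_mulDr : right_distributive endo_mul +%R.
Proof. by move=> f g h; apply: endoP. Qed.
Lemma endo_one_neq0 : endo_one != 0.
Proof. by have [v] := nzV; apply: contra_neq => /(congr1 (fun f => f v)). Qed.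

HB.instance Definition _ := GRing.Zmodule_isNzRing.Build (endo nzV)
  endo_mulA endo_mul1 endo_1mul endo_mulDl endo_mulDr endo_one_neq0.

Lemma endo_scaleA a b f : endo_scale a (endo_scale b f) = endo_scale (a * b) f.
Proof. by apply: endoP => v /=; rewrite scalerA. Qed.
Lemma endo_scale1 : left_id 1 endo_scale.
Proof. by move=> f; apply: endoP => v /=; rewrite scale1r. Qed.
Lemma endo_scaleDr : right_distributive endo_scale +%R.
Proof. by move=> a f g; apply: endoP => v /=; rewrite scalerDr. Qed.
Lemma endo_scaleDl f : {morph endo_scale^~ f : a b / a + b}.
Proof. by move=> a b; apply: endoP => v /=; rewrite scalerDl. Qed.

HB.instance Definition _ := GRing.Zmodule_isLmodule.Build R (endo nzV)
  endo_scaleA endo_scale1 endo_scaleDr endo_scaleDl.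

Lemma endo_scaleAl a f g : a *: (f * g) = (a *: f) * g.
Proof. by apply: endoP => v /=; rewrite endoZ. Qed.
HB.instance Definition _ := GRing.Lmodule_isLalgebra.Build R (endo nzV) endo_scaleAl.

Lemma endo_scaleAr a f g : a *: (f * g) = f * (a *: g).
Proof. by apply: endoP. Qed.
HB.instance Definition _ := GRing.Lalgebra_isAlgebra.Build R (endo nzV) endo_scaleAr.

Lemma endoDE f g v : (f + g) v = f v + g v. Proof. by []. Qed.
Lemma endoNE f v : (- f) v = - f v. Proof. by []. Qed.
Lemma endoME f g v : (f * g) v = g (f v). Proof. by []. Qed.
Lemma endoZE a f v : (a *: f) v = a *: f v. Proof. by []. Qed.
Lemma endo_sumE (I : Type) (r : seq I) (P : pred I) (f : I -> endo nzV) v :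
  (\sum_(i <- r | P i) f i) v = \sum_(i <- r | P i) f i v.
Proof. by elim/big_rec2: _ => // i w g _ <-. Qed.

End endomorphisms.

(** * Filtered algebras *)

Section filtrations.
Context {R : numFieldType} {A : algType R}.

(** In the applications [F k] consists of the operators that raise degrees by at least [k], and
    nilpotency is the vanishing of some [F n]. *)
Record filtration (F : nat -> A -> Prop) : Prop := Filtration {
  filt0 : forall k, F k 0 ;
  filtD : forall k a b, F k a -> F k b -> F k (a + b) ;
  filtZ : forall k c a, F k a -> F k (c *: a) ;
  filtM : forall i j a b, F i a -> F j b -> F (i + j)%N (a * b) ;
  filtS : forall k a, F k.+1 a -> F k a ;
  filt1 : F 0%N 1 }.

Variables (F : nat -> A -> Prop) (fF : filtration F).

Lemma filtN k a : F k a -> F k (- a).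
Proof. by move=> Fa; rewrite -scaleN1r; exact: (filtZ fF). Qed.

Lemma filtB k a b : F k a -> F k b -> F k (a - b).
Proof. by move=> Fa Fb; apply: (filtD fF) => //; exact: filtN. Qed.

Lemma filt_sum k (I : Type) (r : seq I) (P : pred I) (a : I -> A) :
  (forall i, P i -> F k (a i)) -> F k (\sum_(i <- r | P i) a i).
Proof. by move=> Fa; elim/big_rec: _ => [|i b Pi Fb]; [exact: (filt0 fF)|apply: (filtD fF); auto]. Qed.

Lemma filt_le j k a : (j <= k)%N -> F k a -> F j a.
Proof.
elim: k => [|k IH]; first by rewrite leqn0 => /eqP ->.
by rewrite leq_eqVlt => /orP[/eqP ->//|/IH jk /(filtS fF)].
Qed.

Lemma filtX k i a : F k a -> F (k * i)%N (a ^+ i).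
Proof.
move=> Fa; elim: i => [|i IH]; first by rewrite muln0; exact: (filt1 fF).
by rewrite exprS mulnS; exact: (filtM fF).
Qed.

Lemma filt_exp k N a : F k a -> F k (nil_exp N.+1 a - 1).
Proof.
move=> Fa; rewrite /nil_exp big_ord_recl expr0 fact0 invr1 scale1r addrAC subrr add0r.
apply: filt_sum => i _; apply: (filtZ fF); apply: (@filt_le _ (k * i.+1)).
  by rewrite mulnS leq_addr.
exact: filtX.
Qed.

(** The truncation at [N.+2] guarantees that the constant and linear terms are both present; every
    other term is at least quadratic in [a]. *)
Lemma filt_exp1 k N a : F k a -> F (k + k)%N (nil_exp N.+2 a - 1 - a).
Proof.
move=> Fa; rewrite /nil_exp 2!big_ord_recl expr0 expr1 fact0 invr1 !scale1r.
rewrite (addrC 1) addrK; set s := \sum_(_ < _) _.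
rewrite (addrC a) addrK.
apply: filt_sum => i _; apply: (filtZ fF); apply: (@filt_le _ (k * i.+2)).
  by rewrite !mulnS addnA leq_addr.
exact: filtX.
Qed.

Lemma filt_log k N a : F k a -> F k (nil_log N a).
Proof.
move=> Fa; rewrite /nil_log big_nat; apply: filt_sum => i /andP[i0 _].
apply: (filtZ fF); apply: (@filt_le _ (k * i)).
  by rewrite leq_pmulr.
exact: filtX.
Qed.

End filtrations.

Section commutators.
Context {R : numFieldType} {A : algType R}.
Implicit Types a b v : A.

Lemma alg_neq0 : exists v : A, v != 0. Proof. by exists 1; exact: oner_neq0. Qed.

Let E := endo alg_neq0.

Program Definition rmul a : E := @Endo _ _ _ (fun v => v * a) _.
Next Obligation. by move=> a c v w; rewrite mulrDl scalerAl. Qed.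
Program Definition lmul a : E := @Endo _ _ _ (fun v => a * v) _.
Next Obligation. by move=> a c v w; rewrite mulrDr scalerAr. Qed.

Definition commutator a b : A := a * b - b * a.
(** The operator v -> [v, a]. Since composition is written from left to right, a product of such
    operators applied to an element is a left-nested bracket. *)
Definition rad a : E := rmul a - lmul a.

Lemma rmulM a b : rmul (a * b) = rmul a * rmul b.
Proof. by apply: endoP => v /=; rewrite mulrA. Qed.
Lemma lmulM a b : lmul (a * b) = lmul b * lmul a.
Proof. by apply: endoP => v /=; rewrite mulrA. Qed.
Lemma rmul_lmul a b : rmul a * lmul b = lmul b * rmul a.
Proof. by apply: endoP => v /=; rewrite mulrA. Qed.
Lemma rmulX a i : rmul a ^+ i = rmul (a ^+ i).
Proof. by elim: i => [|i IH]; [apply: endoP => v /=; rewrite mulr1|rewrite !exprS rmulM IH]. Qed.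
Lemma lmulX a i : lmul a ^+ i = lmul (a ^+ i).
Proof. by elim: i => [|i IH]; [apply: endoP => v /=; rewrite mul1r|rewrite exprS IH -lmulM -exprSr]. Qed.
Lemma rmul0 : rmul 0 = 0. Proof. by apply: endoP => v /=; rewrite mulr0. Qed.
Lemma lmul0 : lmul 0 = 0. Proof. by apply: endoP => v /=; rewrite mul0r. Qed.

Lemma nil_exp_rmul N a : nil_exp N (rmul a) = rmul (nil_exp N a).
Proof.
apply: endoP => v; rewrite /nil_exp endo_sumE [RHS]/= mulr_sumr; apply: eq_bigr => i _.
by rewrite endoZE rmulX /= scalerAr.
Qed.
Lemma nil_exp_lmul N a : nil_exp N (lmul a) = lmul (nil_exp N a).
Proof.
apply: endoP => v; rewrite /nil_exp endo_sumE [RHS]/= mulr_suml; apply: eq_bigr => i _.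
by rewrite endoZE lmulX /= scalerAl.
Qed.

Lemma commutatorMr D a b : commutator D (a * b) = commutator D a * b + a * commutator D b.
Proof. by rewrite /commutator mulrBl mulrBr !mulrA addrA subrK. Qed.

Lemma expr0_le n i a : a ^+ n = 0 -> (n <= i)%N -> a ^+ i = 0.
Proof. by move=> an ni; rewrite -(subnK ni) exprD an mulr0. Qed.

(** Left and right multiplications commute, so the exponential of [rad a] is the conjugation v ->
    exp(-a) v exp(a). Either factor dies at the power [n], hence their combination at [n + n]. *)
Lemma nil_exp_rad n N a : a ^+ n = 0 -> (n + n <= N)%N ->
  nil_exp N (rad a) = rmul (nil_exp N a) * lmul (nil_exp N (- a)) /\ rad a ^+ N = 0.
Proof.
move=> an nN.
have RL i j : (N <= i + j)%N -> rmul a ^+ i * lmul (- a) ^+ j = 0.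
  move=> ij; rewrite rmulX lmulX.
  have [ni|ni] := leqP n i; first by rewrite (expr0_le an ni) rmul0 mul0r.
  by rewrite exprNn (expr0_le an (i := j)) ?mulr0 ?lmul0 ?mulr0//; lia.
have radE : rad a = rmul a + lmul (- a) by apply: endoP => v /=; rewrite mulNr.
have cRL : GRing.comm (rmul a) (lmul (- a)) by exact: rmul_lmul.
split; first by rewrite radE nil_expD// nil_exp_rmul nil_exp_lmul.
rewrite radE exprDn_comm// big1// => i _.
by rewrite RL ?mul0rn// subnK// -ltnS.
Qed.

Lemma nil_expN n N a : a ^+ n = 0 -> (n + n <= N.+1)%N ->
  nil_exp N.+1 a * nil_exp N.+1 (- a) = 1.
Proof.
move=> an nN; rewrite -nil_expD.
- by rewrite subrr nil_exp0.
- by rewrite /GRing.comm mulrN mulNr.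
- move=> i j ij; have [ni|ni] := leqP n i; first by rewrite (expr0_le an ni) mul0r.
  by rewrite exprNn (expr0_le an (i := j)) ?mulr0//; lia.
Qed.

End commutators.

(** * Dynkin's form of the Baker-Campbell-Hausdorff formula *)

Section baker_campbell_hausdorff.
Context {R : numFieldType} {A : algType R}.
Variables (F : nat -> A -> Prop) (fF : filtration F).
Variables (n M : nat) (x y D : A).
Hypotheses (Fn : forall a, F n a -> a = 0) (nM : (n + n <= M.+1)%N).
Hypotheses (Fx : F 1 x) (Fy : F 1 y).
Hypotheses (Dx : commutator D x = x) (Dy : commutator D y = y).

Let letter (b : bool) : A := if b then x else y.
Let word (w : seq bool) : A := \prod_(b <- w) letter b.
Let lie_word (w : seq bool) : A := left_bracket commutator [seq letter b | b <- w].

Lemma filt_nilp a : F 1 a -> a ^+ n = 0.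
Proof. by move=> Fa; apply: Fn; have := filtX fF n Fa; rewrite mul1n. Qed.

Lemma filt_exp_exp : F 1 (nil_exp M.+1 x * nil_exp M.+1 y - 1).
Proof.
have -> : nil_exp M.+1 x * nil_exp M.+1 y - 1 =
    (nil_exp M.+1 x - 1) * nil_exp M.+1 y + (nil_exp M.+1 y - 1).
  by rewrite mulrBl mul1r addrA subrK.
apply: (filtD fF); last exact: filt_exp.
rewrite -[1%N]addn0; apply: (filtM fF); first exact: filt_exp.
rewrite -(subrK 1 (nil_exp _ _)); apply: (filtD fF); last exact: filt1 fF.
by apply: (filtS fF); exact: filt_exp.
Qed.

(** The exponentials of [rad x] and [rad y] are conjugations, and their product is conjugation by
    [g], which is the exponential of [rad] of the logarithm of [g]. Taking logarithms of operators
    brings brackets into the associative series. *)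
Lemma log_rad (g := nil_exp M.+1 x * nil_exp M.+1 y) :
  nil_log M.+1 (nil_exp M.+1 (rad x) * nil_exp M.+1 (rad y) - 1) =
  rad (nil_log M.+1 (g - 1)).
Proof.
have Fg : F 1 (g - 1) by exact: filt_exp_exp.
set z := nil_log M.+1 (g - 1).
have Fz : F 1 z by exact: filt_log.
have zn := filt_nilp Fz.
have ez : nil_exp M.+1 z = g.
  have nM1 : (n <= M.+1)%N by lia.
  by rewrite (nil_expK (ltn0Sn M) (expr0_le (filt_nilp Fg) nM1)) addrC subrK.
have [ex _] := nil_exp_rad (filt_nilp Fx) nM.
have [ey _] := nil_exp_rad (filt_nilp Fy) nM.
have [erz rz] := nil_exp_rad zn nM.
have -> : nil_exp M.+1 (rad x) * nil_exp M.+1 (rad y) = nil_exp M.+1 (rad z).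
  rewrite ex ey erz ez -mulrA (mulrA (lmul _)) -rmul_lmul !mulrA -rmulM -/g -mulrA.
  rewrite -lmulM; congr (_ * lmul _).
  (* The inverse of [g] is identified in two ways, as exp(-z) and as exp(-y) exp(-x). *)
  have xK := nil_expN (filt_nilp Fx) nM; have yK := nil_expN (filt_nilp Fy) nM.
  have zK := nil_expN (a := - z); rewrite opprK in zK.
  have {}zK : nil_exp M.+1 (- z) * g = 1.
    by rewrite -ez; apply: (zK n) => //; rewrite exprNn zn mulr0.
  rewrite -[LHS]mul1r -zK -mulrA /g -!mulrA (mulrA (nil_exp _ y)) yK mul1r xK.
  by rewrite mulr1.
by rewrite nil_logK.
Qed.

(** [D] stands for the missing first entry: its bracket with the first letter is that letter, and
    the later operators nest their brackets around it. *)
Lemma rad_word w : (0 < size w)%N ->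
  (\prod_(b <- w) (if b then rad x else rad y)) D = lie_word w.
Proof.
elim/last_ind: w => // w b IH _.
have DE c : rad (letter c) D = letter c by case: c => /=.
case: (posnP (size w)) => [/size0nil ->|w0].
  by rewrite big_seq1 /lie_word /= -DE; case: b.
rewrite /lie_word map_rcons left_bracket_rcons ?size_map//.
by rewrite big_rcons endoME IH//; case: b.
Qed.

Lemma commutatorD_word w : commutator D (word w) = (size w)%:R *: word w.
Proof.
rewrite /word; elim: w => [|b w IH].
  by rewrite big_nil /commutator mulr1 mul1r subrr scale0r.
have Db : commutator D (letter b) = letter b by case: b.
rewrite big_cons commutatorMr IH Db -scalerAr /=.
by rewrite -nat1r scalerDl scale1r.
Qed.

Lemma commutatorD_lie_word w : commutator D (lie_word w) = (size w)%:R *: lie_word w.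
Proof.
elim/last_ind: w => [|w b IH].
  by rewrite /lie_word /= /commutator mulr0 mul0r subrr scaler0.
have Db : commutator D (letter b) = letter b by case: b.
case: (posnP (size w)) => [/size0nil ->|w0].
  by rewrite /lie_word /= scale1r.
rewrite /lie_word map_rcons left_bracket_rcons ?size_map// -/(lie_word w).
have -> : commutator D (commutator (lie_word w) (letter b)) =
    commutator D (lie_word w * letter b) - commutator D (letter b * lie_word w).
  rewrite /commutator mulrBr mulrBl !opprB -!addrA; congr (_ + _).
  by rewrite addrCA [RHS]addrCA; congr (_ + _); rewrite addrC.
rewrite !commutatorMr IH Db size_rcons -natr1 scalerDl scale1r.
rewrite -scalerAl -scalerAr [X in _ - X]addrC opprD addrACA -scalerBr.
by [].
Qed.

Lemma endo_log_word_sum (V : lmodType R) (nz : exists v : V, v != 0) (f : endo nz) th :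
  f (log_word_sum M th) = log_word_sum M (fun w => f (th w)).
Proof.
rewrite /log_word_sum endo_sum; apply: eq_bigr => k _; rewrite endoZ; congr (_ *: _).
by rewrite endo_sum; apply: eq_bigr => pq _; rewrite endoZ.
Qed.

Lemma endo_log_word_sumE (V : lmodType R) (nz : exists v : V, v != 0)
    (th : seq bool -> endo nz) v :
  (log_word_sum M th) v = log_word_sum M (fun w => th w v).
Proof.
rewrite /log_word_sum endo_sumE; apply: eq_bigr => k _; rewrite endoZE; congr (_ *: _).
by rewrite endo_sumE; apply: eq_bigr => pq _; rewrite endoZE.
Qed.

Let adD : endo (@alg_neq0 R A) := lmul D - rmul D.

(** Eigenvectors of the bracket with [D] for distinct eigenvalues are independent. Subtracting [k]
    times the relation from its image under [adD] kills the last term and leaves a shorter relation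
    of the same form. *)
Lemma weight_sum_eq0 k (u : nat -> A) : (forall m, adD (u m) = m%:R *: u m) ->
  \sum_(0 <= m < k) m%:R *: u m = 0 -> forall m, (0 < m < k)%N -> u m = 0.
Proof.
elim: k u => [|k IH] u uD s0 m; first by rewrite ltn0 andbF.
have u0 i : (0 < i < k)%N -> u i = 0.
  move=> ik; have : (i%:R - k%:R) *: u i = 0.
    apply: (IH (fun i => (i%:R - k%:R) *: u i)) => // [j|].
      by rewrite endoZ uD !scalerA mulrC.
    have : \sum_(0 <= m < k.+1) m%:R *: ((m%:R - k%:R) *: u m) = 0.
      transitivity (adD (\sum_(0 <= m < k.+1) m%:R *: u m)
                    - k%:R *: \sum_(0 <= m < k.+1) m%:R *: u m).
        rewrite endo_sum scaler_sumr -sumrB; apply: eq_bigr => j _.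
        by rewrite endoZ uD !scalerA -scalerBl mulrBr (mulrC k%:R).
      by rewrite s0 endo0 scaler0 subrr.
    by rewrite big_nat_recr//= subrr scale0r scaler0 addr0.
  move=> /eqP; rewrite scaler_eq0 subr_eq0 eqr_nat => /orP[/eqP ik'|/eqP//].
  by move: ik; rewrite ik' ltnn andbF.
rewrite ltnS => /andP[m0]; rewrite leq_eqVlt => /orP[/eqP mk|mk]; last by rewrite u0// m0.
move: s0; rewrite big_nat_recr//= big1_seq ?add0r => [/eqP|i].
  by rewrite -mk scaler_eq0 pnatr_eq0 gtn_eqF//= => /eqP.
rewrite mem_index_iota => /andP[_ /andP[_ ik]].
by case: (posnP i) => [->|i0]; rewrite ?scale0r// u0 ?scaler0// i0.
Qed.

(** The Dynkin-Specht-Wever argument. The bracket of [D] with the logarithm multiplies each word by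
    its length; computed through [log_rad] and [rad_word], it replaces each word by its nested
    bracket. The two totals agree, and [weight_sum_eq0] separates the degrees, so that the part of
    degree m is 1/m times the nested brackets. *)
Lemma log_word_sum_bch :
  log_word_sum M word = \sum_(1 <= m < n) bch commutator m x y.
Proof.
have Fword w : F (size w) (word w).
  rewrite /word; elim: w => [|b w IH]; first by rewrite big_nil; exact: (filt1 fF).
  by rewrite big_cons -[size _]/(1 + size w)%N; apply: (filtM fF) => //; case: b.
have Flie w : F (size w) (lie_word w).
  elim/last_ind: w => [|w b IH]; first exact: (filt0 fF).
  case: (posnP (size w)) => [/size0nil ->|w0]; first by case: b.
  rewrite /lie_word map_rcons left_bracket_rcons ?size_map// size_rcons.
  apply: (filtB fF); first by rewrite -addn1; apply: (filtM fF) => //; case: b.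
  by rewrite -add1n; apply: (filtM fF) => //; case: b.
have nM1 : (n <= M.+1)%N by lia.
pose dlt w := word w - (size w)%:R^-1 *: lie_word w.
have dlt0 w : (n <= size w)%N -> dlt w = 0.
  move=> nw; rewrite /dlt (Fn (filt_le fF nw (Fword w))).
  by rewrite (Fn (filt_le fF nw (Flie w))) scaler0 subrr.
pose u m := log_word_sum M (fun w => if size w == m then dlt w else 0).
have uD m : adD (u m) = m%:R *: u m.
  (* Multiplication by [m] is written as an endomorphism so that it passes inside the sum over
     words. *)
  have f (v : A) : m%:R *: v = (m%:R *: (1 : endo (@alg_neq0 R A))) v by [].
  rewrite f /u !endo_log_word_sum; apply: eq_log_word_sum => w _; cbv beta.
  case: eqP => [<-|_]; last by rewrite !endo0.
  transitivity ((size w)%:R *: dlt w); last by [].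
  rewrite endoB endoZ.
  have -> : adD (word w) = commutator D (word w) by [].
  have -> : adD (lie_word w) = commutator D (lie_word w) by [].
  by rewrite commutatorD_word commutatorD_lie_word scalerBr !scalerA mulrC.
have Dlog : log_word_sum M (fun w => (size w)%:R *: word w) = log_word_sum M lie_word.
  transitivity (adD (log_word_sum M word)).
    rewrite endo_log_word_sum; apply: eq_log_word_sum => w _.
    by rewrite -commutatorD_word.
  have := log_rad; rewrite log_exp_words => /(congr1 (fun f : endo _ => f D)).
  rewrite log_exp_words endo_log_word_sumE => E.
  transitivity (rad (log_word_sum M word) D); first by [].
  by rewrite -E; apply: eq_log_word_sum => w; exact: rad_word.
have u0 m : (0 < m < n)%N -> u m = 0.
  apply: weight_sum_eq0 => //.
  have -> : \sum_(0 <= m < n) m%:R *: u m = log_word_sum M (fun w => (size w)%:R *: dlt w).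
    have f (v : A) c : c *: v = (c *: (1 : endo (@alg_neq0 R A))) v by [].
    under eq_bigr do rewrite f /u endo_log_word_sum.
    rewrite -log_word_sum_sum; apply: eq_log_word_sum => w w0.
    case: (ltnP (size w) n) => wn.
      rewrite (bigD1_seq (size w)) ?iota_uniq ?mem_index_iota//= eqxx.
      by rewrite big1 ?addr0// => i /negbTE; rewrite eq_sym => ->; rewrite scaler0.
    by rewrite dlt0// scaler0 big1// => i _; rewrite if_same /= scaler0.
  rewrite (@eq_log_word_sum _ _ _ _
    (fun w => (size w)%:R *: word w + (-1 *: (1 : endo (@alg_neq0 R A))) (lie_word w))).
    by rewrite log_word_sumD -endo_log_word_sum Dlog /= scaleN1r subrr.
  move=> w w0; rewrite scalerBr scalerA mulfV ?scale1r ?pnatr_eq0 -?lt0n//=.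
  by rewrite scaleN1r.
have dlt_sum : log_word_sum M dlt = 0.
  rewrite (log_word_sum_split nM1 dlt0) big_nat big1// => m mn.
  by rewrite -(@log_word_sum_homogeneous _ _ M) -/(u m) ?u0//; lia.
rewrite (@eq_log_word_sum _ _ _ _ (fun w => dlt w + (size w)%:R^-1 *: lie_word w));
  last by move=> w _; rewrite subrK.
rewrite log_word_sumD dlt_sum add0r (@log_word_sum_split _ _ _ n)//; last first.
  by move=> w nw; rewrite (Fn (filt_le fF nw (Flie w))) scaler0.
apply: eq_bigr => m _; rewrite /bch /homogeneous_word_sum scaler_sumr.
apply: eq_bigr => k _; rewrite [RHS]scalerA [X in _ = X *: _]mulrC -[RHS]scalerA.
congr (_ *: _); rewrite scaler_sumr.
apply: eq_bigr => pq /andP[_ /eqP pqm].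
rewrite [RHS]scalerA [X in _ = X *: _]mulrC -[RHS]scalerA.
by rewrite size_word_of pqm.
Qed.

(** Products of [n] elements of [F 1] vanish, but the exponentials are cut only at [M.+1 >= n + n],
    the power at which the operators [rad a] are known to vanish as well. *)
Theorem exp_bch : nil_exp M.+1 x * nil_exp M.+1 y =
  nil_exp M.+1 (\sum_(1 <= m < n) bch commutator m x y).
Proof.
rewrite -log_word_sum_bch -log_exp_words.
have gn := expr0_le (filt_nilp filt_exp_exp) (leq_trans (leq_addr n n) nM).
by rewrite (nil_expK (ltn0Sn M) gn) addrC subrK.
Qed.

End baker_campbell_hausdorff.

(** * Graded structure, group law and dilations *)

Lemma bch_termE (R : realType) (X : completeNormedModType R) (br : X -> X -> X) m x y :
  bch_term br m x y = bch br m x y.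
Proof.
rewrite /bch_term /bch /homogeneous_word_sum; congr (_ *: _).
apply: eq_bigr => k _; congr (_ *: _); apply: eq_bigr => pq _; congr (_ *: _).
by rewrite map_word_of.
Qed.

Section graded_lie_algebra.
Context {R : realType} {nu : nat} {L : banach_homogeneous_group R nu}.
Implicit Types (x y z a b : L) (i j k : nat) (r : R).

Let br : L -> L -> L := bracket.

Lemma brDl x y z : br (x + y) z = br x z + br y z.
Proof. by have := bracket_linearl (bracket_lie L) z 1 x y; rewrite !scale1r. Qed.
Lemma brDr x y z : br x (y + z) = br x y + br x z.
Proof. by have := bracket_linearr (bracket_lie L) x 1 y z; rewrite !scale1r. Qed.
Lemma br0l x : br 0 x = 0.
Proof. by have := brDl 0 0 x; rewrite addr0 => /eqP; rewrite addrC -subr_eq subrr => /eqP. Qed.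
Lemma br0r x : br x 0 = 0.
Proof. by have := brDr x 0 0; rewrite addr0 => /eqP; rewrite addrC -subr_eq subrr => /eqP. Qed.
Lemma brZl r x y : br (r *: x) y = r *: br x y.
Proof. by have := bracket_linearl (bracket_lie L) y r x 0; rewrite /= addr0 -/br br0l addr0. Qed.
Lemma brZr r x y : br x (r *: y) = r *: br x y.
Proof. by have := bracket_linearr (bracket_lie L) x r y 0; rewrite /= addr0 -/br br0r addr0. Qed.
Lemma brNl x y : br (- x) y = - br x y.
Proof. by rewrite -scaleN1r brZl scaleN1r. Qed.
Lemma brNr x y : br x (- y) = - br x y.
Proof. by rewrite -scaleN1r brZr scaleN1r. Qed.
Lemma br_suml (I : Type) (s : seq I) (P : pred I) (f : I -> L) y :
  br (\sum_(l <- s | P l) f l) y = \sum_(l <- s | P l) br (f l) y.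
Proof. exact: (big_morph (br^~ y) (fun a b => brDl a b y) (br0l y)). Qed.
Lemma br_sumr (I : Type) (s : seq I) (P : pred I) (f : I -> L) y :
  br y (\sum_(l <- s | P l) f l) = \sum_(l <- s | P l) br y (f l).
Proof. exact: (big_morph (br y) (brDr y) (br0r y)). Qed.
Lemma brC x y : br x y = - br y x. Proof. exact: bracket_skew (bracket_lie L) x y. Qed.
Lemma brxx x : br x x = 0.
Proof.
have /eqP := brC x x; rewrite -addr_eq0 -mulr2n -scaler_nat scaler_eq0 pnatr_eq0 /=.
by move/eqP.
Qed.

Lemma layer0 i : (1 <= i <= nu)%N -> layer L i 0.
Proof. by move=> /(@layer_subspace _ _ L _) []. Qed.
Lemma layerD i r x y : (1 <= i <= nu)%N -> layer L i x -> layer L i y -> layer L i (r *: x + y).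
Proof. by move=> /(@layer_subspace _ _ L _) [_]; apply. Qed.
Lemma layerZ i r x : (1 <= i <= nu)%N -> layer L i x -> layer L i (r *: x).
Proof. by move=> ii lx; rewrite -[_ *: _]addr0; apply: layerD => //; exact: layer0. Qed.

Lemma projP i r x y : (1 <= i <= nu)%N ->
  layer_proj i (r *: x + y) = r *: layer_proj i x + layer_proj i y.
Proof.
move=> ii; rewrite -{1}(proj_sum x) -{1}(proj_sum y) scaler_sumr -big_split/=.
rewrite (proj_uniq (h := fun i => r *: layer_proj i x + layer_proj i y))// => j jj.
by apply: layerD => //; exact: proj_layer.
Qed.
Lemma projD i x y : (1 <= i <= nu)%N ->
  layer_proj i (x + y) = layer_proj i x + layer_proj i y.
Proof. by move=> ii; rewrite -{1}[x]scale1r projP// scale1r. Qed.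
Lemma proj0 i : (1 <= i <= nu)%N -> layer_proj i (0 : L) = 0.
Proof. by move=> ii; have := projD 0 0 ii; rewrite addr0 => /eqP; rewrite addrC -subr_eq subrr => /eqP. Qed.
Lemma projZ i r x : (1 <= i <= nu)%N -> layer_proj i (r *: x) = r *: layer_proj i x.
Proof. by move=> ii; have := projP r x 0 ii; rewrite addr0 proj0// addr0. Qed.
Lemma projN i x : (1 <= i <= nu)%N -> layer_proj i (- x) = - layer_proj i x.
Proof. by move=> ii; rewrite -scaleN1r projZ// scaleN1r. Qed.
Lemma projB i x y : (1 <= i <= nu)%N ->
  layer_proj i (x - y) = layer_proj i x - layer_proj i y.
Proof. by move=> ii; rewrite projD// projN. Qed.
Lemma proj_sumr i (I : Type) (s : seq I) (P : pred I) (f : I -> L) : (1 <= i <= nu)%N ->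
  layer_proj i (\sum_(l <- s | P l) f l) = \sum_(l <- s | P l) layer_proj i (f l).
Proof.
by move=> ii; apply: (big_morph (layer_proj i)) => [x y|]; [exact: projD|exact: proj0].
Qed.

Lemma proj_on_layer i j x : (1 <= i <= nu)%N -> (1 <= j <= nu)%N -> layer L j x ->
  layer_proj i x = if i == j then x else 0.
Proof.
move=> ii jj lx; pose h k : L := if k == j then x else 0.
have hx : \sum_(1 <= k < nu.+1) h k = x.
  rewrite (bigD1_seq j) ?iota_uniq ?mem_index_iota//= /h eqxx big1 ?addr0//.
  by move=> k /negbTE ->.
rewrite -{1}hx (proj_uniq (h := h))// => k kk; rewrite /h.
by case: eqP => [->|_]//; exact: layer0.
Qed.

Lemma layer_ind (P : L -> Prop) :
  P 0 -> (forall x y, P x -> P y -> P (x + y)) ->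
  (forall i x, (1 <= i <= nu)%N -> layer L i x -> P x) -> forall x, P x.
Proof.
move=> P0 PD Pl x; rewrite -(proj_sum x) big_nat.
by elim/big_ind: _ => // i ii; apply: Pl (proj_layer _ ii); lia.
Qed.

Lemma eq_proj x y : (forall i, (1 <= i <= nu)%N -> layer_proj i x = layer_proj i y) -> x = y.
Proof.
move=> xy; rewrite -(proj_sum x) -(proj_sum y); apply: eq_big_nat => i ii.
by apply: xy; lia.
Qed.

(** Membership in H_k + ... + H_nu. Congruences modulo this filtration replace explicit computations
    with BCH terms. *)
Definition lower k x := forall i, (1 <= i <= nu)%N -> (i < k)%N -> layer_proj i x = 0.

Lemma lower0 k : lower k 0. Proof. by move=> i ii _; exact: proj0. Qed.
Lemma lowerD k x y : lower k x -> lower k y -> lower k (x + y).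
Proof. by move=> kx ky i ii ik; rewrite projD// kx// ky// addr0. Qed.
Lemma lowerZ k r x : lower k x -> lower k (r *: x).
Proof. by move=> kx i ii ik; rewrite projZ// kx// scaler0. Qed.
Lemma lowerN k x : lower k x -> lower k (- x).
Proof. by move=> kx; rewrite -scaleN1r; exact: lowerZ. Qed.
Lemma lowerB k x y : lower k x -> lower k y -> lower k (x - y).
Proof. by move=> kx ky; apply: lowerD => //; exact: lowerN. Qed.
Lemma lower_le j k x : (j <= k)%N -> lower k x -> lower j x.
Proof. by move=> jk kx i ii ij; apply: kx => //; exact: leq_trans jk. Qed.
Lemma lower1 x : lower 1 x. Proof. by case. Qed.
Lemma lower_top x : lower nu.+1 x -> x = 0.
Proof. by move=> kx; apply: eq_proj => i ii; rewrite kx ?proj0//; lia. Qed.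
Lemma lower_layer i k x : (1 <= i <= nu)%N -> (k <= i)%N -> layer L i x -> lower k x.
Proof. by move=> ii ki lx j jj jk; rewrite (proj_on_layer _ ii)// ltn_eqF//; lia. Qed.
Lemma lower_sum k (I : Type) (s : seq I) (P : pred I) (f : I -> L) :
  (forall l, P l -> lower k (f l)) -> lower k (\sum_(l <- s | P l) f l).
Proof. by move=> kf; elim/big_ind: _ => //; [exact: lower0|move=> *; exact: lowerD]. Qed.

Lemma bracket_layer i j x y : (1 <= i <= nu)%N -> (1 <= j <= nu)%N ->
  layer L i x -> layer L j y ->
  br x y = 0 \/ ((i + j <= nu)%N /\ layer L (i + j)%N (br x y)).
Proof.
move=> ii jj lx ly; have [ijn|ijn] := leqP (i + j)%N nu.
  by right; split => //; apply: layer_bracket => //; lia.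
by left; apply: (@layer_bracket0 _ _ L _ _ _ _ ii jj) ijn lx ly.
Qed.

Lemma lower_bracket j k x y : lower j x -> lower k y -> lower (j + k)%N (br x y).
Proof.
move=> jx ky; rewrite -(proj_sum x) -(proj_sum y) br_suml big_nat.
apply: lower_sum => p pp; rewrite br_sumr big_nat; apply: lower_sum => q qq.
have [pj|jp] := ltnP p j; first by rewrite jx// br0l; exact: lower0.
have [qk|kq] := ltnP q k; first by rewrite ky// br0r; exact: lower0.
have [->|[pq]] := bracket_layer pp qq (proj_layer x pp) (proj_layer y qq).
  exact: lower0.
by apply: lower_layer; lia.
Qed.

(** A derivation of the bracket, injective because layers start at index 1; this injectivity is what
    makes [affine_ad] faithful. *)
Definition degree x : L := \sum_(1 <= i < nu.+1) i%:R *: layer_proj i x.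

Lemma degreeP r x y : degree (r *: x + y) = r *: degree x + degree y.
Proof.
rewrite /degree scaler_sumr -big_split /=; apply: eq_big_nat => i ii.
by rewrite projP ?scalerDr ?scalerA 1?mulrC//; lia.
Qed.
Lemma degreeD x y : degree (x + y) = degree x + degree y.
Proof. by rewrite -{1}[x]scale1r degreeP scale1r. Qed.
Lemma degree0 : degree 0 = 0.
Proof. by have := degreeD 0 0; rewrite addr0 => /eqP; rewrite addrC -subr_eq subrr => /eqP. Qed.

Lemma proj_degree i x : (1 <= i <= nu)%N -> layer_proj i (degree x) = i%:R *: layer_proj i x.
Proof.
move=> ii; rewrite (proj_uniq (h := fun i => i%:R *: layer_proj i x))// => j jj.
by apply: layerZ => //; exact: proj_layer.
Qed.

Lemma degree_layer i x : (1 <= i <= nu)%N -> layer L i x -> degree x = i%:R *: x.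
Proof.
move=> ii lx; apply: eq_proj => j jj; rewrite proj_degree// projZ//.
by rewrite (proj_on_layer _ ii)//; case: eqP => [->//|_]; rewrite !scaler0.
Qed.

Lemma degree_inj : injective degree.
Proof.
move=> x y xy; apply: eq_proj => i ii; have := congr1 (layer_proj i) xy.
rewrite !proj_degree// => /eqP; rewrite -subr_eq0 -scalerBr scaler_eq0 pnatr_eq0.
by rewrite gtn_eqF ?subr_eq0//=; [move/eqP|lia].
Qed.

Lemma lower_degree k x : lower k (degree x) -> lower k x.
Proof.
move=> kx i ii ik; have /eqP := kx i ii ik; rewrite proj_degree// scaler_eq0 pnatr_eq0.
by rewrite gtn_eqF//=; [move/eqP|lia].
Qed.

Lemma degree_bracket x y : degree (br x y) = br (degree x) y + br x (degree y).
Proof.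
elim/layer_ind: x => [|x x' Hx Hx'|i x ii lx].
- by rewrite degree0 !br0l degree0 addr0.
- by rewrite brDl !degreeD Hx Hx' !brDl addrACA.
elim/layer_ind: y => [|y y' Hy Hy'|j y jj ly].
- by rewrite degree0 !br0r degree0 addr0.
- by rewrite brDr !degreeD Hy Hy' !brDr addrACA.
rewrite (degree_layer ii lx) (degree_layer jj ly) brZl brZr -scalerDl -natrD.
have [->|[ij]] := bracket_layer ii jj lx ly; first by rewrite degree0 scaler0.
by apply: degree_layer; lia.
Qed.

Lemma dilationP r c x y : dilation r (c *: x + y) = c *: dilation r x + dilation r y :> L.
Proof.
rewrite /dilation scaler_sumr -big_split /=; apply: eq_big_nat => i ii.
by rewrite projP ?scalerDr ?scalerA 1?mulrC//; lia.
Qed.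
Lemma dilationD r x y : dilation r (x + y) = dilation r x + dilation r y :> L.
Proof. by rewrite -{1}[x]scale1r dilationP scale1r. Qed.
Lemma dilation0r r : dilation r 0 = 0 :> L.
Proof. by have := dilationD r 0 0; rewrite addr0 => /eqP; rewrite addrC -subr_eq subrr => /eqP. Qed.
Lemma dilationZ r c x : dilation r (c *: x) = c *: dilation r x :> L.
Proof. by have := dilationP r c x 0; rewrite dilation0r !addr0. Qed.
Lemma dilationN r x : dilation r (- x) = - dilation r x :> L.
Proof. by rewrite -scaleN1r dilationZ scaleN1r. Qed.
Lemma proj_dilation i r x : (1 <= i <= nu)%N -> layer_proj i (dilation r x) = r ^+ i *: layer_proj i x.
Proof.
move=> ii; rewrite (proj_uniq (h := fun i => r ^+ i *: layer_proj i x))// => j jj.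
by apply: layerZ => //; exact: proj_layer.
Qed.
Lemma dilation_layer i r x : (1 <= i <= nu)%N -> layer L i x -> dilation r x = r ^+ i *: x.
Proof.
move=> ii lx; apply: eq_proj => j jj; rewrite proj_dilation// projZ//.
by rewrite (proj_on_layer _ ii)//; case: eqP => [->//|_]; rewrite !scaler0.
Qed.
Lemma dilationM r r' x : dilation r (dilation r' x) = dilation (r * r') x.
Proof. by apply: eq_proj => i ii; rewrite !proj_dilation// scalerA exprMn. Qed.
Lemma dilation1 x : dilation 1 x = x.
Proof. by apply: eq_proj => i ii; rewrite proj_dilation// expr1n scale1r. Qed.

Lemma dilation_bracket r x y : dilation r (br x y) = br (dilation r x) (dilation r y).
Proof.
elim/layer_ind: x => [|x x' Hx Hx'|i x ii lx].
- by rewrite dilation0r !br0l dilation0r.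
- by rewrite brDl !dilationD Hx Hx' !brDl.
elim/layer_ind: y => [|y y' Hy Hy'|j y jj ly].
- by rewrite dilation0r !br0r dilation0r.
- by rewrite brDr !dilationD Hy Hy' !brDr.
rewrite (dilation_layer _ ii lx) (dilation_layer _ jj ly) brZl brZr scalerA -exprD.
have [->|[ij]] := bracket_layer ii jj lx ly; first by rewrite dilation0r scaler0.
by apply: dilation_layer; lia.
Qed.

Lemma step_gt0 : (0 < nu)%N.
Proof.
rewrite lt0n; apply/negP => /eqP nu0; have [_ [w sw]] := bracket_nilpotent L.
have /size0nil -> : size w = 0%N by rewrite sw.
by rewrite eqxx.
Qed.

Lemma gmulE x y : gmul x y = \sum_(1 <= m < nu.+1) bch br m x y.
Proof.
rewrite /gmul /bch_mul; rewrite [RHS]big_ltn ?ltnS ?step_gt0// /bch homogeneous_word_sum1 /= invr1 scale1r; congr (_ + _).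
by apply: eq_bigr => m _; exact: bch_termE.
Qed.

Lemma dilation_gmul r x y : dilation r (gmul x y) = gmul (dilation r x) (dilation r y).
Proof.
rewrite !gmulE (big_morph (dilation r) (dilationD r) (dilation0r r)).
apply: eq_bigr => m _; rewrite /bch dilationZ; congr (_ *: _).
rewrite (homogeneous_word_sum_linear (f := dilation r)); last exact: dilationP.
apply: eq_homogeneous_word_sum => w _; elim/last_ind: w => [|w b IH].
  by rewrite /= dilation0r.
case: (posnP (size w)) => [/size0nil ->|w0]; first by case: b.
rewrite !map_rcons !left_bracket_rcons ?size_map// dilation_bracket IH.
by case: b.
Qed.

End graded_lie_algebra.

Section endo_filtration.
Context {R : realType} {V : lmodType R} (nzV : exists v : V, v != 0).
Variable W : nat -> V -> Prop.
Hypotheses (W0 : forall k, W k 0) (WD : forall k v w, W k v -> W k w -> W k (v + w)).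
Hypotheses (WZ : forall k c v, W k v -> W k (c *: v)) (WS : forall k v, W k.+1 v -> W k v).

Definition raises k (T : endo nzV) := forall j v, W j v -> W (j + k)%N (T v).

Lemma raises_filtration : filtration raises.
Proof.
split.
- by move=> k j v _; exact: W0.
- by move=> k a b Fa Fb j v Wv; apply: WD; [exact: Fa|exact: Fb].
- by move=> k c a Fa j v Wv; apply: WZ; exact: Fa.
- by move=> i j a b Fa Fb k v Wv; rewrite addnA; apply: Fb; exact: Fa.
- by move=> k a Fa j v Wv; apply: WS; rewrite -addnS; exact: Fa.
- by move=> j v Wv; rewrite addn0.
Qed.
End endo_filtration.

(** * The group law through a faithful nilpotent representation *)

Section group_law.
Context {R : realType} {nu : nat} {L : banach_homogeneous_group R nu}.
Implicit Types (x y z a b : L) (i j k : nat) (r : R).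

Local Notation br := (@bracket R nu L).
Let V0 : lmodType R := (R^o * L)%type.

Lemma affine_neq0 : exists v : V0, v != 0.
Proof. by exists (1, 0); rewrite xpair_eqE negb_and oner_neq0. Qed.
Let E0 := endo affine_neq0.

(* The right adjoint action of a on the extension of the Lie algebra by its
   degree derivation; unlike the adjoint action it is faithful, so that the
   associativity of gmul follows from that of composition. *)
Program Definition affine_ad a : E0 :=
  @Endo _ _ _ (fun v : V0 => (0, v.1 *: degree a + br v.2 a) : V0) _.
Next Obligation.
move=> a c [s v] [t w]; congr pair; rewrite /= ?scaler0 ?addr0//.
by rewrite scalerDl brDl brZl scalerDr scalerA addrACA.
Qed.

Lemma affine_adE a (v : V0) : affine_ad a v = (0, v.1 *: degree a + br v.2 a).
Proof. by []. Qed.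

Lemma affine_adP r a b : affine_ad (r *: a + b) = r *: affine_ad a + affine_ad b.
Proof.
apply: endoP => -[s v]; rewrite endoDE endoZE !affine_adE; congr pair; rewrite /= ?scaler0 ?addr0//.
by rewrite degreeP brDr brZr !scalerDr !scalerA mulrC addrACA.
Qed.

Lemma affine_adD a b : affine_ad (a + b) = affine_ad a + affine_ad b.
Proof. by rewrite -{1}[a]scale1r affine_adP scale1r. Qed.

Lemma affine_ad0 : affine_ad 0 = 0.
Proof. by have := affine_adP (-1) 0 0; rewrite scaler0 addr0 scaleN1r addNr. Qed.

Lemma affine_ad_inj : injective affine_ad.
Proof.
move=> a b /(congr1 (fun f : E0 => (f (1, 0)).2)); rewrite !affine_adE /= !scale1r !br0l.
by rewrite !addr0; exact: degree_inj.
Qed.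

Lemma affine_ad_bracket a b : affine_ad (br a b) = commutator (affine_ad a) (affine_ad b).
Proof.
apply: endoP => -[s v]; rewrite /commutator endoDE endoNE !endoME !affine_adE /=.
congr pair; rewrite /= ?subr0// !scale0r !add0r !brDl !brZl degree_bracket scalerDr.
have J := bracket_jacobi (bracket_lie L) v a b.
have -> : br v (br a b) = br (br v a) b - br (br v b) a.
  have := J; rewrite (brC b v) brNr (brC b (br v a)) (brC a (br v b)) opprK.
  move/eqP; rewrite -addrA addr_eq0 => /eqP ->.
  by rewrite opprD opprK addrC.
by rewrite (brC a (degree b)) scalerN opprD [RHS]addrACA.
Qed.

(** The summand [R] is placed in degree 0, below all layers, so that every [affine_ad a] raises
    degrees. *)
Definition affine_lower k (v : V0) := ((0 < k)%N -> v.1 = 0) /\ lower k v.2.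

Let F0 : nat -> E0 -> Prop := raises affine_lower.

Lemma affine_filtration : filtration F0.
Proof.
apply: raises_filtration.
- by move=> k; split=> //; exact: lower0.
- move=> k [s v] [t w] [/= s0 kv] [/= t0 kw]; split; last exact: lowerD.
  by move=> k0 /=; rewrite s0// t0// addr0.
- move=> k c [s v] [/= s0 kv]; split; last exact: lowerZ.
  by move=> k0 /=; rewrite s0// scaler0.
- move=> k [s v] [/= s0 kv]; split; first by move=> _; exact: s0.
  exact: lower_le kv.
Qed.

Lemma affine_lower_top v : affine_lower nu.+1 v -> v = 0.
Proof. by case: v => s v [/= s0 /lower_top ->]; rewrite s0. Qed.

Lemma affine_raises_top T : F0 nu.+1 T -> T = 0.
Proof.
by move=> FT; apply: endoP => v; apply: affine_lower_top; apply: (FT 0%N); split.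
Qed.

Lemma affine_adF k a : lower k a -> F0 k (affine_ad a).
Proof.
move=> ka j [s v] [/= s0 jv]; split=> //=; apply: lowerD; last exact: lower_bracket.
case: j s0 jv => [|j] s0 jv; last by rewrite s0// scale0r; exact: lower0.
apply: lowerZ => i ii ik; rewrite proj_degree// ka ?scaler0//.
Qed.

Lemma lower_affine_ad k a : F0 k (affine_ad a) -> lower k a.
Proof.
move=> /(_ 0%N (1, 0)); rewrite affine_adE /= scale1r br0l addr0 => -[|_].
  by split=> //=; exact: lower0.
exact: lower_degree.
Qed.

Let V : lmodType R := R -> V0.

Let V_neq0 : exists v : V, v != 0.
Proof.
have [v v0] := affine_neq0; exists (fun=> v); apply: contra_neq v0.
by move/(congr1 (fun f : V => f 0)).
Qed.
Let E := endo V_neq0.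

(** Dynkin's argument asks for an element whose bracket with every a is a itself, whereas the degree
    derivation multiplies H_i by i. Acting on functions of a real variable with a translation by [m]
    records the length of brackets, as a formal factor t^m would; [shift_degree] then plays the part
    of t d/dt. *)
Program Definition shift_ad m a : E :=
  @Endo _ _ _ (fun (u : V) (s : R) => affine_ad a (u (s - m%:R))) _.
Next Obligation.
by move=> m a c u w; apply/funext => s; rewrite endoD endoZ.
Qed.

Program Definition shift_degree : E := @Endo _ _ _ (fun (u : V) (s : R) => - s *: u s) _.
Next Obligation.
move=> c u w; apply/funext => s; rewrite [LHS]scalerDr; congr (_ + _).
by rewrite [LHS]scalerA [RHS]scalerA mulrC.
Qed.

Lemma shift_adE m a (u : V) s : shift_ad m a u s = affine_ad a (u (s - m%:R)).
Proof. by []. Qed.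

Lemma shift_adP m r a b : shift_ad m (r *: a + b) = r *: shift_ad m a + shift_ad m b.
Proof.
apply: endoP => u; apply/funext => s; rewrite shift_adE affine_adP.
by [].
Qed.

Lemma commutator_shift_ad i j a b :
  commutator (shift_ad i a) (shift_ad j b) = shift_ad (i + j) (br a b).
Proof.
apply: endoP => u; apply/funext => s; rewrite shift_adE affine_ad_bracket.
rewrite /commutator endoDE endoNE !endoME natrD.
have -> : s - (i%:R + j%:R) = s - i%:R - j%:R by rewrite opprD addrA.
transitivity (affine_ad b (affine_ad a (u (s - j%:R - i%:R))) -
              affine_ad a (affine_ad b (u (s - i%:R - j%:R)))); first by [].
by rewrite addrAC.
Qed.

Lemma commutator_shift_degree a : commutator shift_degree (shift_ad 1 a) = shift_ad 1 a.
Proof.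
apply: endoP => u; apply/funext => s; rewrite /commutator endoDE endoNE !endoME.
transitivity (affine_ad a (- (s - 1) *: u (s - 1)) - (- s *: affine_ad a (u (s - 1)))).
  by [].
by rewrite endoZ -scalerBl opprB opprK subrK scale1r.
Qed.

Let FE : nat -> E -> Prop := raises (fun k (u : V) => forall s, affine_lower k (u s)).

Lemma shift_filtration : filtration FE.
Proof.
have F := affine_filtration; apply: raises_filtration.
- by move=> k s; split=> //; exact: lower0.
- move=> k u w ku kw s; have [u0 lu] := ku s; have [w0 lw] := kw s.
  split; last exact: lowerD.
  by move=> k0 /=; rewrite u0// w0// addr0.
- move=> k c u ku s; have [u0 lu] := ku s; split; last exact: lowerZ.
  by move=> k0 /=; rewrite u0// scaler0.
- move=> k u ku s; have [u0 lu] := ku s; split; first by move=> _; exact: u0.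
  exact: lower_le lu.
Qed.

Lemma shift_raises_top (T : E) : FE nu.+1 T -> T = 0.
Proof.
move=> FT; apply: endoP => u; apply/funext => s; apply: affine_lower_top.
by apply: (FT 0%N) => {}s; split.
Qed.

Lemma shift_adF m a : FE 1 (shift_ad m a).
Proof. by move=> j u ju s; rewrite shift_adE; apply: affine_adF => //; exact: lower1. Qed.

Lemma bch_shift_ad m a b : (0 < m)%N ->
  bch (@commutator R E) m (shift_ad 1 a) (shift_ad 1 b) = shift_ad m (bch br m a b).
Proof.
move=> m0; rewrite /bch.
have sZ c v : shift_ad m (c *: v) = c *: shift_ad m v.
  have z : shift_ad m 0 = 0.
    have := shift_adP m (-1) 0 0; rewrite scaler0 addr0 scaleN1r addNr => ->.
    by [].
  by rewrite -[c *: v]addr0 shift_adP z addr0.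
rewrite sZ (homogeneous_word_sum_linear (f := shift_ad m)); last exact: shift_adP.
congr (_ *: _); apply: eq_homogeneous_word_sum => w wm.
have {m0} : (0 < size w)%N by rewrite wm.
rewrite -{}wm; elim/last_ind: w => // w b' IH _.
case: (posnP (size w)) => [/size0nil ->|w0]; first by case: b'.
rewrite !map_rcons !left_bracket_rcons ?size_map// IH//.
by rewrite size_rcons; case: b'; rewrite commutator_shift_ad addn1.
Qed.

Let N := (nu.+1 + nu.+1)%N.

Definition gexp a : E0 := nil_exp N (affine_ad a).

Lemma gexp_gmul a b : gexp a * gexp b = gexp (gmul a b).
Proof.
have := exp_bch (M := (nu + nu.+1)%N) shift_filtration shift_raises_top (leqnn _)
  (shift_adF 1 a) (shift_adF 1 b) (commutator_shift_degree a) (commutator_shift_degree b).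
rewrite -addSn -/N.
have -> : \sum_(1 <= m < nu.+1) bch (@commutator R E) m (shift_ad 1 a) (shift_ad 1 b) =
          \sum_(1 <= m < nu.+1) shift_ad m (bch br m a b).
  by apply: eq_big_nat => m /andP[m0 _]; exact: bch_shift_ad.
(* Translations are invisible on constant functions, where [shift_ad m c] acts as [affine_ad c]; the
   identity between operators on functions therefore descends to [V0]. *)
pose cst (v : V0) : V := fun=> v.
pose lifts (T : E) (T0 : E0) := forall v, T (cst v) = cst (T0 v).
have cst_sum (I : Type) (s : seq I) (f : I -> V0) :
    cst (\sum_(i <- s) f i) = \sum_(i <- s) cst (f i).
  by apply: (big_morph cst).
have liftsX T T0 k : lifts T T0 -> lifts (T ^+ k) (T0 ^+ k).
  by move=> TT; elim: k => [//|k IH] v; rewrite !exprS !endoME TT IH.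
have lifts_exp T T0 : lifts T T0 -> lifts (nil_exp N T) (nil_exp N T0).
  move=> TT v; rewrite /nil_exp !endo_sumE.
  rewrite cst_sum; apply: eq_bigr => k _; rewrite endoZE (liftsX _ _ _ TT).
  by [].
have lifts_ad m c : lifts (shift_ad m c) (affine_ad c) by [].
move=> EE; apply: endoP => v.
have /(congr1 (fun T : E => T (cst v) 0)) := EE.
rewrite !endoME (lifts_exp _ _ (lifts_ad 1%N a)) (lifts_exp _ _ (lifts_ad 1%N b)).
have lifts_sum : lifts (\sum_(1 <= m < nu.+1) shift_ad m (bch br m a b)) (affine_ad (gmul a b)).
  rewrite gmulE => w; rewrite endo_sumE.
  have -> : affine_ad (\sum_(1 <= m < nu.+1) bch br m a b) =
            \sum_(1 <= m < nu.+1) affine_ad (bch br m a b).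
    exact: (big_morph affine_ad affine_adD affine_ad0).
  by rewrite endo_sumE cst_sum.
by rewrite (lifts_exp _ _ lifts_sum).
Qed.

Lemma affine_ad_nilp a : affine_ad a ^+ N = 0.
Proof.
apply: (@expr0_le _ _ nu.+1); last exact: leq_addr.
apply: affine_raises_top.
by have := filtX affine_filtration nu.+1 (affine_adF (lower1 a)); rewrite mul1n.
Qed.

Lemma gexp_log a : nil_log N (gexp a - 1) = affine_ad a.
Proof. by apply: nil_logK; exact: affine_ad_nilp. Qed.

Lemma gexp_inj : injective gexp.
Proof. by move=> a b ab; apply: affine_ad_inj; rewrite -!gexp_log ab. Qed.

Lemma gexp0 : gexp 0 = 1.
Proof.
by rewrite /gexp affine_ad0 /N addSn nil_exp0.
Qed.

Lemma gmulA x y z : gmul x (gmul y z) = gmul (gmul x y) z.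
Proof. by apply: gexp_inj; rewrite -!gexp_gmul mulrA. Qed.

Lemma gmul0x x : gmul 0 x = x.
Proof. by apply: gexp_inj; rewrite -!gexp_gmul gexp0 mul1r. Qed.

Lemma gmulx0 x : gmul x 0 = x.
Proof. by apply: gexp_inj; rewrite -!gexp_gmul gexp0 mulr1. Qed.

Lemma gexpD x y : br x y = 0 -> gexp (x + y) = gexp x * gexp y.
Proof.
move=> xy; have cxy : commutator (affine_ad x) (affine_ad y) = 0.
  by rewrite -affine_ad_bracket xy affine_ad0.
rewrite /gexp affine_adD nil_expD//.
  by apply/eqP; rewrite -subr_eq0; apply/eqP.
move=> i j ij; apply: affine_raises_top.
apply: (filt_le affine_filtration (k := (1 * i + 1 * j)%N)); first by move: ij; rewrite /N; lia.
by apply: (filtM affine_filtration); apply: (filtX affine_filtration); apply: affine_adF; exact: lower1.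
Qed.

Lemma gmul_commute x y : br x y = 0 -> gmul x y = x + y.
Proof. by move=> xy; apply: gexp_inj; rewrite -gexp_gmul gexpD. Qed.

Lemma gmul_line r r' x : gmul (r *: x) (r' *: x) = (r + r') *: x.
Proof. by rewrite gmul_commute ?scalerDl// brZl brZr brxx !scaler0. Qed.

Lemma gmulxN x : gmul x (- x) = 0.
Proof. by rewrite gmul_commute ?subrr// brNr brxx oppr0. Qed.
Lemma gmulNx x : gmul (- x) x = 0.
Proof. by rewrite -{2}[x]opprK gmulxN. Qed.

Lemma gmulKV x y : gmul x (gmul (- x) y) = y.
Proof. by rewrite gmulA gmulxN gmul0x. Qed.
Lemma gmulVK x y : gmul (- x) (gmul x y) = y.
Proof. by rewrite gmulA gmulNx gmul0x. Qed.

Lemma gmulN x y : - gmul x y = gmul (- y) (- x).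
Proof.
rewrite -[RHS](gmulVK (gmul x y)) -!gmulA (gmulA y) gmulxN gmul0x gmulxN.
by rewrite gmulx0.
Qed.

Lemma gexp_sub1F k x : lower k x -> F0 k (gexp x - 1).
Proof. by move=> kx; rewrite /gexp /N addSn; apply: (filt_exp affine_filtration); exact: affine_adF. Qed.

Lemma gexp_approx k x : (0 < k)%N -> lower k x -> F0 k.+1 (gexp x - 1 - affine_ad x).
Proof.
move=> k0 kx; apply: (filt_le affine_filtration (k := (k + k)%N)); first by lia.
have -> : gexp x = nil_exp (nu + nu).+2 (affine_ad x) by rewrite /gexp /N addSn addnS.
by apply: (filt_exp1 affine_filtration); exact: affine_adF.
Qed.

Lemma lower_gexp k x : F0 k (gexp x - 1) -> lower k x.
Proof.
by move=> kx; apply: lower_affine_ad; rewrite -gexp_log; apply: (filt_log affine_filtration).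
Qed.

Lemma affine_adB x y : affine_ad (x - y) = affine_ad x - affine_ad y.
Proof.
by rewrite -scaleN1r addrC affine_adP scaleN1r addrC.
Qed.

Let cong k (S T : E0) := F0 k (S - T).
Let congC k S T : cong k S T -> cong k T S.
Proof. by rewrite /cong => /(filtN affine_filtration); rewrite opprB. Qed.
Let cong_trans k S T U : cong k S T -> cong k T U -> cong k S U.
Proof.
by rewrite /cong => ST TU; rewrite -(subrK T S) -addrA; exact: (filtD affine_filtration).
Qed.
Let congD k S T S' T' : cong k S T -> cong k S' T' -> cong k (S + S') (T + T').
Proof.
by rewrite /cong => ST ST'; rewrite opprD addrACA; exact: (filtD affine_filtration).
Qed.
Let congN k S T : cong k S T -> cong k (- S) (- T).
Proof. by rewrite /cong => ST; rewrite -opprD; exact: (filtN affine_filtration). Qed.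
Let congM i j k S T S' T' : (k <= i.+1 + j)%N -> (k <= i + j.+1)%N -> F0 j S' -> F0 i T ->
  cong i.+1 S T -> cong j.+1 S' T' -> cong k (S * S') (T * T').
Proof.
have fF := affine_filtration.
rewrite /cong => ki kj FS' FT ST ST'.
rewrite -(subrK (T * S') (S * S')) -addrA -mulrBl -mulrBr; apply: (filtD fF).
  exact: (filt_le fF ki) (filtM fF ST FS').
exact: (filt_le fF kj) (filtM fF FT ST').
Qed.

(** With X and Y the exponentials, XY - 1 is the sum of X - 1, Y - 1 and their product. The product
    has degree 2k > k, and X - 1 agrees with [affine_ad x] up to degree k + 1. *)
Lemma lower_gmul k x y : (0 < k)%N -> lower k x -> lower k y ->
  lower k.+1 (gmul x y - (x + y)).
Proof.
move=> k0 kx ky; have fF := affine_filtration.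
have Fx := gexp_sub1F kx; have Fy := gexp_sub1F ky.
have Exy : gexp (gmul x y) - 1 =
    (gexp x - 1) * (gexp y - 1) + ((gexp x - 1) + (gexp y - 1)).
  rewrite -gexp_gmul; move: (gexp x) (gexp y) => X Y.
  by rewrite addrA -{2}(mulr1 (X - 1)) -mulrDr subrK mulrBl mul1r addrA subrK.
have Fxy : F0 (k + k)%N ((gexp x - 1) * (gexp y - 1)) by exact: (filtM fF).
have kxy : lower k (gmul x y).
  apply: lower_gexp; rewrite Exy; apply: (filtD fF); last exact: (filtD fF).
  by apply: (filt_le fF) Fxy; exact: leq_addr.
apply: lower_affine_ad; rewrite affine_adB affine_adD -/(cong _ _ _).
apply: (cong_trans (T := gexp (gmul x y) - 1)); first by apply: congC; exact: gexp_approx.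
rewrite Exy -[X in cong _ _ X]add0r; apply: congD.
  by rewrite /cong subr0; apply: (filt_le fF) Fxy; lia.
by apply: congD; exact: gexp_approx.
Qed.

(** With a = X - 1 and b = Y - 1 one has XY - YX = ab - ba, so the group commutator is 1 + (ab - ba)
    Z, where Z is the exponential of [z]. Modulo degree k + 2, Z may be replaced by 1, and a and b
    by their linear parts. *)
Lemma lower_gcommutator k x y : lower k y -> (0 < k)%N ->
  lower k.+2 (gmul (gmul x y) (gmul (- x) (- y)) - br x y).
Proof.
move=> ky k0; have fF := affine_filtration; have x1 := lower1 x.
have Fx := gexp_sub1F x1; have Fy := gexp_sub1F ky.
set c := gmul _ _; set a := gexp x - 1 in Fx; set b := gexp y - 1 in Fy.
set z := gmul (- x) (- y) in c *.
have Ec : gexp c - 1 = (a * b - b * a) * gexp z.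
  have z1 : gexp y * gexp x * gexp z = 1.
    by rewrite /z !gexp_gmul !gmulA -(gmulA y) (gmulxN x) gmulx0 (gmulxN y) gexp0.
  rewrite -{1}z1 /c -!gexp_gmul -/z -mulrBl; congr (_ * _).
  rewrite /a /b; move: (gexp x) (gexp y) => X Y.
  have sub1M (S T : E0) : (S - 1) * (T - 1) = S * T - (S + (T - 1)).
    by rewrite mulrBl mul1r mulrBr mulr1 [in RHS](opprD S) addrA.
  rewrite !sub1M (addrCA Y); move: (X + (Y - 1)) => S.
  by rewrite opprB addrA subrK.
have ab : cong k.+2 (a * b - b * a) (affine_ad (br x y)).
  rewrite affine_ad_bracket; apply: congD.
    apply: (congM (i := 1%N) (j := k)) => //; [exact: affine_adF| |];
      exact: gexp_approx.
  apply: congN; apply: (congM (i := k) (j := 1%N)); rewrite ?addn1 ?addn2//;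
    [exact: affine_adF| |]; exact: gexp_approx.
have Fab : F0 k.+1 (a * b - b * a).
  apply: (filtB fF); first by rewrite -add1n; exact: (filtM fF).
  by rewrite -addn1; exact: (filtM fF).
have Fz : F0 1 (gexp z - 1) by apply: gexp_sub1F; exact: lower1.
have cc : cong k.+2 (gexp c - 1) (affine_ad (br x y)).
  apply: cong_trans ab; rewrite Ec /cong -{2}[a * b - b * a]mulr1 -mulrBr.
  by rewrite -[k.+2]addn1; exact: (filtM fF).
have kc : lower k.+1 c.
  apply: lower_gexp; rewrite -(subrK (affine_ad (br x y)) (gexp c - 1)).
  apply: (filtD fF); first exact: (filt_le fF) cc.
  by apply: affine_adF; rewrite -add1n; apply: lower_bracket => //; exact: lower1.
apply: lower_affine_ad; rewrite affine_adB; apply: cong_trans cc; apply: congC.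
by apply: (filt_le fF) (gexp_approx _ kc).
Qed.

End group_law.

(** * Norm estimates for the group law *)

Section bracket_estimates.
Context {R : realType} {nu : nat} {L : banach_homogeneous_group R nu}.
Implicit Types (x y z a b p q : L) (i j k : nat) (r : R).

Local Notation br := (@bracket R nu L).

Lemma bracket_bounded : exists2 K : R, 0 < K & forall x y, `|br x y| <= K * `|x| * `|y|.
Proof.
have := @bracket_continuous _ _ _ (bracket_lie L) (0, 0).
rewrite /continuous_at /= br0l => /cvgrPdist_lt /(_ 1 ltr01) /nbhs_ballP [e /= e0 He].
have [d d0 de] : exists2 d : R, 0 < d & d < e.
  by exists (e / 2); rewrite ?divr_gt0// ltr_pdivrMr// mulr_natr mulr2n ltrDl.
have small x : x != 0 -> ball 0 e ((d / `|x|) *: x).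
  move=> x0; rewrite -ball_normE /= sub0r normrN normrZ ?normrM normfV normr_id.
  by rewrite divfK ?normr_eq0// gtr0_norm.
exists (d ^- 2); first by rewrite invr_gt0 exprn_gt0.
move=> x y; have [->|x0] := eqVneq x 0; first by rewrite br0l !normr0 mulr0 mul0r.
have [->|y0] := eqVneq y 0; first by rewrite br0r !normr0 mulr0.
have := He ((d / `|x|) *: x, (d / `|y|) *: y) (conj (small x x0) (small y y0)).
rewrite /= sub0r normrN brZl brZr !normrZ ?normrM !normfV !normr_id (gtr0_norm d0) => /ltW.
have nx : 0 < `|x| by rewrite normr_gt0.
have ny : 0 < `|y| by rewrite normr_gt0.
have -> : d / `|x| * (d / `|y| * `|br x y|) = `|br x y| / (d ^- 2 * `|x| * `|y|).
  by rewrite !invfM invrK; field; rewrite !gt_eqF.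
by rewrite ler_pdivrMr ?mul1r// !mulr_gt0// invr_gt0 exprn_gt0.
Qed.

Definition ev (w : seq bool) p a : L := left_bracket br [seq if l then p else a | l <- w].

Lemma ev_rcons w l p a : (0 < size w)%N ->
  ev (rcons w l) p a = br (ev w p a) (if l then p else a).
Proof. by move=> w0; rewrite /ev map_rcons left_bracket_rcons ?size_map. Qed.

Lemma ev_constant w p a : (1 < size w)%N -> false \notin w -> ev w p a = 0.
Proof.
elim/last_ind: w => // w l IH; rewrite size_rcons ltnS mem_rcons inE negb_or => w0.
case/andP; case: l => // _ wf; rewrite ev_rcons//.
have [w1|w1] := ltnP 1 (size w); first by rewrite IH// br0l.
by case: w w0 w1 wf {IH} => [|[] [|? ?]]//= _ _ _; rewrite /ev /= brxx.
Qed.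

Lemma ev_bounded (B : R) w : exists2 C : R, 0 <= C &
  forall p a, `|p| <= B -> `|a| <= B -> `|ev w p a| <= C.
Proof.
have [K K0 HK] := bracket_bounded.
elim/last_ind: w => [|w l [C C0 IH]]; first by exists 0 => // p a _ _; rewrite normr0.
case: (posnP (size w)) => [/size0nil ->|w0].
  by exists `|B|; case: l => // p a pB aB; apply: le_trans (ler_norm B).
exists (K * C * `|B|); first by rewrite !mulr_ge0// ltW.
move=> p a pB aB; rewrite ev_rcons//; apply: (le_trans (HK _ _)).
apply: ler_pM; rewrite ?mulr_ge0 ?(ltW K0)//.
  by rewrite ler_wpM2l ?(ltW K0)//; exact: IH.
by case: l; exact: le_trans (ler_norm B).
Qed.

Lemma ev_small (B : R) w : false \in w -> exists2 C : R, 0 <= C &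
  forall p a, `|p| <= B -> `|a| <= B -> `|ev w p a| <= C * `|a|.
Proof.
have [K K0 HK] := bracket_bounded.
elim/last_ind: w => // w l IH wl.
case: (posnP (size w)) => [/size0nil w0|w0].
  rewrite {}w0 in wl *; exists 1 => // p a _ _; case: l wl => //= _.
  by rewrite mul1r.
case: l wl => wl.
  have /IH [C C0 HC] : false \in w by move: wl; rewrite mem_rcons.
  exists (K * C * `|B|); first by rewrite !mulr_ge0// ltW.
  move=> p a pB aB; rewrite ev_rcons//; apply: (le_trans (HK _ _)).
  rewrite [leRHS]mulrAC; apply: ler_pM; rewrite ?mulr_ge0 ?(ltW K0)//.
    by rewrite -mulrA ler_wpM2l ?(ltW K0)//; exact: HC.
  exact: le_trans (ler_norm B).
have [C C0 HC] := ev_bounded B w.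
exists (K * C); first by rewrite mulr_ge0// ltW.
move=> p a pB aB; rewrite ev_rcons//; apply: (le_trans (HK _ _)).
by rewrite ler_wpM2r// ler_wpM2l ?(ltW K0)//; exact: HC.
Qed.

(** The variation of the first factor is weighted by the size of the increment [b]. Such a weight is
    available because a nested bracket of length at least 2 in [p] alone is zero. *)
Definition step_bound (B C : R) (phi : L * L -> L) := forall p q a b,
  `|p| <= B -> `|q| <= B -> `|a| <= B -> `|b| <= B ->
  `|phi (p, a) - phi (q, b)| <= C * (`|p - q| * `|b| + `|a - b|).

Lemma ev_step (B : R) w : (1 < size w)%N ->
  exists2 C : R, 0 <= C & step_bound B C (fun t => ev w t.1 t.2).
Proof.
have [K K0 HK] := bracket_bounded; have K0' := ltW K0.
(* The induction passes through the word [[:: true]], for which the bound fails. Its extra term is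
   harmless: the next letter is either [p], and the bracket vanishes, or an increment, which
   supplies the missing factor. *)
suff: (0 < size w)%N -> exists2 C : R, 0 <= C & forall p q a b,
    `|p| <= B -> `|q| <= B -> `|a| <= B -> `|b| <= B ->
    `|ev w p a - ev w q b| <= C * (`|p - q| * `|b| + `|a - b|)
                              + (if w == [:: true] then `|p - q| else 0).
  move=> H w1; have [C C0 HC] := H (ltnW w1); exists C => // p q a b pB qB aB bB.
  by have := HC p q a b pB qB aB bB; case: eqP => [w2|_]; rewrite ?addr0//; rewrite w2 in w1.
elim/last_ind: w => // w l IH _.
case: (posnP (size w)) => [/size0nil ->|w0].
  exists 1 => // p q a b pB qB aB bB; rewrite mul1r; case: l => /=.
    by rewrite lerDr addr_ge0// mulr_ge0.
  by rewrite addr0 lerDr mulr_ge0.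
have wt : (rcons w l == [:: true]) = false.
  by apply/eqP => /(congr1 size); rewrite size_rcons => -[] /eqP; rewrite gtn_eqF.
rewrite wt; have [C C0 HC] := IH w0.
have [C' C'0 HC'] := ev_bounded B w.
case: (boolP (false \in rcons w l)) => wf; last first.
  exists 0 => // p q a b _ _ _ _; rewrite !ev_constant ?size_rcons//.
  by rewrite subrr normr0 mul0r addr0.
have split_br p q a b : `|ev (rcons w l) p a - ev (rcons w l) q b| <=
    K * `|ev w p a - ev w q b| * `|if l then q else b| +
    K * `|ev w p a| * `|(if l then p else a) - (if l then q else b)|.
  rewrite !ev_rcons//; set u := ev w p a; set u' := ev w q b.
  set v := if l then p else a; set v' := if l then q else b.
  have -> : br u v - br u' v' = br (u - u') v' + br u (v - v').
    by rewrite brDl brNl brDr brNr [RHS]addrC addrA subrK.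
  by apply: (le_trans (ler_normD _ _)); apply: lerD.
(* If the last letter is [p], the prefix already contains an increment, so [ev_small] bounds it by a
   multiple of the norm of [a], which is compared with that of [b]. *)
case: l wf split_br {wt} => wf split_br.
  have {}wf : false \in w by move: wf; rewrite mem_rcons.
  have [C'' C''0 HC''] := ev_small B wf.
  have wt : (w == [:: true]) = false by apply/eqP => w1; rewrite w1 in wf.
  rewrite wt in HC.
  exists (K * C * `|B| + K * C'' * (1 + 2 * `|B|)).
    by rewrite addr_ge0// ?mulr_ge0// addr_ge0// mulr_ge0.
  move=> p q a b pB qB aB bB; rewrite addr0; apply: (le_trans (split_br p q a b)).
  have {}HC := HC p q a b pB qB aB bB; rewrite addr0 in HC.
  set X := `|p - q| * `|b| + `|a - b| in HC *.
  have X0 : 0 <= X by rewrite addr_ge0// mulr_ge0.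
  rewrite mulrDl; apply: lerD.
    rewrite -mulrA -[leRHS]mulrA -[leRHS]mulrA ler_wpM2l//.
    rewrite [in leRHS]mulrCA [in leRHS]mulrC; apply: ler_pM => //.
    exact: le_trans (ler_norm B).
  apply: (@le_trans _ _ (K * (C'' * `|a|) * `|p - q|)).
    by rewrite ler_wpM2r// ler_wpM2l//; exact: HC''.
  rewrite -!mulrA ler_wpM2l// ler_wpM2l//.
  have aab : `|a| <= `|b| + `|a - b| by rewrite -{1}(subrK b a) addrC ler_normD.
  have pq2 : `|p - q| <= 2 * `|B|.
    rewrite (le_trans (ler_normB _ _))// mulr_natl mulr2n lerD//.
      exact: le_trans (ler_norm B).
    exact: le_trans (ler_norm B).
  apply: (@le_trans _ _ ((`|b| + `|a - b|) * `|p - q|)); first by rewrite ler_wpM2r.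
  have := normr_ge0 B; have := normr_ge0 (a - b); have := normr_ge0 (p - q).
  have := normr_ge0 b; rewrite /X.
  move: (`|p - q|) (`|b|) (`|a - b|) (`|B|) pq2 => P b' D B' pq2 b0 P0 D0 B0.
  have h1 : D * P <= D * (2 * B') by rewrite ler_wpM2l.
  have h2 : 0 <= B' * (P * b') by rewrite !mulr_ge0.
  nra.
exists (K * (C * `|B| + 1 + C')).
  by rewrite mulr_ge0// addr_ge0// addr_ge0// mulr_ge0.
move=> p q a b pB qB aB bB; rewrite addr0; apply: (le_trans (split_br p q a b)).
have {}HC : `|ev w p a - ev w q b| <= C * (`|p - q| * `|b| + `|a - b|) + `|p - q|.
  by apply: (le_trans (HC p q a b pB qB aB bB)); rewrite lerD2l; case: ifP.
rewrite /= -!mulrA -mulrDr ler_wpM2l//.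
apply: (@le_trans _ _ ((C * (`|p - q| * `|b| + `|a - b|) + `|p - q|) * `|b| + C' * `|a - b|)).
  by apply: lerD; rewrite ler_wpM2r//; exact: HC'.
have bB' : `|b| <= `|B| by exact: le_trans (ler_norm B).
have := normr_ge0 B; have := normr_ge0 (a - b); have := normr_ge0 (p - q); have := normr_ge0 b.
move: (`|p - q|) (`|b|) (`|a - b|) (`|B|) bB' => P b' D B' *.
have -> : (C * (P * b' + D) + P) * b' + C' * D = C * (P * b' + D) * b' + P * b' + C' * D by ring.
have -> : (C * B' + 1 + C') * (P * b' + D) =
  C * (P * b' + D) * B' + P * b' + C' * D + (D + C' * (P * b')) by ring.
have : C * (P * b' + D) * b' <= C * (P * b' + D) * B'.
  by rewrite ler_wpM2l// mulr_ge0// addr_ge0// mulr_ge0.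
have : 0 <= D + C' * (P * b') by rewrite addr_ge0// !mulr_ge0.
lra.
Qed.

(** The linear part of the product gives the coefficient exactly 1, and all brackets carry the norm
    of [b]. Over N steps with increments of size O(1/N), an error is thus amplified by a bounded
    factor. *)
Lemma gmul_step (B : R) : exists2 C : R, 0 <= C & forall p q a b,
  `|p| <= B -> `|q| <= B -> `|a| <= B -> `|b| <= B ->
  `|gmul p a - gmul q b| <= `|p - q| * (1 + C * `|b|) + C * `|a - b|.
Proof.
pose Q (phi : L * L -> L) := exists2 C : R, 0 <= C & step_bound B C phi.
have Q0 : Q (fun=> 0).
  by exists 0 => // p q a b _ _ _ _; rewrite subrr normr0 mul0r.
have QD f g : Q f -> Q g -> Q (fun t => f t + g t).
  move=> [C C0 HC] [C' C'0 HC']; exists (C + C'); first exact: addr_ge0.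
  move=> p q a b pB qB aB bB; rewrite opprD addrACA mulrDl.
  by apply: (le_trans (ler_normD _ _)); apply: lerD; [exact: HC|exact: HC'].
have QZ c f : Q f -> Q (fun t => c *: f t).
  move=> [C C0 HC]; exists (`|c| * C); first exact: mulr_ge0.
  move=> p q a b pB qB aB bB; rewrite -scalerBr normrZ -mulrA ler_wpM2l//.
  exact: HC.
have Qs (s : seq nat) : all (leq 2) s -> Q (fun t => \sum_(m <- s) bch_term br m t.1 t.2).
  elim: s => [_|m s IH /= /andP[m2 /IH {}IH]].
    by rewrite (_ : (fun _ => _) = fun=> 0)//; apply/funext => t; rewrite big_nil.
  rewrite (_ : (fun _ => _) = fun t => m%:R^-1 *: homogeneous_word_sum m
      (fun w => ev w t.1 t.2) + \sum_(m <- s) bch_term br m t.1 t.2).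
    apply: (QD) => //; apply: (QZ); apply: homogeneous_word_sum_closed => // w wm.
    by have := @ev_step B w; rewrite wm => /(_ m2).
  by apply/funext => t; rewrite big_cons bch_termE.
have [C C0 HC] := Qs (index_iota 2 nu.+1) ltac:(by apply/allP => m; rewrite mem_index_iota => /andP[]).
exists (1 + C); first exact: addr_ge0.
move=> p q a b pB qB aB bB; rewrite /gmul /bch_mul.
have {}HC := HC p q a b pB qB aB bB; rewrite /= in HC.
set S := \sum_(_ <= _ < _) _ in HC *; set S' := \sum_(_ <= _ < _) _ in HC *.
have -> : p + a + S - (q + b + S') = (p - q) + (a - b) + (S - S').
  by rewrite !opprD addrACA (addrACA p).
apply: (le_trans (ler_normD _ _)).
apply: (le_trans (lerD (ler_normD _ _) HC)).
have := normr_ge0 (a - b); have := normr_ge0 (p - q); have := normr_ge0 b.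
move: (`|p - q|) (`|b|) (`|a - b|) => P b' D *.
have -> : P * (1 + (1 + C) * b') + (1 + C) * D = P + D + C * (P * b' + D) + P * b' by ring.
by rewrite lerDl mulr_ge0.
Qed.

Lemma gmul_continuous : continuous (fun t : L * L => gmul t.1 t.2).
Proof.
have Qev w : continuous (fun t : L * L => ev w t.1 t.2).
  elim/last_ind: w => [|w l IH]; first by move=> t; exact: cvg_cst.
  have Ql : continuous (fun t : L * L => if l then t.1 else t.2).
    by case: l => t; [exact: cvg_fst|exact: cvg_snd].
  case: (posnP (size w)) => [/size0nil ->|w0]; first by move: Ql; case: l.
  under eq_fun do rewrite ev_rcons//.
  move=> t; apply: (@continuous_comp _ _ _
    (fun t : L * L => (ev w t.1 t.2, if l then t.1 else t.2)) (fun u : L * L => br u.1 u.2)).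
    by apply: cvg_pair; [exact: IH|exact: Ql].
  exact: bracket_continuous (bracket_lie L) _.
have QD (f g : L * L -> L) : continuous f -> continuous g -> continuous (fun t => f t + g t).
  by move=> cf cg t; apply: continuousD; [exact: cf|exact: cg].
have QZ (c : R) (f : L * L -> L) : continuous f -> continuous (fun t => c *: f t).
  by move=> cf t; apply: cvgZl_tmp; exact: cf.
rewrite (_ : (fun _ => _) = fun t => \sum_(m <- index_iota 1 nu.+1) m%:R^-1 *:
    homogeneous_word_sum m (fun w => ev w t.1 t.2)); last first.
  by apply/funext => t; rewrite gmulE.
elim: (index_iota _ _) => [|m s IH]; first by under eq_fun do rewrite big_nil; move=> t; exact: cvg_cst.
under eq_fun do rewrite big_cons; apply: (QD) => //; apply: (QZ).
by apply: (@homogeneous_word_sum_closed _ _ _ (fun f => continuous f)) => // t; exact: cvg_cst.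
Qed.

End bracket_estimates.

Section homogeneous_norm_estimates.
Context {R : realType} {nu : nat} {L : banach_homogeneous_group R nu}.
Variable sigma : nat -> R.
Hypothesis sigma_gt0 : forall i, (1 <= i <= nu)%N -> 0 < sigma i.

Lemma homogeneous_norm_proj (x : L) r i : (1 <= i <= nu)%N ->
  homogeneous_norm sigma x <= r -> `|layer_proj i x| <= (r / sigma i) ^+ i.
Proof.
move=> ii xr; have s0 := sigma_gt0 ii.
have : sigma i * `|layer_proj i x| `^ (i%:R^-1) <= r.
  apply: le_trans xr; rewrite /homogeneous_norm.
  by apply: (le_bigmax_seq 0 i xpredT) => //; rewrite mem_index_iota; lia.
rewrite mulrC -ler_pdivlMr// => H.
have -> : `|layer_proj i x| = (`|layer_proj i x| `^ (i%:R^-1)) ^+ i.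
  rewrite -powR_mulrn ?powR_ge0// -powRrM mulVf ?powRr1//.
  by rewrite pnatr_eq0; lia.
by apply: lerXn2r => //; rewrite nnegrE ?powR_ge0// (le_trans (powR_ge0 _ _) H).
Qed.

End homogeneous_norm_estimates.

Lemma discrete_gronwall (R : realType) (c : R) (e eta : nat -> R) n :
  0 <= c -> e 0%N = 0 -> (forall k, (k < n)%N -> e k.+1 <= e k * (1 + c) + eta k) ->
  (forall k, (k < n)%N -> 0 <= eta k) ->
  e n <= expR (c * n%:R) * \sum_(k < n) eta k.
Proof.
move=> c0 e0 eS eta0.
have : e n <= (1 + c) ^+ n * \sum_(k < n) eta k.
  elim: n eS eta0 => [|n IH] eS eta0; first by rewrite e0 big_ord0 mulr0.
  have {}IH := IH (fun k kn => eS k (ltnW kn)) (fun k kn => eta0 k (ltnW kn)).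
  apply: (le_trans (eS n _)) => //; rewrite big_ord_recr /= [leRHS]mulrDr; apply: lerD.
    by rewrite exprS mulrC -mulrA ler_wpM2l// addr_ge0.
  by rewrite ler_peMl ?eta0// exprn_ege1// lerDl.
move=> /le_trans; apply; apply: ler_wpM2r; first by rewrite sumr_ge0// => k _; exact: eta0.
rewrite mulrC expRM_natl; apply: lerXn2r; rewrite ?nnegrE ?expR_ge0 ?addr_ge0//.
exact: expR_ge1Dx.
Qed.

(** * Chains of increments *)

Section homogeneous_distance_theory.
Context {R : realType} {s : nat} {G : banach_homogeneous_group R s}.
Variables (d : G -> G -> R) (hd : homogeneous_distance d).
Implicit Types (x y z zeta : G) (r t : R).

Lemma hdistxx x : d x x = 0. Proof. exact/(hdist_eq0 hd). Qed.

Lemma hdist_ge0 x y : 0 <= d x y.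
Proof.
have := hdist_triangle hd x y x; rewrite hdistxx (hdist_sym hd y x) -mulr2n.
by rewrite -mulr_natl pmulr_rge0.
Qed.

Lemma dilation_layer1 t zeta : layer G 1 zeta -> dilation t zeta = t *: zeta.
Proof. by move=> lz; rewrite (dilation_layer _ (i := 1%N)) ?expr1// (@step_gt0 _ _ G). Qed.

Lemma hdist_line x zeta r t : layer G 1 zeta ->
  d (gmul x (r *: zeta)) (gmul x (t *: zeta)) = `|r - t| * d 0 zeta.
Proof.
move=> lz; rewrite (hdist_gmul hd); wlog rt : r t / r <= t => [H|].
  have [|/ltW] := leP r t; first exact: H.
  by move=> /H {}H; rewrite (hdist_sym hd) H distrC.
rewrite -{1}[r *: zeta]gmulx0 -{1}(subrK r t) addrC -gmul_line (hdist_gmul hd).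
have [->|rt'] := eqVneq r t; first by rewrite subrr scale0r hdistxx normr0 mul0r.
have {}rt : 0 < t - r by rewrite subr_gt0 lt_neqAle rt'.
rewrite -(dilation_layer1 _ lz) -{1}(dilation0r (t - r)) (hdist_dilation hd)//.
by rewrite distrC gtr0_norm.
Qed.

End homogeneous_distance_theory.

Section pansu_differentiability.
Context {R : realType} {s nu : nat}.
Context (G : banach_homogeneous_group R s) (M : banach_homogeneous_group R nu).
Variables (d : G -> G -> R) (hd : homogeneous_distance d).
Variable sigma : nat -> R.
Hypothesis sigma1 : sigma 1%N = 1.
Hypothesis sigma_gt0 : forall i, (1 <= i <= nu)%N -> 0 < sigma i.
Let rho : M -> M -> R := homogeneous_norm_dist sigma.
Let nu_gt0 : (1 <= 1 <= nu)%N. Proof. by rewrite (@step_gt0 _ _ M). Qed.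

(** Brackets live in layers of index at least 2, so the first projection turns products into
    sums. *)
Lemma proj1_gmul (u w : M) : layer_proj 1 (gmul (- u) w) = layer_proj 1 w - layer_proj 1 u.
Proof.
have := lower_gmul (ltnSn 0) (lower1 (- u)) (lower1 w) nu_gt0 (ltnSn 1).
by rewrite projB// projD// projN// => /eqP; rewrite subr_eq0 addrC => /eqP.
Qed.

Lemma proj1_dist (u w : M) : `|layer_proj 1 w - layer_proj 1 u| <= rho u w.
Proof.
have := homogeneous_norm_proj sigma_gt0 nu_gt0 (lexx (homogeneous_norm sigma (gmul (- u) w))).
by rewrite proj1_gmul sigma1 divr1 expr1.
Qed.

Section increments.
Variable K : R.
Hypothesis K_ge0 : 0 <= K.

(** For [0 <= tau <= 2] the power [tau ^+ i] is at most [2 ^+ i] times [tau], and for i >= 2 also at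
    most [2 ^+ i] times [tau ^+ 2]; hence the powers of 2. *)
Let C1 : R := \sum_(1 <= i < nu.+1) 2 ^+ i * (K / sigma i) ^+ i.

Lemma increment_const_ge0 : 0 <= C1.
Proof.
rewrite /C1 big_nat; apply: sumr_ge0 => i ii.
have s0 : 0 < sigma i by apply: sigma_gt0; lia.
by rewrite mulr_ge0 ?exprn_ge0// divr_ge0// ltW.
Qed.

Variables (u w : M) (t tau : R).
Hypotheses (t_gt0 : 0 < t) (tau_le : 0 <= tau <= 2) (uw : rho u w <= K * (tau * t)).
Let a : M := dilation t^-1 (gmul (- u) w).

Lemma increment_proj i : (1 <= i <= nu)%N -> `|layer_proj i a| <= tau ^+ i * (K / sigma i) ^+ i.
Proof.
move=> ii; have s0 := sigma_gt0 ii; rewrite /a proj_dilation// normrZ.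
have := homogeneous_norm_proj sigma_gt0 ii uw => H.
rewrite ger0_norm ?exprn_ge0 ?invr_ge0 ?(ltW t_gt0)//.
apply: (le_trans (ler_wpM2l _ H)); first by rewrite exprn_ge0 ?invr_ge0 ?(ltW t_gt0).
have E : t^-1 * (K * (tau * t) / sigma i) = tau * (K / sigma i).
  by field; rewrite !gt_eqF.
by rewrite -!exprMn E.
Qed.

Lemma increment_norm : `|a| <= C1 * tau.
Proof.
case/andP: tau_le => tau0 tau2.
rewrite -[a]proj_sum /C1 mulr_suml; apply: (le_trans (ler_norm_sum _ _ _)).
apply: ler_sum_nat => i ii; have {}ii : (1 <= i <= nu)%N by lia.
have s0 := sigma_gt0 ii.
apply: (le_trans (increment_proj ii)); rewrite mulrAC ler_wpM2r//.
  by rewrite exprn_ge0// divr_ge0// ltW.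
case: i ii s0 => // i _ _; rewrite exprSr ler_wpM2r// exprSr.
by apply: (le_trans (lerXn2r i _ _ tau2)); rewrite ?nnegrE// ler_peMr ?exprn_ge0// ler1n.
Qed.

Lemma increment_norm2 :
  `|a - layer_proj 1 a| <= C1 * tau ^+ 2.
Proof.
case/andP: tau_le => tau0 tau2.
have -> : a - layer_proj 1 a = \sum_(2 <= i < nu.+1) layer_proj i a.
  by rewrite -{1}[a]proj_sum big_ltn ?ltnS ?(@step_gt0 _ _ M)// addrC addKr.
apply: (le_trans (ler_norm_sum _ _ _)).
have -> : C1 = \sum_(1 <= i < nu.+1) 2 ^+ i * (K / sigma i) ^+ i by [].
rewrite [in leRHS]big_ltn ?ltnS ?(@step_gt0 _ _ M)// mulrDl.
apply: (@le_trans _ _ ((\sum_(2 <= i < nu.+1) 2 ^+ i * (K / sigma i) ^+ i) * tau ^+ 2)); last first.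
  rewrite lerDr mulr_ge0 ?exprn_ge0// mulr_ge0 ?exprn_ge0// divr_ge0//.
  by rewrite sigma1.
rewrite mulr_suml; apply: ler_sum_nat => i i2.
have ii : (1 <= i <= nu)%N by lia.
have s0 := sigma_gt0 ii.
apply: (le_trans (increment_proj ii)); rewrite mulrAC ler_wpM2r//.
  by rewrite exprn_ge0// divr_ge0// ltW.
case: i i2 ii s0 => [//|[//|i]] _ _ _.
rewrite -addn2 !exprD ler_wpM2r ?exprn_ge0//.
apply: (le_trans (lerXn2r i _ _ tau2)); rewrite ?nnegrE// ler_peMr ?exprn_ge0//.
by rewrite exprn_ege1// ler1n.
Qed.

End increments.

Lemma increment_bounds (K : R) : 0 <= K -> exists2 C : R, 0 <= C &
  forall (u w : M) t tau, 0 < t -> 0 <= tau <= 2 -> rho u w <= K * (tau * t) ->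
    let a := dilation t^-1 (gmul (- u) w) in
    `|a| <= C * tau /\ `|a - layer_proj 1 a| <= C * tau ^+ 2.
Proof.
move=> K0; exists (\sum_(1 <= i < nu.+1) 2 ^+ i * (K / sigma i) ^+ i).
  exact: increment_const_ge0.
by move=> u w t tau t0 tau2 uw; split; [exact: increment_norm|exact: increment_norm2].
Qed.
End pansu_differentiability.

Section pansu_chain.
Context {R : realType} {s nu : nat}.
Context (G : banach_homogeneous_group R s) (M : banach_homogeneous_group R nu).
Variables (d : G -> G -> R) (hd : homogeneous_distance d).
Variable sigma : nat -> R.
Hypothesis sigma1 : sigma 1%N = 1.
Hypothesis sigma_gt0 : forall i, (1 <= i <= nu)%N -> 0 < sigma i.
Let rho : M -> M -> R := homogeneous_norm_dist sigma.
Variables (A : set G) (f : G -> M) (x zeta : G) (K0 : R) (v : M).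
Hypotheses (lz : layer G 1 zeta) (K0_ge0 : 0 <= K0).
Hypothesis f_lip : forall y y', A y -> A y' -> rho (f y) (f y') <= K0 * d y y'.
Hypothesis Ax : A x.
Hypothesis near_points : forall eta : R, 0 < eta -> exists2 delta : R, 0 < delta &
  forall t, 0 < t < delta -> exists2 r, t < r < t * (1 + eta) & A (gmul x (r *: zeta)).
Hypothesis line_derivative : forall eps : R, 0 < eps -> exists2 delta : R, 0 < delta &
  forall r, 0 < r < delta -> A (gmul x (r *: zeta)) ->
  `|layer_proj 1 (f (gmul x (r *: zeta))) - layer_proj 1 (f x) - r *: v| <= eps * r.

Let D := d 0 zeta.
(** [D] accounts for moves along the line, and the added 1 for the final move from the line to a
    nearby point of [A]. *)
Let K := K0 * (D + 1).
Let nu1 : (1 <= 1 <= nu)%N. Proof. by rewrite (@step_gt0 _ _ M). Qed.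
Let line r := gmul x (r *: zeta).
Let F y := layer_proj 1 (f y).

Let D_ge0 : 0 <= D. Proof. exact: hdist_ge0. Qed.
Let K_ge0 : 0 <= K. Proof. by rewrite mulr_ge0// addr_ge0. Qed.

Let line0 : line 0 = x. Proof. by rewrite /line scale0r gmulx0. Qed.

Let rho_line r r' : A (line r) -> A (line r') -> rho (f (line r)) (f (line r')) <= K * `|r - r'|.
Proof.
move=> Ar Ar'; apply: (le_trans (f_lip Ar Ar')).
rewrite (hdist_line hd _ _ _ lz) /K -/D mulrCA -mulrA [leLHS]mulrC -mulrA.
by rewrite ler_wpM2l// ler_wpM2r// lerDl.
Qed.

Lemma pansu_chain : exists2 C : R, 0 <= C & forall N : nat, (0 < N)%N ->
  exists2 delta : R, 0 < delta & forall (t : R) (w : G), 0 < t < delta ->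
    A (gmul x w) -> d w (t *: zeta) <= t / N%:R ->
    `|dilation t^-1 (gmul (- f x) (f (gmul x w))) - v| <= C / N%:R.
Proof.
have [C1 C1_ge0 HC1] := @increment_bounds _ _ M _ sigma1 sigma_gt0 K K_ge0.
(* A common bound for the partial products [p k] and [q k] and for all increments; the 2 is the
   value of [tau] for [p k], whose parameter is at most 2t. *)
set B := C1 * 2 + `|v|.
have [C C_ge0 HC] := gmul_step (L := M) B.
(* In units of N^-2: [C1 * 4] is for the higher layers of an increment with [tau = 2 / N], the norm
   of [v] for the misplaced parameters, and 4 for two errors of the derivative, each at a parameter
   at most 2t. *)
pose E := C1 * 4 + `|v| + 4.
have E_ge0 : 0 <= E by rewrite !addr_ge0// mulr_ge0.
(* The first summand is the Gronwall bound along the line, the second the cost of the last step to a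
   point off the line. *)
exists (expR (C * `|v|) * (C * E) + C * C1).
  by rewrite addr_ge0// ?mulr_ge0 ?expR_ge0.
move=> N N0; have nN0 : (0 : R) < N%:R by rewrite ltr0n.
have nN1 : (1 : R) <= N%:R by rewrite ler1n.
pose n : R := N%:R^-1.
have n0 : 0 < n by rewrite invr_gt0.
have n1 : n <= 1 by rewrite invf_le1.
(* The precision N^-2 is asked both of the position of the points and of the derivative, so that N
   steps accumulate only O(1/N). *)
pose kappa := n ^+ 2.
have kappa0 : 0 < kappa by rewrite exprn_gt0.
have kappan : kappa <= n by rewrite /kappa expr2 ler_piMl// ltW.
have [d1 d1_gt0 Hd1] := near_points kappa0.
have [d2 d2_gt0 Hd2] := line_derivative kappa0.
(* The parameters [r k] may reach 2t, whence the halving. *)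
exists (Num.min d1 (d2 / 2)); first by rewrite lt_min d1_gt0 divr_gt0.
move=> t w /andP[t0]; rewrite lt_min => /andP[td1 td2] Aw dw.
have kn (k : nat) : (k <= N)%N -> k%:R * n <= 1.
  by move=> kN; rewrite ler_pdivrMr// mul1r ler_nat.
(* [near_points] applies at positive parameters only, so the chain starts at [x] itself, with
   [r 0 = 0]. *)
have /choice [r Hr] : forall k : nat, exists r : R, (k <= N)%N ->
    [/\ A (line r), k%:R * n * t <= r, r <= k%:R * n * t + kappa * t & (k = 0%N -> r = 0)].
  move=> [|k]; first by exists 0 => _; rewrite line0 !mul0r add0r mulr_ge0// ltW.
  have [kN|kN] := leqP k.+1 N; last by exists 0.
  set u := k.+1%:R * n * t.
  have u0 : 0 < u by rewrite !mulr_gt0// ltr0n.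
  have ut : u <= t by rewrite ler_piMl ?(ltW t0)// kn.
  have [|r /andP[ur ru] Ar] := Hd1 u; first by rewrite u0 (le_lt_trans ut).
  exists r => _; split=> //; first exact: ltW.
  apply: (le_trans (ltW ru)); rewrite mulrDr mulr1 lerD2l mulrC ler_wpM2l//.
  exact: ltW.
(* p k and q k obey the same recursion up to errors O(N^-2), by pS, qS and ab. *)
pose p k := dilation t^-1 (gmul (- f x) (f (line (r k)))).
pose a k := dilation t^-1 (gmul (- f (line (r k))) (f (line (r k.+1)))).
pose q (k : nat) := (k%:R * n) *: v.
pose b := n *: v.
have pS k : p k.+1 = gmul (p k) (a k).
  rewrite /p /a -dilation_gmul -gmulA (gmulA (f _)) (gmulxN (f (line (r k)))).
  by rewrite gmul0x.
have qS k : q k.+1 = gmul (q k) b.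
  by rewrite /q /b gmul_line -natr1 mulrDl mul1r.
have r2 k : (k <= N)%N -> 0 <= r k <= 2 * t.
  move=> kN; have [_ rl ru _] := Hr _ kN; apply/andP; split.
    by apply: le_trans rl; rewrite !mulr_ge0// ltW.
  have h1 : k%:R * n * t <= t by rewrite ler_piMl ?(ltW t0) ?kn.
  have h2 : kappa * t <= t by rewrite ler_piMl ?(ltW t0)// (le_trans kappan).
  by move: (k%:R * n * t) (kappa * t) ru h1 h2 => *; lra.
have pB k : (k <= N)%N -> `|p k| <= C1 * 2.
  move=> kN; have [Ar _ _ _] := Hr _ kN; have /andP[r0 rk] := r2 _ kN.
  apply: (HC1 _ _ _ _ t0 _ _).1; first by rewrite ler0n lexx.
  rewrite -{1}line0; apply: (le_trans (rho_line _ Ar)); first by rewrite line0.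
  by rewrite ler_wpM2l// sub0r normrN ger0_norm.
have C1B : C1 * 2 <= B by rewrite lerDl.
have qB k : (k <= N)%N -> `|q k| <= B.
  move=> kN; rewrite normrZ ger0_norm ?mulr_ge0 ?(ltW n0)//.
  by rewrite (@le_trans _ _ `|v|)// ?ler_piMl// ?kn// lerDr mulr_ge0.
have nb : `|b| = n * `|v| by rewrite normrZ gtr0_norm.
have bB : `|b| <= B.
  by rewrite nb (@le_trans _ _ `|v|)// ?ler_piMl// lerDr mulr_ge0.
have dr k : (k < N)%N -> `|r k.+1 - r k - n * t| <= kappa * t.
  move=> kN; have [_ l1 u1 _] := Hr _ kN; have [_ l0 u0 _] := Hr _ (ltnW kN).
  rewrite -natr1 !mulrDl mul1r in l1 u1.
  move: (k%:R * n * t) (kappa * t) (n * t) l0 u0 l1 u1 => z1 z2 z3 *.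
  by rewrite ler_distlC; apply/andP; split; lra.
have dr2 k : (k < N)%N -> `|r k - r k.+1| <= 2 * n * t.
  move=> kN; have := dr _ kN; have : kappa * t <= n * t by rewrite ler_wpM2r// ltW.
  rewrite distrC !ler_norml => H /andP[h1 h2].
  have : 0 <= n * t by rewrite mulr_ge0// ltW.
  rewrite -mulrA; move: (kappa * t) (n * t) h1 h2 H => z1 z2 h1 h2 H h3.
  by apply/andP; split; lra.
have tau2 : 0 <= 2 * n <= 2 by rewrite mulr_ge0 ?(ltW n0)//= ler_piMr.
have rho_a k : (k < N)%N -> rho (f (line (r k))) (f (line (r k.+1))) <= K * (2 * n * t).
  move=> kN; have [Ar _ _ _] := Hr _ (ltnW kN); have [Ar' _ _ _] := Hr _ kN.
  by apply: (le_trans (rho_line Ar Ar')); rewrite ler_wpM2l// dr2.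
have aB k : (k < N)%N -> `|a k| <= B.
  move=> kN; apply: le_trans C1B; apply: (le_trans (HC1 _ _ _ _ t0 tau2 (rho_a _ kN)).1).
  by rewrite ler_wpM2l//; case/andP: tau2.
have Fr k : (k <= N)%N -> `|F (line (r k)) - F x - r k *: v| <= kappa * (2 * t).
  move=> kN; have /andP[r0 rk] := r2 _ kN; have [Ar _ _ _] := Hr _ kN.
  have [r00|r00] := eqVneq (r k) 0.
    by rewrite r00 line0 subrr scale0r subrr normr0 !mulr_ge0 ?ltW.
  apply: (@le_trans _ _ (kappa * r k)); last by rewrite ler_wpM2l// ltW.
  apply: Hd2 => //; rewrite lt_neqAle eq_sym r00 r0/=.
  by apply: (le_lt_trans rk); rewrite mulrC -ltr_pdivlMr.
have ab k : (k < N)%N -> `|a k - b| <= E * kappa.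
  move=> kN; have := (HC1 _ _ _ _ t0 tau2 (rho_a _ kN)).2; rewrite -/(a k) => H2.
  have H1 : `|layer_proj 1 (a k) - b| <= (`|v| + 4) * kappa.
    rewrite /a proj_dilation// proj1_gmul// expr1.
    have -> : t^-1 *: (layer_proj 1 (f (line (r k.+1))) - layer_proj 1 (f (line (r k)))) - b =
      t^-1 *: ((r k.+1 - r k - n * t) *: v + ((F (line (r k.+1)) - F x - r k.+1 *: v)
              - (F (line (r k)) - F x - r k *: v))).
      rewrite /b -/(F _) -/(F _).
      have -> : n *: v = t^-1 *: ((n * t) *: v) by rewrite scalerA mulrCA mulVf ?mulr1// gt_eqF.
      rewrite -scalerBr; congr (_ *: _).
      rewrite !scalerBl; move: (F _) (F x) (F _) => X Y Z.
      have sub4 (a1 a2 a3 a4 : M) : a1 - a2 - (a3 - a4) = a1 - a3 - (a2 - a4).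
        by rewrite !opprB addrACA [X in _ + X]addrC addrACA [X in _ + X]addrC.
      have sub3 (a1 a2 a3 : M) : a1 - a2 - (a3 - a2) = a1 - a3 by rewrite opprB addrA subrK.
      by rewrite [in RHS]sub4 sub3 [RHS]addrC addrA subrK.
    rewrite normrZ gtr0_norm ?invr_gt0// mulrC ler_pdivrMr//.
    apply: (le_trans (ler_normD _ _)); rewrite normrZ.
    have h1 : `|r k.+1 - r k - n * t| * `|v| <= kappa * t * `|v|.
      by rewrite ler_wpM2r// dr.
    have h2 := le_trans (ler_normB _ _) (lerD (Fr _ kN) (Fr _ (ltnW kN))).
    by apply: (le_trans (lerD h1 h2)); lra.
  rewrite -(subrK (layer_proj 1 (a k)) (a k)) -addrA.
  apply: (le_trans (ler_normD _ _)); apply: (le_trans (lerD H2 H1)).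
  rewrite exprMn -/kappa /E; lra.
(* The rate in Gronwall's inequality is C times the norm of [b], that is of [v] divided by N, so the
   exponent after N steps does not depend on N. *)
have eN : `|p N - q N| <= expR (C * `|v|) * (C * E) * n.
  have := @discrete_gronwall R (C * `|b|) (fun k => `|p k - q k|) (fun=> C * (E * kappa)) N.
  have -> : C * `|b| * N%:R = C * `|v|.
    by rewrite nb /n; field; rewrite gt_eqF.
  have -> : \sum_(k < N) C * (E * kappa) = C * (E * kappa) * N%:R.
    by rewrite sumr_const card_ord mulr_natr.
  move=> H.
  have -> : expR (C * `|v|) * (C * E) * n = expR (C * `|v|) * (C * (E * kappa) * N%:R).
    by rewrite /kappa /n; field; rewrite gt_eqF.
  apply: H => [|| k kN|k kN].
  - by rewrite mulr_ge0.
  - have [_ _ _ /(_ erefl) r00] := Hr 0%N (leq0n _).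
    by rewrite /p /q r00 line0 gmulNx dilation0r !mul0r scale0r subrr normr0.
  - rewrite pS qS; apply: (le_trans (HC _ _ _ _ _ _ _ _)).
    + exact: le_trans (pB _ (ltnW kN)) _.
    + exact: qB (ltnW kN).
    + exact: aB.
    + exact: bB.
    + by rewrite lerD2l ler_wpM2l// ab.
  - by rewrite !mulr_ge0// ltW.
have [ArN rN1 rN2 _] := Hr N (leqnn N).
have Nn : N%:R * n = 1 by rewrite mulfV ?gt_eqF.
rewrite Nn mul1r in rN1 rN2.
pose a' := dilation t^-1 (gmul (- f (line (r N))) (f (gmul x w))).
have a'C : `|a'| <= C1 * n.
  apply: (HC1 _ _ _ _ t0 _ _).1; first by rewrite (ltW n0) (le_trans n1)// ler1n.
  apply: (le_trans (f_lip ArN Aw)); rewrite (hdist_gmul hd) /K -mulrA ler_wpM2l//.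
  apply: (le_trans (hdist_triangle hd _ (t *: zeta) _)).
  rewrite (hdist_sym hd (t *: zeta)) mulrDl mul1r lerD//; last by rewrite mulrC.
  rewrite -(gmul0x (r N *: _)) -(gmul0x (t *: _)) (hdist_line hd _ _ _ lz) -/D mulrC.
  rewrite ler_wpM2l// ger0_norm ?subr_ge0// lerBlDl.
  by apply: (le_trans rN2); rewrite lerD2l ler_wpM2r// ltW.
have last_step : dilation t^-1 (gmul (- f x) (f (gmul x w))) = gmul (p N) a'.
  rewrite /p /a' -dilation_gmul -gmulA (gmulA (f _)) (gmulxN (f (line (r N)))).
  by rewrite gmul0x.
have qN : q N = v by rewrite /q Nn scale1r.
rewrite last_step.
have -> : gmul (p N) a' - v = (gmul (p N) a' - p N) + (p N - q N).
  by rewrite qN addrA subrK.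
apply: (le_trans (ler_normD _ _)); rewrite mulrDl [leLHS]addrC; apply: lerD; first exact: eN.
have := HC (p N) (p N) a' 0; rewrite gmulx0 subrr !normr0 mul0r add0r subr0 => H.
apply: (le_trans (H _ _ _ _)).
- exact: le_trans (pB _ (leqnn N)) _.
- exact: le_trans (pB _ (leqnn N)) _.
- apply: le_trans C1B; apply: (le_trans a'C); rewrite ler_wpM2l// (le_trans n1)// ler1n//.
- by rewrite /B addr_ge0// mulr_ge0.
by rewrite -mulrA ler_wpM2l.
Qed.

End pansu_chain.

(** * Derivatives along a line *)

Lemma closed_sup (R : realType) (A : set R) : has_sup A -> closed A -> A (sup A).
Proof.
move=> sA /closure_id Ac; suff: closure A (sup A) by rewrite -Ac.
move=> U /nbhs_ballP[e /= e0 Ue].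
have [z Az zs] := sup_adherent e0 sA; exists z; split=> //; apply: Ue.
rewrite -ball_normE /= ger0_norm ?subr_ge0 ?sup_upper_bound//.
by rewrite ltrBlDr addrC -ltrBlDr.
Qed.

Lemma closed_inf (R : realType) (A : set R) : has_inf A -> closed A -> A (inf A).
Proof.
move=> sA /closure_id Ac; suff: closure A (inf A) by rewrite -Ac.
move=> U /nbhs_ballP[e /= e0 Ue].
have [z Az zs] := inf_adherent e0 sA; exists z; split=> //; apply: Ue.
by rewrite -ball_normE /= ler0_norm ?subr_le0 ?ge_inf ?opprB ?ltrBlDl//; case: sA.
Qed.

Lemma max_lipschitz (R : realType) (a s t : R) : `|Num.max a s - Num.max a t| <= `|s - t|.
Proof.
wlog st : s t / s <= t => [H|].
  by case: (leP s t) => [|/ltW] /H //; rewrite distrC (distrC s).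
rewrite (ler0_norm (x := s - t)) ?subr_le0// ler0_norm; last by rewrite subr_le0 ge_max !le_max lexx st orbT.
by rewrite !opprB; case: (leP a s) => as'; case: (leP a t) => at'; lra.
Qed.

Lemma min_lipschitz (R : realType) (b s t : R) : `|Num.min s b - Num.min t b| <= `|s - t|.
Proof.
wlog st : s t / s <= t => [H|].
  by case: (leP s t) => [|/ltW] /H //; rewrite distrC (distrC s).
rewrite (ler0_norm (x := s - t)) ?subr_le0// ler0_norm; last by rewrite subr_le0 le_min !ge_min lexx st orbT.
by rewrite !opprB; case: (leP s b) => bs; case: (leP t b) => bt; lra.
Qed.

Section lipschitz_extension.
Context {R : realType} {X : completeNormedModType R}.
Variables (S : set X) (K : R).
Hypotheses (S_sub : linear_subspace S) (S_closed : closed S) (K_ge0 : 0 <= K).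
Implicit Types (E : set R) (g h : R -> X).

Let lip E g := forall s t, E s -> E t -> `|g s - g t| <= K * `|s - t|.

(** The values of [g] near [t] form a Cauchy filter; completeness provides the limit and closedness
    keeps it in [S]. *)
Lemma lip_limit E g t : lip E g -> (forall s, E s -> S (g s)) -> closure E t ->
  exists l, S l /\ forall e, E e -> `|g e - l| <= K * `|e - t|.
Proof.
move=> lg Sg Et.
pose F := g @ within E (nbhs t).
have FE : ProperFilter (within E (nbhs t)) by exact: within_nbhs_proper.
have FF : ProperFilter F by exact: fmap_proper_filter.
have cF : cauchy F.
  apply: cauchy_exP => e e0.
  have dK : 0 < e / 2 / (K + 1) by rewrite !divr_gt0// ltr_wpDl.
  have [z [Ez tz]] := Et _ (nbhsx_ballx t _ dK).
  exists (g z); rewrite /F /= /within /=.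
  apply: filterS (nbhsx_ballx t _ dK) => y ty Ey.
  rewrite -ball_normE /= (le_lt_trans (lg _ _ Ez Ey))//.
  move: tz ty; rewrite -!ball_normE /= => tz ty.
  have zy : `|z - y| < e / (K + 1).
    rewrite -(subrK t z) -addrA (le_lt_trans (ler_normD _ _))// [ltRHS](_ : _ =
      e / 2 / (K + 1) + e / 2 / (K + 1)); last by field; rewrite gt_eqF// ltr_wpDl.
    by rewrite ltrD// distrC.
  apply: (@le_lt_trans _ _ ((K + 1) * `|z - y| - `|z - y|)); first by rewrite mulrDl mul1r addrK.
  rewrite ltr_pdivlMr ?ltr_wpDl// in zy.
  have := normr_ge0 (z - y); rewrite mulrC in zy => z0.
  by rewrite (le_lt_trans _ zy)// lerBlDr lerDl.
have /cvg_ex [l Fl] : cvg F by apply/cauchy_cvgP.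
exists l; split.
  apply: (closed_cvg (F := within E (nbhs t)) S S_closed) Fl.
  by rewrite /within /=; apply: (@filterS _ (nbhs t) _ setT) => [y _ Ey|]; [exact: Sg|exact: filterT].
move=> e Ee; apply/ler_addgt0Pr => eps eps0.
have dK : 0 < eps / 2 / (K + 1) by rewrite !divr_gt0// ltr_wpDl.
have e2 : 0 < eps / 2 by rewrite divr_gt0.
have H1 : within E (nbhs t) (ball t (eps / 2 / (K + 1))).
  by apply: filterS (nbhsx_ballx t _ dK).
have H2 : within E (nbhs t) (g @^-1` ball l (eps / 2)).
  by apply: Fl; exact: nbhsx_ballx.
have H3 : within E (nbhs t) E by apply: nearW.
have [y [[/= ty gy] Ey]] := filter_ex (filterI (filterI H1 H2) H3).
move: ty gy; rewrite -!ball_normE /= => ty gy.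
rewrite -(subrK (g y) (g e)) -addrA (le_trans (ler_normD _ _))//.
apply: (@le_trans _ _ (K * `|e - y| + eps / 2)).
  by apply: lerD; [exact: lg|rewrite distrC ltW].
have ey : `|e - y| <= `|e - t| + `|t - y|.
  by rewrite -{1}(subrK t e) -addrA ler_normD.
have Kty : K * `|t - y| <= eps / 2.
  rewrite ltr_pdivlMr ?ltr_wpDl// in ty; apply: le_trans (ltW ty).
  by rewrite mulrC ler_wpM2l// lerDl.
have := ler_wpM2l K_ge0 ey; rewrite mulrDr => h; lra.
Qed.

Lemma lip_extend_closure E g : lip E g -> (forall s, E s -> S (g s)) ->
  exists g', [/\ lip (closure E) g', forall s, closure E s -> S (g' s) &
                 forall s, E s -> g' s = g s].
Proof.
move=> lg Sg.
have /choice [g' Hg'] : forall t, exists l, closure E t ->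
    S l /\ forall e, E e -> `|g e - l| <= K * `|e - t|.
  move=> t; have [Et|nEt] := pselect (closure E t); last by exists 0.
  by have [l] := lip_limit lg Sg Et; exists l.
exists g'; split=> [s t Es Et|s Es|s Es]; last 2 first.
- by have [] := Hg' _ Es.
- have [_ /(_ _ Es)] := Hg' _ (subset_closure Es).
  by rewrite subrr normr0 mulr0 normr_le0 subr_eq0 => /eqP.
apply/ler_addgt0Pr => eps eps0.
have dK : 0 < eps / 4 / (K + 1) by rewrite !divr_gt0// ltr_wpDl.
have K1 : 0 < K + 1 by rewrite ltr_wpDl.
have [y [Ey]] := Es _ (nbhsx_ballx s _ dK); rewrite -ball_normE /= => sy.
have [z [Ez]] := Et _ (nbhsx_ballx t _ dK); rewrite -ball_normE /= => tz.
have hy := (Hg' _ Es).2 _ Ey; have hz := (Hg' _ Et).2 _ Ez; have hyz := lg _ _ Ey Ez.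
have yz : `|y - z| <= `|s - y| + `|s - t| + `|t - z|.
  have -> : y - z = (y - s) + (s - t) + (t - z) by rewrite !addrA !subrK.
  by rewrite (le_trans (ler_normD _ _))// lerD2r (le_trans (ler_normD _ _))// lerD2r distrC.
have -> : g' s - g' t = (g' s - g y) + (g y - g z) + (g z - g' t) by rewrite !addrA !subrK.
rewrite (le_trans (ler_normD _ _))//.
apply: (le_trans (lerD (ler_normD _ _) hz)); rewrite distrC.
apply: (le_trans (lerD (lerD hy hyz) (lexx _))).
have sub u : u < eps / 4 / (K + 1) -> 0 <= u -> K * u <= eps / 4.
  move=> ue u0; rewrite ltr_pdivlMr// in ue; apply: le_trans (ltW ue).
  by rewrite mulrC ler_wpM2l// lerDl.
have := sub _ sy (normr_ge0 _); have := sub _ tz (normr_ge0 _).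
rewrite (distrC y s) (distrC z t); have := ler_wpM2l K_ge0 yz; rewrite !mulrDr.
move: (K * `|y - z|) (K * `|s - y|) (K * `|t - z|) (K * `|s - t|) => *; lra.
Qed.

(** Gaps of [E] are filled by affine interpolation between the neighbouring points of [E], and the
    map is frozen outside [a, b]. On the line this keeps the constant [K] for any Banach target, and
    linear subspaces are respected. *)
Lemma lip_extend_closed (a b : R) E g : closed E -> E a -> E b ->
  (forall e, E e -> a <= e <= b) -> lip E g -> (forall s, E s -> S (g s)) ->
  exists h, [/\ lip setT h, forall s, S (h s) & forall s, E s -> h s = g s].
Proof.
move=> cE Ea Eb Eab lg Sg.
have ab : a <= b by case/andP: (Eab _ Ea).
have /choice [lr Hlr] : forall t, exists lr : R * R, a <= t <= b ->
    [/\ E lr.1, E lr.2, lr.1 <= t <= lr.2 & forall e, E e -> e <= lr.1 \/ lr.2 <= e].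
  move=> t; have [/andP[at' tb]|nt] := boolP (a <= t <= b); last by exists (0, 0).
  pose A1 := E `&` [set e | e <= t]; pose A2 := E `&` [set e | t <= e].
  have A1s : has_sup A1 by split; [exists a|exists t => e []].
  have A2i : has_inf A2 by split; [exists b|exists t => e []].
  have cA1 : closed A1 by apply: closedI => //; exact: closed_le.
  have cA2 : closed A2 by apply: closedI => //; exact: closed_ge.
  have [E1 s1] : A1 (sup A1) by apply: closed_sup.
  have [E2 s2] : A2 (inf A2) by apply: closed_inf.
  exists (sup A1, inf A2) => _; split=> //=; first exact/andP.
  move=> e Ee; have [et|te] := leP e t.
    by left; apply: sup_upper_bound.
  by right; apply: ge_inf; [by case: A2i|]; split=> //; exact: ltW.
pose l t := (lr t).1; pose r t := (lr t).2.
pose h t := g (l t) + ((t - l t) / (r t - l t)) *: (g (r t) - g (l t)).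
have h_lr t : a <= t <= b -> `|h t - g (l t)| <= K * (t - l t) /\ `|h t - g (r t)| <= K * (r t - t).
  move=> /Hlr[El Er /andP[lt tr] _]; rewrite -/(l t) -/(r t) in El Er lt tr *.
  have [e|ne] := eqVneq (l t) (r t).
    have lt' : l t = t by apply/eqP; rewrite eq_le lt e.
    by rewrite /h -e !subrr scaler0 addr0 subrr normr0 lt' subrr mulr0.
  have rl : 0 < r t - l t by rewrite subr_gt0 lt_neqAle ne (le_trans lt).
  have grl := lg _ _ Er El; rewrite gtr0_norm// in grl.
  have base (c : R) : 0 <= c -> `|(c / (r t - l t)) *: (g (r t) - g (l t))| <= K * c.
    move=> c0; rewrite normrZ ger0_norm; last by rewrite divr_ge0// ltW.
    apply: (le_trans (ler_wpM2l _ grl)); first by rewrite divr_ge0// ltW.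
    by rewrite mulrCA divfK ?gt_eqF.
  split; first by rewrite /h addrAC subrr add0r base// subr_ge0.
  have -> : h t - g (r t) = - (((r t - t) / (r t - l t)) *: (g (r t) - g (l t))).
    have -> : (r t - t) / (r t - l t) = 1 - (t - l t) / (r t - l t).
      by field; rewrite gt_eqF.
    rewrite scalerBl scale1r opprB /h; move: (_ *: _) => w.
    by rewrite opprB addrA (addrC w).
  by rewrite normrN base// subr_ge0.
have h_e t e : a <= t <= b -> E e -> `|h t - g e| <= K * `|t - e|.
  move=> tab Ee; have [El Er /andP[lt tr] He] := Hlr _ tab.
  rewrite -/(l t) -/(r t) in El Er lt tr He.
  have [hl hr] := h_lr _ tab; case: (He _ Ee) => [el|re].
    rewrite -(subrK (g (l t)) (h t)) -addrA (le_trans (ler_normD _ _))//.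
    apply: (le_trans (lerD hl (lg _ _ El Ee))).
    rewrite -mulrDr ler_wpM2l// !ger0_norm ?subr_ge0//; last exact: le_trans lt.
    by rewrite addrA subrK.
  rewrite -(subrK (g (r t)) (h t)) -addrA (le_trans (ler_normD _ _))//.
  apply: (le_trans (lerD hr (lg _ _ Er Ee))).
  rewrite -mulrDr ler_wpM2l// !ler0_norm ?subr_le0//; last exact: le_trans re.
  by rewrite !opprB addrC addrA subrK.
have h_lip s t : a <= s <= b -> a <= t <= b -> `|h s - h t| <= K * `|s - t|.
  wlog st : s t / s < t => [H|].
    case: (ltgtP s t) => [|ts|-> _ _]; [exact: H|rewrite distrC (distrC s) => ? ?; exact: H|].
    by rewrite !subrr !normr0 mulr0.
  (* Either a point of [E] separates [s] and [t], and two bounds through it add up, or both lie in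
     one gap, where [h] is affine. *)
  move=> sab tab; have [[e [Ee /andP[se et]]]|ne] := pselect (exists e, E e /\ s <= e <= t).
    rewrite -(subrK (g e) (h s)) -addrA (le_trans (ler_normD _ _))//.
    have := h_e _ _ tab Ee; rewrite distrC => hte.
    apply: (le_trans (lerD (h_e _ _ sab Ee) hte)).
    rewrite -mulrDr ler_wpM2l// (ler0_norm (x := s - e)) ?subr_le0//.
    rewrite (ger0_norm (x := t - e)) ?subr_ge0// (ler0_norm (x := s - t)) ?subr_le0 ?(ltW st)//.
    lra.
  have [Els Ers /andP[ls sr] Hs] := Hlr _ sab; have [Elt Ert /andP[lt tr] Ht] := Hlr _ tab.
  rewrite -/(l s) -/(r s) -/(l t) -/(r t) in Els Ers ls sr Hs Elt Ert lt tr Ht.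
  have rst : t < r s.
    by rewrite ltNge; apply/negP => rst; apply: ne; exists (r s); rewrite sr.
  have lts : l t < s.
    by rewrite ltNge; apply/negP => lts; apply: ne; exists (l t); rewrite lts.
  have ell : l s = l t.
    apply/eqP; rewrite eq_le; apply/andP; split.
      by case: (Ht _ Els) => // h1; have := le_lt_trans (le_trans tr h1) (le_lt_trans ls st); rewrite ltxx.
    by case: (Hs _ Elt) => // h1; have := lt_le_trans (lt_trans lts st) (ltW (lt_le_trans rst h1)); rewrite ltxx.
  have err : r s = r t.
    apply/eqP; rewrite eq_le; apply/andP; split.
      case: (Hs _ Ert) => // h1.
      by have := lt_le_trans (lt_le_trans st tr) (le_trans h1 ls); rewrite ltxx.
    by case: (Ht _ Ers) => // h1; have := lt_le_trans (lt_trans st rst) (le_trans h1 (ltW lts)); rewrite ltxx.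
  rewrite /h ell err.
  have rl : 0 < r t - l t by rewrite subr_gt0 (lt_trans lts)// (lt_le_trans st).
  rewrite opprD addrACA subrr add0r -scalerBl normrZ.
  have -> : (s - l t) / (r t - l t) - (t - l t) / (r t - l t) = (s - t) / (r t - l t).
    by field; rewrite gt_eqF.
  rewrite normrM normfV (gtr0_norm rl).
  have grl := lg _ _ Ert Elt; rewrite gtr0_norm// in grl.
  apply: (le_trans (ler_wpM2l _ grl)); first by rewrite divr_ge0// ltW.
  by rewrite mulrCA divfK ?gt_eqF.
pose c t := Num.max a (Num.min t b).
have cab t : a <= c t <= b by rewrite /c le_max lexx/= ge_max ab ge_min lexx orbT.
exists (h \o c); split=> [s t _ _|s|s Es] /=.
- apply: (le_trans (h_lip _ _ (cab s) (cab t))); rewrite ler_wpM2l//.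
  exact: le_trans (max_lipschitz _ _ _) (min_lipschitz _ _ _).
- have [El Er _ _] := Hlr _ (cab s); rewrite /h addrC.
  case: S_sub => S0 SD; apply: (SD); last exact: Sg.
  by rewrite -scaleN1r addrC; apply: (SD); exact: Sg.
- have -> : c s = s.
    have /andP[as' sb] := Eab _ Es.
    by rewrite /c min_l// max_r.
  have := h_e _ _ (Eab _ Es) Es.
  by rewrite subrr normr0 mulr0 normr_le0 subr_eq0 => /eqP.
Qed.

Lemma lip_extend E g : E `<=` `[0, 1] -> E !=set0 -> lip E g ->
  (forall s, E s -> S (g s)) ->
  exists h, [/\ lip setT h, forall s, S (h s) & forall s, E s -> h s = g s].
Proof.
move=> E01 [e0 Ee0] lg Sg.
have [g' [lg' Sg' g'g]] := lip_extend_closure lg Sg.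
have c01 : closure E `<=` `[0, 1].
  have /closure_id -> : closed `[0 : R, 1]%classic by exact: interval_closed.
  exact: closureS.
have cE0 : closure E !=set0 by exists e0; exact: subset_closure.
have ub : has_ubound (closure E) by exists 1 => e /c01 /=; rewrite in_itv => /andP[].
have lb : has_lbound (closure E) by exists 0 => e /c01 /=; rewrite in_itv => /andP[].
have cc : closed (closure E) by exact: closed_closure.
have bnd e : closure E e -> inf (closure E) <= e <= sup (closure E).
  by move=> Ee; rewrite ge_inf// ub_le_sup.
have [h [lh Sh hg]] := lip_extend_closed cc (closed_inf (conj cE0 lb) cc)
  (closed_sup (conj cE0 ub) cc) bnd lg' Sg'.
exists h; split=> // s Es; rewrite hg ?g'g//; exact: subset_closure.
Qed.

(** The RNP concerns maps on all of [0, 1], so [g] is first extended from the part of [E] in that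
    interval; the derivative of the extension is then tested along increments that stay in [E]. *)
Lemma rnp_ae_derivative E g : radon_nikodym_property S -> lip E g ->
  (forall s, E s -> S (g s)) ->
  {ae lebesgue_measure, forall t : R, 0 < t < 1 -> E t ->
    exists2 v, S v & forall eps : R, 0 < eps -> exists2 delta : R, 0 < delta &
      forall r, 0 < `|r| < delta -> E (t + r) ->
      `|g (t + r) - g t - r *: v| <= eps * `|r|}.
Proof.
move=> rnp lg Sg; pose E1 := E `&` `[0, 1].
have [E0|/set0P E1n] := eqVneq E1 set0.
  apply: aeW => t /andP[t0 t1] Et; exfalso.
  suff : E1 t by rewrite E0.
  by split=> //=; rewrite in_itv /= !ltW.
have [h [lh Sh hg]] : exists h, [/\ lip setT h, forall s, S (h s) &
    forall s, E1 s -> h s = g s].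
  apply: lip_extend => //; first by move=> s [].
    by move=> s t [Es _] [Et _]; exact: lg.
  by move=> s [Es _]; exact: Sg.
have := rnp h (fun t _ => Sh t) _.
have hl : [lipschitz h t | t in `[0, 1] ].
  exists K; split=> [|m Km [s t] _ /=]; first exact: num_real.
  by apply: (le_trans (lh s t I I)); rewrite ler_wpM2r// ltW.
move=> /(_ hl); apply: negligibleS => t /= nP Ht; apply: nP => /andP[t0 t1] Et.
have [|v Sv [dh hv]] := Ht; first by rewrite in_itv /= t0.
exists v => // eps eps0.
have /cvgrPdist_le /(_ eps eps0) : (r^-1 *: ((h \o shift t) (r *: (1 : R)) - h t)) @[r --> (0 : R)^'] --> v.
  by rewrite -hv; exact: dh.
rewrite /dnbhs /within /= => /nbhs_ballP[e /= e0 He].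
(* The last two terms keep [t + r] inside [0, 1], where the extension agrees with [g]. *)
pose m := Num.min e (Num.min t (1 - t)).
exists m; first by rewrite !lt_min e0 t0 subr_gt0.
move=> r /andP[r0]; rewrite !lt_min => /and3P[re rt r1] Etr.
have rn0 : r != 0 by rewrite -normr_gt0.
have := He r; rewrite -ball_normE /= sub0r normrN => /(_ re rn0).
rewrite /shift /= [r *: 1]mulr1 [r + t]addrC => H.
have tr01 : E1 (t + r).
  split=> //=; rewrite in_itv /=; move: rt r1; rewrite !ltr_norml => /andP[a1 a2] /andP[b1 b2].
  by apply/andP; split; lra.
have t01 : E1 t by split=> //=; rewrite in_itv /= !ltW.
rewrite -(hg _ tr01) -(hg _ t01).
have -> : h (t + r) - h t - r *: v = - (r *: (v - r^-1 *: (h (t + r) - h t))).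
  by rewrite scalerBr scalerA mulfV// scale1r opprB.
by rewrite normrN normrZ mulrC ler_wpM2r.
Qed.

End lipschitz_extension.

(** * Continuity of homogeneous distances *)

Lemma baire_ball (R : realType) (U : completeNormedModType R) (K : (set U)^nat) :
  (forall n, closed (K n)) -> (forall x, exists n, K n x) ->
  exists n x (r : R), 0 < r /\ ball x r `<=` K n.
Proof.
move=> cK covK; apply: contrapT => nK.
have H : forall n, open (~` K n) /\ dense (~` K n).
  move=> n; split; first exact: closed_openC.
  move=> O [y Oy] oO; apply: contrapT => OK; apply: nK; exists n, y.
  move: (oO); rewrite openE => /(_ _ Oy) /nbhs_ballP[r /= r0 Or]; exists r; split=> // z yz.
  by apply: contrapT => nKz; apply: OK; exists z; split=> //; exact: Or.
have [y [_ Ky]] := Baire H (ex_intro _ 0 I) openT.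
by have [n Kn] := covK y; exact: (Ky n I).
Qed.

Section finite_dimensional_spaces.
Context {R : realType} {U : completeNormedModType R} {n : nat} (e : 'I_n -> U).
Hypothesis e_span : forall x, exists c : 'I_n -> R, x = \sum_i c i *: e i.

(** The spanning family may be linearly dependent, so coordinates are not functions of the vector;
    images of cubes stand in for bounds on coordinates. *)
Definition coord_box (r : R) : set U :=
  [set x | exists2 c : 'I_n -> R, (forall i, `|c i| <= r) & x = \sum_i c i *: e i].

Lemma coord_box_compact r : compact (coord_box r).
Proof.
pose phi (w : 'rV[R]_n) : U := \sum_i w ord0 i *: e i.
have -> : coord_box r = phi @` [set w : 'rV[R]_n | forall i, `[- r, r]%classic (w ord0 i)].
  apply/seteqP; split=> [x [c cr ->]|x [w wr <-]].
    exists (\row_i c i) => [i|]; first by rewrite /= mxE in_itv /= -ler_norml.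
    by apply: eq_bigr => i _; rewrite mxE.
  by exists (fun i => w ord0 i) => // i; have := wr i; rewrite /= in_itv /= -ler_norml.
apply: continuous_compact; last first.
  by apply: (@rV_compact _ _ (fun=> `[- r, r]%classic)) => i; exact: segment_compact.
apply: continuous_subspaceT; rewrite /phi.
elim: (index_enum _) => [|i r' IH].
  by under eq_fun do rewrite big_nil; exact: cst_continuous.
under eq_fun do rewrite big_cons.
move=> w; have FF := nbhs_filter w; apply: (cvgD (F := nbhs w)); last exact: IH.
by apply: (cvgZr_tmp (F := nbhs w)); exact: coord_continuous.
Qed.

(** By Baire some box contains a ball. Subtracting the coefficients of its centre from those of its
    other points gives bounded coefficients for all small vectors, and the division by [k] brings
    them below 1. *)
Lemma coord_box_ball : exists2 rho : R, 0 < rho & forall x, `|x| < rho -> coord_box 1 x.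
Proof.
have [m [x [r [r0 xr]]]] : exists m x (r : R), 0 < r /\ ball x r `<=` coord_box m%:R.
  apply: (baire_ball (K := fun m => coord_box m%:R)) => [m|x].
    by apply: compact_closed; [exact: norm_hausdorff|exact: coord_box_compact].
  have [c ->] := e_span x; exists (Num.trunc (\sum_i `|c i|)).+1; exists c => // i.
  apply: (@le_trans _ _ (\sum_i `|c i|)); first by rewrite (bigD1 i)//= lerDl sumr_ge0.
  by rewrite ltW// truncnS_gt.
pose k : R := 2 * m.+1%:R.
have k0 : 0 < k by rewrite mulr_gt0.
exists (r / k); first by rewrite divr_gt0.
move=> u ur; have [c cm cx] : coord_box m%:R x by apply: xr; exact: ballxx.
have [c' c'm c'x] : coord_box m%:R (x + k *: u).
  apply: xr; rewrite -ball_normE /= opprD addrA subrr add0r normrN normrZ gtr0_norm//.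
  by rewrite mulrC -ltr_pdivlMr.
exists (fun i => k^-1 * (c' i - c i)) => [i|].
  rewrite normrM gtr0_norm ?invr_gt0// ler_pdivrMl// mulr1.
  rewrite (le_trans (ler_normB _ _))//; have := cm i; have := c'm i.
  by rewrite /k -natr1; lra.
have -> : u = k^-1 *: (\sum_i c' i *: e i - \sum_i c i *: e i).
  by rewrite -c'x -cx addrAC subrr add0r scalerA mulVf ?scale1r// gt_eqF.
by rewrite -sumrB scaler_sumr; apply: eq_bigr => i _; rewrite -scalerBl scalerA.
Qed.

Lemma finite_dim_linear_bounded (phi : U -> U) : linear phi ->
  exists2 C : R, 0 <= C & forall x, `|phi x| <= C * `|x|.
Proof.
move=> lphi; have [rho rho0 box] := coord_box_ball.
have phi0 : phi 0 = 0 by have := lphi (-1) 0 0; rewrite scaler0 addr0 scaleN1r addNr.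
have phiD : {morph phi : u v / u + v} by move=> u v; have := lphi 1 u v; rewrite !scale1r.
have phiZ c u : phi (c *: u) = c *: phi u by have := lphi c u 0; rewrite phi0 !addr0.
pose S := \sum_i `|phi (e i)|.
have S0 : 0 <= S by rewrite sumr_ge0.
have phiB x : `|x| < rho -> `|phi x| <= S.
  move=> /box [c c1 ->]; rewrite (big_morph phi phiD phi0).
  apply: (le_trans (ler_norm_sum _ _ _)); apply: ler_sum => i _.
  by rewrite phiZ normrZ ler_piMl.
exists (S * 2 / rho); first by rewrite !mulr_ge0// invr_ge0 ltW.
move=> x; have [->|x0] := eqVneq x 0; first by rewrite phi0 !normr0 mulr0.
have nx : 0 < `|x| by rewrite normr_gt0.
have := phiB ((rho / 2 / `|x|) *: x).
have c0 : 0 < rho / 2 / `|x| by rewrite !divr_gt0.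
rewrite phiZ (normrZ _ (phi x)) (normrZ _ x) !(gtr0_norm c0) divfK ?gt_eqF// ltr_pdivrMr// ltr_pMr// ltr1n.
move=> /(_ isT) H.
have -> : S * 2 / rho * `|x| = S / (rho / 2 / `|x|) by field; rewrite !gt_eqF.
by rewrite ler_pdivlMr// mulrC.
Qed.

End finite_dimensional_spaces.

(** * Horizontal segments generate the group *)

Section generation.
Context {R : realType} {s : nat} {G : banach_homogeneous_group R s}.
Context {n : nat} (e : 'I_n -> G).
Hypothesis e_span : forall x, exists c : 'I_n -> R, x = \sum_i c i *: e i.
Hypothesis bracket_span : forall j, (1 <= j)%N ->
  linear_span [set bracket x y | x in layer G 1 & y in layer G j] = layer G j.+1.

Local Notation br := (@bracket R s G).
Let s1 : (1 <= 1 <= s)%N. Proof. by rewrite (@step_gt0 _ _ G). Qed.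

Definition horizontal_gen i : G := layer_proj 1 (e i).
Let b := horizontal_gen.

Lemma horizontal_gen_layer i : layer G 1 (b i). Proof. exact: proj_layer. Qed.

Definition line_product (l : seq (R * 'I_n)) : G :=
  foldr (fun p g => gmul (p.1 *: b p.2) g) 0 l.

Definition generated : set G := [set g | exists l, g = line_product l].

Lemma generatedM g h : generated g -> generated h -> generated (gmul g h).
Proof.
move=> [l ->] [l' ->]; exists (l ++ l'); elim: l => [|p l IH] /=; first by rewrite gmul0x.
by rewrite -gmulA IH.
Qed.

Lemma generated0 : generated 0. Proof. by exists [::]. Qed.

Lemma generatedZ t i : generated (t *: b i).
Proof. by exists [:: (t, i)]; rewrite /= gmulx0. Qed.

Lemma generatedN g : generated g -> generated (- g).
Proof.
move=> [l ->]; elim: l => [|p l IH] /=; first by rewrite oppr0; exact: generated0.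
by rewrite gmulN; apply: generatedM => //; rewrite -scaleNr; exact: generatedZ.
Qed.

Lemma generated_dilation r g : generated g -> generated (dilation r g).
Proof.
move=> [l ->]; elim: l => [|p l IH] /=; first by rewrite dilation0r; exact: generated0.
rewrite dilation_gmul; apply: generatedM => //.
rewrite dilationZ (dilation_layer1 _ (horizontal_gen_layer _)) scalerA.
exact: generatedZ.
Qed.

(** The layer-j leading parts of elements of the subgroup generated by horizontal segments: the
    associated graded object of that subgroup. *)
Definition leading_terms j : set G :=
  [set w | layer G j w /\ exists2 g, generated g & lower j.+1 (g - w)].

Lemma lower_dilation k r (x : G) : lower k x -> lower k (dilation r x).
Proof. by move=> kx i ii ik; rewrite proj_dilation// kx// scaler0. Qed.

(** Products add leading terms and inverses negate them. Multiplication by r > 0 comes from the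
    dilation by the j-th root of r, which preserves generated elements. *)
Lemma leading_terms_subspace j : (1 <= j <= s)%N -> linear_subspace (leading_terms j).
Proof.
move=> jj.
have T0 : leading_terms j 0.
  split; first exact: layer0.
  by exists 0; [exact: generated0|rewrite subrr; exact: lower0].
have TN w : leading_terms j w -> leading_terms j (- w).
  move=> [lw [g gg gw]]; split; first by rewrite -scaleN1r; exact: layerZ.
  exists (- g); first exact: generatedN.
  by rewrite -opprD; exact: lowerN.
have Tpos r w : 0 < r -> leading_terms j w -> leading_terms j (r *: w).
  move=> r0 [lw [g gg gw]]; split; first exact: layerZ.
  pose q := r `^ (j%:R^-1).
  have qr : q ^+ j = r.
    rewrite -powR_mulrn ?powR_ge0// -powRrM mulVf ?powRr1 ?(ltW r0)//.
    by rewrite pnatr_eq0; lia.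
  exists (dilation q g); first exact: generated_dilation.
  rewrite -qr -(dilation_layer _ jj lw) -dilationN -dilationD.
  exact: lower_dilation.
have TZ r w : leading_terms j w -> leading_terms j (r *: w).
  move=> Tw; case: (ltgtP r 0) => [r0|r0|->]; [|exact: Tpos|by rewrite scale0r].
  by rewrite -[r]opprK scaleNr; apply: TN; apply: Tpos => //; rewrite oppr_gt0.
split=> // r x y /(TZ r) [lx [g gg gx]] [ly [h hh hy]].
split; first by rewrite -[r *: x]scale1r; exact: layerD.
have lower_g z u : layer G j z -> lower j.+1 (u - z) -> lower j u.
  move=> lz uz; rewrite -(subrK z u); apply: lowerD; first exact: lower_le uz.
  exact: lower_layer lz.
exists (gmul g h); first exact: generatedM.
rewrite -(subrK (g + h) (gmul g h)) -addrA; apply: lowerD.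
  by apply: lower_gmul; [lia|exact: lower_g gx|exact: lower_g hy].
by rewrite opprD addrACA; exact: lowerD.
Qed.

Lemma leading_terms1 : layer G 1 `<=` leading_terms 1.
Proof.
move=> w lw; have [T0 TD] := leading_terms_subspace s1.
have [c cw] := e_span w.
have -> : w = \sum_i c i *: b i.
  have <- : layer_proj 1 w = w by rewrite (proj_on_layer s1 s1 lw).
  by rewrite {1}cw proj_sumr//; apply: eq_bigr => i _; rewrite projZ.
elim/big_ind: _ => // [x y Tx Ty|i _].
  by rewrite -[x]scale1r; exact: TD.
rewrite -[_ *: _]addr0; apply: (TD) => //; split; first exact: horizontal_gen_layer.
exists (b i); first by rewrite -[b i]scale1r; exact: generatedZ.
by rewrite subrr; exact: lower0.
Qed.

(** The leading term of a group commutator is the bracket of the leading terms, and brackets with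
    the first layer span the next one. *)
Lemma leading_termsT j : (1 <= j <= s)%N -> layer G j `<=` leading_terms j.
Proof.
case: j => // j; elim: j => [|j IH] jj; first exact: leading_terms1.
have j1 : (1 <= j.+1 <= s)%N by lia.
rewrite -bracket_span// => w; apply; split; first exact: leading_terms_subspace.
move=> _ [x lx [y ly <-]].
split; first by rewrite -[j.+2]add1n; apply: layer_bracket => //; lia.
have [_ [g gg gx]] := leading_terms1 lx; have [_ [h hh hy]] := IH j1 y ly.
have hj : lower j.+1 h.
  rewrite -(subrK y h); apply: lowerD; first exact: lower_le hy.
  exact: lower_layer ly.
exists (gmul (gmul g h) (gmul (- g) (- h))).
  by apply: generatedM; apply: generatedM => //; exact: generatedN.
rewrite -(subrK (br g h) (gmul _ _)) -addrA; apply: lowerD.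
  by apply: lower_gcommutator.
have -> : br g h - br x y = br (g - x) h + br x (h - y).
  by rewrite brDl brNl brDr brNr addrA subrK.
apply: lowerD.
  by rewrite -[j.+3]add2n; apply: lower_bracket.
by rewrite -[j.+3]add1n; apply: lower_bracket => //; exact: lower1.
Qed.

(** Leading terms are stripped one layer at a time: dividing [g] by a generated element with the
    same leading term moves it one step down the filtration. The induction counter is the number of
    layers left. *)
Lemma generatedT g : generated g.
Proof.
suff H k : (k <= s)%N -> forall g, lower (s.+1 - k)%N g -> generated g.
  by apply: (H s) => //; rewrite subSnn; exact: lower1.
elim: k => [_ {}g|k IH ks {}g gk].
  by rewrite subn0 => /lower_top ->; exact: generated0.
set j := (s.+1 - k.+1)%N in gk; have jj : (1 <= j <= s)%N by rewrite /j; lia.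
have j1 : (s.+1 - k)%N = j.+1 by rewrite /j; lia.
have [_ [h hh hg]] := leading_termsT jj (proj_layer g jj).
have gpi : lower j.+1 (g - layer_proj j g).
  move=> i ii; rewrite ltnS leq_eqVlt projB// (proj_on_layer ii jj (proj_layer _ jj)).
  by case: eqP => [->|_ /= ij]; rewrite ?subrr// gk// subr0.
have hj : lower j h.
  rewrite -(subrK (layer_proj j g) h); apply: lowerD; first exact: lower_le hg.
  by apply: lower_layer (proj_layer _ jj).
rewrite -(gmulKV h g); apply: generatedM => //; apply: IH; first exact: ltnW.
rewrite j1 -(subrK (- h + g) (gmul _ _)); apply: lowerD.
  by apply: lower_gmul => //; [lia|exact: lowerN].
have -> : - h + g = (g - layer_proj j g) - (h - layer_proj j g).
  by rewrite opprB addrA subrK addrC.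
exact: lowerB.
Qed.

End generation.

Section distance_continuity.
Context {R : realType} {s : nat} {G : banach_homogeneous_group R s}.
Variables (d : G -> G -> R) (hd : homogeneous_distance d).
Context {n : nat} (e : 'I_n -> G).
Hypothesis e_span : forall x, exists c : 'I_n -> R, x = \sum_i c i *: e i.
Hypothesis bracket_span : forall j, (1 <= j)%N ->
  linear_span [set bracket x y | x in layer G 1 & y in layer G j] = layer G j.+1.

Let b := horizontal_gen e.

Lemma hdist0_gmul g h : d 0 (gmul g h) <= d 0 g + d 0 h.
Proof.
apply: (le_trans (hdist_triangle hd _ g _)); rewrite lerD2l.
by rewrite -{1}[g]gmulx0 (hdist_gmul hd).
Qed.

Lemma hdist0_line i t : d 0 (t *: b i) = `|t| * d 0 (b i).
Proof.
rewrite -[in LHS](gmul0x (t *: b i)) -{1}(gmulx0 0) -{2}(scale0r (b i)).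
by rewrite (hdist_line hd _ _ _ (horizontal_gen_layer _ _)) sub0r normrN.
Qed.

Fixpoint line_products (r : R) (J : seq 'I_n) : set G :=
  if J is i :: J' then
    (fun p : R * G => gmul (p.1 *: b i) p.2) @` (`[- r, r]%classic `*` line_products r J')
  else [set 0].

Lemma line_products_compact r J : compact (line_products r J).
Proof.
elim: J => [|i J IH] /=; first exact: compact_set1.
apply: continuous_compact; last by apply: compact_setX => //; exact: segment_compact.
apply: continuous_subspaceT => p.
apply: (@continuous_comp _ _ _ (fun p : R * G => (p.1 *: b i, p.2))
  (fun q : G * G => gmul q.1 q.2)); last exact: gmul_continuous.
by apply: cvg_pair; [apply: cvgZr_tmp; exact: cvg_fst|exact: cvg_snd].
Qed.

Lemma line_products_bounded r J : exists C : R, forall g, line_products r J g -> d 0 g <= C.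
Proof.
elim: J => [|i J [C HC]] /=; first by exists 0 => _ ->; rewrite (hdistxx hd).
exists (r * d 0 (b i) + C) => _ [[t g] [/= tr Jg] <-].
apply: (le_trans (hdist0_gmul _ _)); apply: lerD; last exact: HC.
rewrite hdist0_line ler_wpM2r ?hdist_ge0//.
by move: tr; rewrite in_itv /= -ler_norml.
Qed.

Lemma line_product_mem l r : all (fun p => `|p.1| <= r) l ->
  line_products r (map snd l) (line_product e l).
Proof.
elim: l => //= -[t i] l IH /= /andP[tr /IH {}IH].
by exists (t, line_product e l) => //; split=> //=; rewrite in_itv /= -ler_norml.
Qed.

(* A homogeneous distance is not assumed continuous. It is bounded on each compact
   set of products of boundedly many bounded horizontal segments; these countably
   many sets cover G, so one of them has interior points by Baire. *)
Lemma hdist0_bounded : exists2 rho : R, 0 < rho &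
  exists C : R, forall g, `|g| < rho -> d 0 g <= C.
Proof.
pose K m : set G := if unpickle m is Some (J, k) then line_products k%:R J else set0.
have [m [x [r [r0 xr]]]] : exists m x (r : R), 0 < r /\ ball x r `<=` K m.
  apply: baire_ball => [m|x].
    rewrite /K; case: unpickle => [[J k]|]; last exact: closed0.
    by apply: compact_closed; [exact: norm_hausdorff|exact: line_products_compact].
  have [l ->] := generatedT e_span bracket_span x.
  have [k lk] : exists k : nat, all (fun p => `|p.1| <= k%:R) l.
    elim: l => [|[t i] l [k Hk]]; first by exists 0%N.
    exists (maxn (Num.trunc `|t|).+1 k) => /=; apply/andP; split.
      by apply: (le_trans (ltW (truncnS_gt _))); rewrite ler_nat leq_maxl.
    by apply: sub_all Hk => p /le_trans; apply; rewrite ler_nat leq_maxr.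
  by exists (pickle (map snd l, k)); rewrite /K pickleK; exact: line_product_mem.
have [C HC] : exists C : R, forall g, K m g -> d 0 g <= C.
  rewrite /K; case: unpickle => [[J k]|]; last by exists 0.
  exact: line_products_bounded.
have : (gmul x u @[u --> (0 : G)] --> gmul x 0).
  apply: (@continuous_comp _ _ _ (fun u : G => (x, u)) (fun q : G * G => gmul q.1 q.2) 0);
    last exact: gmul_continuous.
  by apply: cvg_pair; [exact: cvg_cst|exact: cvg_id].
rewrite gmulx0 => /(_ _ (nbhsx_ballx x r r0)) /nbhs_ballP[rho /= rho0 H].
exists rho => //; exists (C + C) => g grho.
have Kx : K m x by apply: xr; exact: ballxx.
have Kxg : K m (gmul x g).
  by apply: xr; apply: H; rewrite -ball_normE /= sub0r normrN.
have -> : d 0 g = d x (gmul x g) by rewrite -{1}[x]gmulx0 (hdist_gmul hd).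
apply: (le_trans (hdist_triangle hd _ 0 _)).
by rewrite (hdist_sym hd x); apply: lerD; exact: HC.
Qed.

(** Homogeneity turns boundedness near 0 into smallness: [d 0 g] is [l] times the distance from 0 to
    the dilate of [g] by [l^-1], and dilations are bounded linear maps in finite dimension. *)
Lemma hdist0_continuous : d 0 g @[g --> (0 : G)] --> 0.
Proof.
have [rho rho0 [C HC]] := hdist0_bounded.
have C0 : 0 <= C by have := HC 0; rewrite normr0 (hdistxx hd); apply.
apply/cvgrPdist_lt => eps eps0.
pose l := eps / (C + 1).
have l0 : 0 < l by rewrite divr_gt0// ltr_wpDl.
have [D D0 HD] := finite_dim_linear_bounded e_span (dilationP l^-1 : linear (dilation l^-1 : G -> G)).
have D1 : 0 < D + 1 by rewrite ltr_wpDl.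
apply/nbhs_ballP; exists (rho / (D + 1)) => /=; first by rewrite divr_gt0.
move=> g; rewrite -ball_normE /= sub0r normrN ltr_pdivlMr// => grho.
rewrite sub0r normrN ger0_norm ?(hdist_ge0 hd)//.
have : d 0 (dilation l^-1 g) <= C.
  apply: HC; apply: le_lt_trans grho; apply: (le_trans (HD g)).
  by rewrite mulrC ler_wpM2l// lerDl.
have -> : d 0 g = l * d 0 (dilation l^-1 g).
  rewrite -(hdist_dilation hd)// dilation0r dilationM mulfV ?gt_eqF//.
  by rewrite dilation1.
move=> H; apply: (@le_lt_trans _ _ (l * C)); first by rewrite ler_wpM2l// ltW.
by rewrite /l mulrAC ltr_pdivrMr ?ltr_wpDl// mulrDr mulr1 ltrDl.
Qed.

End distance_continuity.

(** * Null sets of Haar measure *)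

Section countable_bases.

(** Indexing by [nat] is the point: countable bases put the open sets of a product into the product
    of the Borel sigma-algebras, where Fubini applies. *)
Definition open_base (X : topologicalType) (U : nat -> set X) : Prop :=
  (forall n, open (U n)) /\
  forall x (A : set X), nbhs x A -> exists n, U n x /\ U n `<=` A.

Lemma dense_open_base (R : realType) (X : normedModType R) (I : countType) (q : I -> X) :
  (forall x (eps : R), 0 < eps -> exists i, `|x - q i| < eps) -> exists U, @open_base X U.
Proof.
move=> dq.
exists (fun m => if unpickle m is Some (i, k) then ball (q i) ((k : nat).+1%:R^-1 : R) else set0).
split=> [m|x A /nbhs_ballP[e /= e0 eA]].
  by case: unpickle => [[i k]|]; [exact: ball_open|exact: open0].
have [k ke] : exists k : nat, (k.+1%:R^-1 : R) < e / 2.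
  have e2 : 0 < e / 2 by rewrite divr_gt0.
  exists (Num.trunc ((e / 2)^-1)).
  by rewrite invf_plt ?posrE// truncnS_gt.
have [i xi] := dq x (k.+1%:R^-1) ltac:(by rewrite invr_gt0).
exists (pickle (i, k)); rewrite pickleK; split.
  by rewrite -ball_normE /= distrC.
move=> z; rewrite -ball_normE /= => zi; apply: eA; rewrite -ball_normE /=.
rewrite -(subrK (q i) x) -addrA (le_lt_trans (ler_normD _ _))//.
by rewrite [ltRHS](splitr e) ltrD// (lt_trans _ ke).
Qed.

Lemma prod_open_base (X Y : topologicalType) U V : @open_base X U -> @open_base Y V ->
  exists W, @open_base (X * Y)%type W /\
    forall m, W m = set0 \/ exists i j, W m = U i `*` V j.
Proof.
move=> [oU bU] [oV bV].
exists (fun m => if unpickle m is Some (i, j) then U i `*` V j else set0); split.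
  split=> [m|[x y] A [[A1 A2] [/= xA1 yA2] sA]].
    case: unpickle => [[i j]|]; last exact: open0.
    rewrite openE => -[x y] [/= Ux Vy]; exists (U i, V j) => //; split => /=;
      apply: open_nbhs_nbhs; split=> //=; first [exact: oU|exact: oV].
  have [i [Ux UA]] := bU _ _ xA1; have [j [Vy VA]] := bV _ _ yA2.
  exists (pickle (i, j)); rewrite pickleK; split=> //.
  by move=> [z w] [/= Uz Vw]; apply: sA; split => /=; [exact: UA|exact: VA].
move=> m; case: unpickle => [[i j]|]; last by left.
by right; exists i, j.
Qed.

Lemma open_base_measurable (X : topologicalType) d (T : measurableType d) (f : T -> X) U :
  @open_base X U -> (forall n, measurable (f @^-1` U n)) ->
  forall O : set X, open O -> measurable (f @^-1` O).
Proof.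
move=> [oU bU] mU O oO.
have -> : f @^-1` O = \bigcup_(n in [set n | U n `<=` O]) (f @^-1` U n).
  apply/seteqP; split=> [x Ox|x [n /= UO Ux]]; last exact: UO.
  have [n [Ux UO]] := bU (f x) O (open_nbhs_nbhs (conj oO Ox)).
  by exists n.
by apply: bigcup_measurable => n _; exact: mU.
Qed.

End countable_bases.

(** One iterated integral of the indicator of [S] vanishes, hence so does the other, and almost
    every section in the second direction is null; a set of positive measure contains such a
    parameter. *)
Lemma fubini_null d1 d2 (T1 : measurableType d1) (T2 : measurableType d2) (R : realType)
    (m1 : {sigma_finite_measure set T1 -> \bar R})
    (m2 : {sigma_finite_measure set T2 -> \bar R}) (S : set (T1 * T2)) (D : set T2) :
  measurable S -> measurable D -> m2 D != 0%E ->
  (forall x, m2 (xsection S x) = 0%E) -> exists2 y, D y & m1 (ysection S y) = 0%E.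
Proof.
move=> mS mD D0 S0.
have := indic_fubini_tonelli m1 m2 mS.
rewrite (indic_fubini_tonelli_FE m2 mS) (indic_fubini_tonelli_GE m1 mS).
rewrite [LHS](_ : _ = 0%E); last first.
  by rewrite integral0_eq// => x _ /=; exact: S0.
move=> /esym H.
have mG := measurable_fun_ysection m1 mS.
have /(ae_eq_integral_abs _ measurableT mG) : (\int[m2]_x `|(m1 \o ysection S) x| = 0)%E.
  rewrite -[RHS]H; apply: eq_integral => y _ /=.
  by rewrite gee0_abs.
move=> [N [mN N0 sN]]; apply: contrapT => nD.
have DN : D `<=` N.
  move=> y Dy; apply: sN => /= /(_ I) Sy.
  by apply: nD; exists y.
move/eqP: D0; apply.
exact: (subset_measure0 (mu := m2) mD mN DN N0).
Qed.

Section sigma_finite_measures.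
Context {d} {T : measurableType d} {R : realType}.
Variable mu : {measure set T -> \bar R}.

(** An alias of [mu] whose type remembers the proof of sigma-finiteness, so that the structure
    required by Fubini can be attached to it. *)
Definition sigma_finite_of (_ : sigma_finite setT mu) : set T -> \bar R := mu.

Variable h : sigma_finite setT mu.
HB.instance Definition _ := isMeasure.Build _ _ _ (sigma_finite_of h)
  (measure0 mu) (measure_ge0 mu) (@measure_semi_sigma_additive _ _ _ mu).
HB.instance Definition _ := Measure_isSigmaFinite.Build _ _ _ (sigma_finite_of h) h.

End sigma_finite_measures.

Section haar.
Context {R : realType} {s : nat} {G : banach_homogeneous_group R s}.
Variable mu : {measure set (borel G) -> \bar R}.
Hypothesis hmu : haar_measure mu.
Context {n : nat} (e : 'I_n -> G).
Hypothesis e_span : forall x, exists c : 'I_n -> R, x = \sum_i c i *: e i.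

Lemma borel_open (O : set G) : open O -> measurable (O : set (borel G)).
Proof. by move=> oO; exact: sub_sigma_algebra. Qed.

Lemma haar_sigma_finite : sigma_finite setT mu.
Proof.
exists (fun k => coord_box e k%:R).
  apply/seteqP; split=> // x _; have [c cx] := e_span x.
  exists (Num.trunc (\sum_i `|c i|)).+1 => //; exists c => // i.
  apply: (@le_trans _ _ (\sum_i `|c i|)); first by rewrite (bigD1 i)//= lerDl sumr_ge0.
  by rewrite ltW// truncnS_gt.
move=> k; have ck := @coord_box_compact _ _ _ e k%:R; split; last exact: (haar_compact hmu).
have : closed (coord_box e k%:R) by apply: compact_closed => //; exact: norm_hausdorff.
rewrite -openC => /borel_open /measurableC; rewrite setCK.
exact.
Qed.

Let smu : {sigma_finite_measure set (borel G) -> \bar R} := sigma_finite_of haar_sigma_finite.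

Lemma group_base : exists U, @open_base G U.
Proof.
apply: (@dense_open_base R G {ffun 'I_n -> rat} (fun c => \sum_i ratr (c i) *: e i)).
move=> x eps eps0; have [c ->] := e_span x.
pose S := \sum_i `|e i|; have S0 : 0 <= S by rewrite sumr_ge0.
pose del := eps / (S + 1); have d0 : 0 < del by rewrite divr_gt0// ltr_wpDl.
have /choice [q Hq] : forall i, exists q : rat, `|c i - ratr q| <= del.
  move=> i; have [|q] := @rat_in_itvoo R (c i - del) (c i + del).
    by rewrite ltrBlDr -addrA ltrDl addr_gt0.
  rewrite in_itv /= => /andP[q1 q2]; exists q.
  by rewrite ler_distlC; apply/andP; split; lra.
exists (finfun q); rewrite -sumrB.
apply: (@le_lt_trans _ _ (del * S)).
  apply: (le_trans (ler_norm_sum _ _ _)); rewrite mulr_sumr; apply: ler_sum => i _.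
  by rewrite ffunE -scalerBl normrZ ler_wpM2r.
by rewrite /del mulrAC ltr_pdivrMr ?ltr_wpDl// mulrDr mulr1 ltrDl.
Qed.

Lemma real_base : exists U, @open_base R U.
Proof.
apply: (@dense_open_base R R rat (fun q => ratr q : R)) => x eps eps0.
have [|q] := @rat_in_itvoo R (x - eps) (x + eps).
  by rewrite ltrBlDr -addrA ltrDl addr_gt0.
rewrite in_itv /= => /andP[q1 q2]; exists q.
by rewrite ltr_distlC; apply/andP; split; lra.
Qed.

Lemma open_measurable_pair (X Y : topologicalType) U V d (T : measurableType d)
    (f : T -> X) (g : T -> Y) : @open_base X U -> @open_base Y V ->
  (forall O : set X, open O -> measurable (f @^-1` O)) ->
  (forall O : set Y, open O -> measurable (g @^-1` O)) ->
  forall O : set (X * Y), open O -> measurable ((fun t => (f t, g t)) @^-1` O).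
Proof.
move=> bU bV mf mg; have [W [bW WE]] := prod_open_base bU bV.
apply: (open_base_measurable bW) => m; case: (WE m) => [->|[i [j ->]]].
  by rewrite preimage_set0.
rewrite (_ : _ @^-1` _ = f @^-1` U i `&` g @^-1` V j); last by apply/seteqP; split.
by apply: measurableI; [apply: mf; case: bU|apply: mg; case: bV].
Qed.

Let openR_measurable (O : set R) : open O -> measurable (O : set (measurableTypeR R)).
Proof. exact: open_measurable. Qed.

Lemma open_measurable_GG (O : set (G * G)) : open O -> measurable (O : set (borel G * borel G)).
Proof.
have [U bU] := group_base; move=> oO.
have := @open_measurable_pair G G U U _ (borel G * borel G)%type fst snd bU bU.
have -> : O = (fun t : borel G * borel G => (t.1, t.2)) @^-1` O by apply/seteqP; split=> -[].
apply=> // O' oO'; rewrite -[_ @^-1` _]setTI.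
  exact: (@measurable_fst _ _ (borel G) (borel G)) measurableT _ (borel_open oO').
exact: (@measurable_snd _ _ (borel G) (borel G)) measurableT _ (borel_open oO').
Qed.

Lemma open_measurable_GR (O : set (G * R)) : open O ->
  measurable (O : set (borel G * measurableTypeR R)).
Proof.
have [U bU] := group_base; have [V bV] := real_base; move=> oO.
have := @open_measurable_pair G R U V _ (borel G * measurableTypeR R)%type fst snd bU bV.
have -> : O = (fun t : borel G * R => (t.1, t.2)) @^-1` O by apply/seteqP; split=> -[].
apply=> // O' oO'; rewrite -[_ @^-1` _]setTI.
  exact: (@measurable_fst _ _ (borel G) (measurableTypeR R)) measurableT _ (borel_open oO').
exact: (@measurable_snd _ _ (borel G) (measurableTypeR R)) measurableT _ (openR_measurable oO').
Qed.

Lemma open_measurable_GRR (O : set (G * (R * R))) : open O ->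
  measurable (O : set (borel G * (measurableTypeR R * measurableTypeR R))).
Proof.
have [U bU] := group_base; have [V bV] := real_base; move=> oO.
have [W [bW _]] := prod_open_base bV bV.
pose T := (borel G * (measurableTypeR R * measurableTypeR R))%type.
have mRR (O' : set (R * R)) : open O' -> measurable (O' : set (measurableTypeR R * measurableTypeR R)).
  have := @open_measurable_pair R R V V _ (measurableTypeR R * measurableTypeR R)%type fst snd bV bV.
  move=> H oO'; rewrite (_ : O' = (fun t : R * R => (t.1, t.2)) @^-1` O'); last by apply/seteqP; split=> -[].
  apply: H => // O'' oO''; rewrite -[_ @^-1` _]setTI.
    exact: (@measurable_fst _ _ (measurableTypeR R) (measurableTypeR R)) measurableT _ (openR_measurable oO'').
  exact: (@measurable_snd _ _ (measurableTypeR R) (measurableTypeR R)) measurableT _ (openR_measurable oO'').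
have := @open_measurable_pair G (R * R)%type U W _ T fst snd bU bW.
have -> : O = (fun t : T => (t.1, t.2)) @^-1` O by apply/seteqP; split=> -[].
apply=> // O' oO'; rewrite -[_ @^-1` _]setTI.
  exact: (@measurable_fst _ _ (borel G) (measurableTypeR R * measurableTypeR R)%type) measurableT _ (borel_open oO').
exact: (@measurable_snd _ _ (borel G) (measurableTypeR R * measurableTypeR R)%type) measurableT _ (mRR _ oO').
Qed.

Lemma borel_measurable_fun d (T : measurableType d) (f : T -> borel G) :
  (forall O : set G, open O -> measurable (f @^-1` O)) -> measurable_fun setT f.
Proof.
move=> mf; apply: (@measurability _ _ T (borel G) setT f (@open G) erefl).
by move=> _ [V oV <-]; rewrite setTI; exact: mf.
Qed.

Lemma gmul_continuousr (x : G) : continuous (gmul x : G -> G).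
Proof.
move=> u; apply: (@continuous_comp _ _ _ (fun u : G => (x, u)) (fun q : G * G => gmul q.1 q.2));
  last exact: gmul_continuous.
by apply: cvg_pair; [exact: cvg_cst|exact: cvg_id].
Qed.

Lemma borel_preimage (f : G -> G) (B : set (borel G)) : continuous f -> measurable B ->
  measurable (f @^-1` B : set (borel G)).
Proof.
move=> cf mB; have mf : measurable_fun setT (f : borel G -> borel G).
  apply: borel_measurable_fun => O oO; apply: borel_open.
  by move/continuousP : cf; apply.
by rewrite -[_ @^-1` _]setTI; exact: mf.
Qed.

Lemma preimage_gmul (x : G) (B : set G) : gmul x @^-1` B = gmul (- x) @` B.
Proof.
apply/seteqP; split=> [u xu|_ [b Bb <-]]; last by rewrite /= gmulKV.
by exists (gmul x u) => //; rewrite gmulVK.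
Qed.

Lemma haar_left (x : G) (B : set (borel G)) : measurable B -> mu (gmul x @^-1` B) = mu B.
Proof. by move=> mB; rewrite preimage_gmul; exact: haar_left_invariant. Qed.

(** The pairs (x, y) with x^-1 y in [B] have null sections at fixed x by left invariance. By Fubini
    some section at fixed y is null, and it is a left translate of the inverse of [B]. *)
Lemma haar_inv_null (B : set (borel G)) : measurable B -> mu B = 0%E ->
  mu ((fun u : G => - u) @^-1` B) = 0%E.
Proof.
move=> mB B0.
pose S := [set p : borel G * borel G | B (gmul (- p.1) p.2)].
have mS : measurable S.
  have mf : measurable_fun setT (fun p : borel G * borel G => gmul (- p.1) p.2 : borel G).
    apply: borel_measurable_fun => O oO; apply: open_measurable_GG.
    have cf : continuous (fun p : G * G => gmul (- p.1) p.2).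
      move=> p; apply: (@continuous_comp _ _ _ (fun p : G * G => (- p.1, p.2))
        (fun q : G * G => gmul q.1 q.2)); last exact: gmul_continuous.
      by apply: cvg_pair; [apply: cvgN; exact: cvg_fst|exact: cvg_snd].
    by move/continuousP : cf; apply.
  by rewrite -[S]setTI; exact: mf.
have S0 x : mu (xsection S x) = 0%E.
  rewrite (_ : xsection S x = gmul (- x) @^-1` B) ?haar_left//.
  by apply/seteqP; split=> y; rewrite /xsection /= inE.
have [x _ Sx] := @fubini_null _ _ _ _ _ smu smu S setT mS measurableT (haar_neq0 hmu) S0.
rewrite -(haar_left (- x)); last by apply: borel_preimage => //; move=> u; apply: cvgN; exact: cvg_id.
rewrite -[RHS]Sx; congr (mu _); apply/seteqP; split=> y; rewrite /ysection /= inE /S /=;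
  by rewrite gmulN opprK.
Qed.

(** A right translation is a left translation conjugated by inversion, and both preserve null
    sets. *)
Lemma haar_right_null (x : G) (B : set (borel G)) : measurable B -> mu B = 0%E ->
  mu ((fun u : G => gmul u x) @^-1` B) = 0%E.
Proof.
move=> mB B0.
have cN : continuous (fun u : G => - u) by move=> u; apply: cvgN; exact: cvg_id.
have mB' := borel_preimage cN mB.
have B'0 : mu (gmul (- x) @^-1` ((fun u : G => - u) @^-1` B)) = 0%E.
  by rewrite haar_left//; exact: haar_inv_null.
have mC := borel_preimage (@gmul_continuousr (- x)) mB'.
have := haar_inv_null mC B'0; rewrite (_ : _ @^-1` _ = (fun u : G => gmul u x) @^-1` B)//.
by apply/seteqP; split=> u /=; rewrite gmulN !opprK.
Qed.

Lemma line_continuous (zeta : G) : continuous (fun p : G * R => gmul p.1 (p.2 *: zeta)).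
Proof.
move=> p; apply: (@continuous_comp _ _ _ (fun p : G * R => (p.1, p.2 *: zeta))
  (fun q : G * G => gmul q.1 q.2)); last exact: gmul_continuous.
by apply: cvg_pair; [exact: cvg_fst|apply: cvgZr_tmp; exact: cvg_snd].
Qed.

Lemma line_measurable (zeta : G) (B : set (borel G)) : measurable B ->
  measurable [set p : borel G * measurableTypeR R | B (gmul p.1 (p.2 *: zeta))].
Proof.
move=> mB; have mf : measurable_fun setT
    (fun p : borel G * measurableTypeR R => gmul p.1 (p.2 *: zeta) : borel G).
  apply: borel_measurable_fun => O oO; apply: open_measurable_GR.
  by have /continuousP := @line_continuous zeta; apply.
by rewrite -[X in measurable X]setTI; exact: mf.
Qed.

(** Fubini on G times ]0, 1[ yields one [t] for which the right translate of [N] by [- (t *: zeta)]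
    is null; translating back gives [N]. *)
Lemma haar_null_lines (zeta : G) (N : set (borel G)) : measurable N ->
  (forall x : G, lebesgue_measure [set t : R | 0 < t < 1 /\ N (gmul x (t *: zeta))] = 0%E) ->
  mu N = 0%E.
Proof.
move=> mN N0.
pose S : set (borel G * measurableTypeR R) :=
  [set p | N (gmul p.1 (p.2 *: zeta))] `&` (setT `*` `]0, 1[%classic).
have mS : measurable S.
  by apply: measurableI; [exact: line_measurable|apply: measurableX].
have S0 x : lebesgue_measure (xsection S x) = 0%E.
  rewrite -[RHS](N0 x); congr (lebesgue_measure _).
  apply/seteqP; split=> t; rewrite /xsection /= inE /S /= in_itv /=; first by case=> ? [].
  by case.
have I0 : lebesgue_measure (`]0, 1[%classic : set R) != 0%E.
  by rewrite lebesgue_measure_itv /= lte_fin ltr01 sube0 eqe oner_eq0.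
have [t /= t01 St] := @fubini_null _ _ _ _ _ smu (@lebesgue_measure R) S `]0, 1[%classic mS
  (measurable_itv _) I0 S0.
have mSt : measurable (ysection S t) by exact: measurable_ysection.
have := haar_right_null (- (t *: zeta)) mSt St.
rewrite (_ : _ @^-1` _ = N)//; apply/seteqP; split=> u; rewrite /ysection /= inE /S /=.
  by case=> + _; rewrite -gmulA gmulNx gmulx0.
by move=> Nu; rewrite -gmulA gmulNx gmulx0.
Qed.

End haar.

(** * Density points on the real line *)

Section lebesgue_line.
Context {R : realType}.
Local Notation leb := (@lebesgue_measure R).

Lemma lebesgue_measure_mono (A B : set R) : A `<=` B -> (leb A <= leb B)%E.
Proof. by move=> AB; exact: (@le_mu_ext _ _ R (wlength idfun) A B AB). Qed.

Lemma lebesgue_measure_translate (a : R) (E : set R) :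
  measurable (E : set (measurableTypeR R)) -> leb [set t | E (a + t)] = leb E.
Proof.
have mf : measurable_fun setT (fun t : measurableTypeR R => a + t : measurableTypeR R).
  by apply: measurable_funD => //; exact: measurable_cst.
pose nu : {measure set (measurableTypeR R) -> \bar R} :=
  measure_function_pushforward__canonical__measure_function_Measure leb mf.
move=> mE; apply/esym/(@lebesgue_measure_unique _ nu) => // _ [[b c] /= _ <-].
rewrite [RHS](_ : _ = leb `]b - a, c - a]%classic); last first.
  rewrite /nu /= /pushforward; congr (leb _); apply/seteqP; split=> t /=;
    by rewrite !in_itv /= ltrBlDl lerBrDl.
by rewrite !lebesgue_measure_itv /= !lte_fin ltrD2r -!EFinB opprB addrA subrK.
Qed.

(* The limit is tested along the radii 1/(k+1), which makes the exceptional set a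
   countable combination of measurable sets. *)
Definition rarely_missed (miss : nat -> \bar R) := forall j, exists m, forall k,
  (m <= k)%N -> (miss k <= (j.+1%:R^-1 * k.+1%:R^-1)%:E)%E.

Lemma density_right (E : set R) : measurable (E : set (measurableTypeR R)) ->
  {ae leb, forall a : R, E a ->
    rarely_missed (fun k => leb [set t | 0 < t < k.+1%:R^-1 /\ ~ E (a + t)])}.
Proof.
move=> mE; have := lebesgue_density mE; apply: negligibleS => a /= nP H; apply: nP; move: H => + Ea j.
rewrite indicE mem_set// => /fine_cvgP[_ /cvgrPdist_lt].
(* The density theorem measures balls, of length 2q, whereas the claim is relative to the right
   half, of length q. *)
pose eps : R := j.+1%:R^-1 / 2.
have eps0 : 0 < eps by rewrite divr_gt0// invr_gt0.
move=> /(_ eps eps0); rewrite /at_right /within /= => /nbhs_ballP[r /= r0 Hr].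
exists (Num.trunc r^-1) => k rk; set q : R := k.+1%:R^-1.
have q0 : 0 < q by rewrite invr_gt0.
have qr : q < r.
  rewrite invf_plt ?posrE//; apply: (lt_le_trans (truncnS_gt _)).
  by rewrite ler_nat.
have bq : ball (0 : R) r q by rewrite -ball_normE /= sub0r normrN gtr0_norm.
have := Hr q bq q0.
have mball : measurable (ball a q : set (measurableTypeR R)) by exact: measurable_ball.
have ballE : leb (ball a q) = (q *+ 2)%:E by rewrite lebesgue_measure_ball// ltW.
have ballfin : (leb (ball a q) < +oo)%E by rewrite ballE ltry.
have mD : leb (ball a q `\` E) = ((q *+ 2)%:E - leb (ball a q `&` E))%E.
  by rewrite -ballE; exact: measureD.
rewrite ballE.
have leI : (leb (ball a q `&` E) <= (q *+ 2)%:E)%E.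
  by rewrite -ballE; apply: lebesgue_measure_mono => x [].
have finI : leb (ball a q `&` E) \is a fin_num.
  by rewrite ge0_fin_numE// (le_lt_trans leI)// ltry.
rewrite setIC -(fineK finI); set u := fine (leb (ball a q `&` E)) in mD *.
have q2 : q *+ 2 != 0 by rewrite mulrn_eq0 /= gt_eqF.
rewrite inver (negbTE q2) -EFinM /= => ltu.
apply: (@le_trans _ _ (leb (ball a q `\` E))).
  rewrite -[leRHS](lebesgue_measure_translate a); last exact: measurableD.
  apply: lebesgue_measure_mono => t /= [/andP[t0 tq] nE]; split=> //.
  by rewrite -ball_normE /= opprD addrA subrr add0r normrN gtr0_norm.
rewrite mD -(fineK finI) -/u -EFinB lee_fin.
have q20 : 0 < q *+ 2 by rewrite mulrn_wgt0.
have : 1 - u / (q *+ 2) < eps by apply: le_lt_trans ltu; exact: ler_norm.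
move=> H; rewrite (_ : _ * q = eps * (q *+ 2)); last by rewrite /eps; field.
have : (1 - u / (q *+ 2)) * (q *+ 2) <= eps * (q *+ 2) by rewrite ler_wpM2r ?ltW.
by rewrite mulrBl mul1r divfK.
Qed.

End lebesgue_line.

(** * Exceptional sets *)

Lemma lebesgue_negligible0 (R : realType) (S : set R) :
  (@lebesgue_measure R).-negligible S -> lebesgue_measure S = 0%E.
Proof.
move=> [N [mN N0 SN]]; apply/eqP; rewrite eq_le; apply/andP; split.
  by rewrite -N0; exact: lebesgue_measure_mono.
by rewrite -(measure0 (@lebesgue_measure R)); exact: lebesgue_measure_mono.
Qed.

Lemma plane_sigma_finite (R : realType) : sigma_finite setT
  (@product_measure1 _ _ (measurableTypeR R) (measurableTypeR R) R
     (@lebesgue_measure R) (@lebesgue_measure R)).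
Proof.
pose I n : set (measurableTypeR R) := `](- n%:R), n%:R[%classic.
have mI n : measurable (I n) by exact: measurable_itv.
exists (fun n => I n `*` I n) => [|n]; last first.
  have [c Ic] : exists c, @lebesgue_measure R (I n) = c%:E.
    rewrite lebesgue_measure_itv /=.
    by case: ifP => _; [exists (n%:R + n%:R); rewrite -EFinB opprK|exists 0].
  split; first exact: measurableX.
  by rewrite product_measure1E//= Ic -EFinM ltry.
apply/seteqP; split=> // -[x y] _; exists (Num.trunc (Num.max `|x| `|y|)).+1 => //.
have H : Num.max `|x| `|y| < (Num.trunc (Num.max `|x| `|y|)).+1%:R.
  by rewrite truncnS_gt.
move: H; rewrite gt_max => /andP[hx hy].
by split; rewrite /I /= in_itv /= -ltr_norml.
Qed.

Section exceptional_sets.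
Context {R : realType} {s : nat} {G : banach_homogeneous_group R s}.
Variable mu : {measure set (borel G) -> \bar R}.
Hypothesis hmu : haar_measure mu.
Context {n : nat} (e : 'I_n -> G).
Hypothesis e_span : forall x, exists c : 'I_n -> R, x = \sum_i c i *: e i.
Variables (B : set (borel G)) (zeta : G).
Hypothesis mB : measurable B.
Local Notation leb := (@lebesgue_measure R).

Let line (x : G) (t : R) : G := gmul x (t *: zeta).

Lemma gmul_line_line (x : G) t t' : gmul (line x t) (t' *: zeta) = line x (t + t').
Proof. by rewrite /line -gmulA gmul_line. Qed.

Definition missed_measure k (x : G) : \bar R :=
  leb [set t | 0 < t < k.+1%:R^-1 /\ ~ B (gmul x (t *: zeta))].

Let mline : measurable [set p : borel G * measurableTypeR R | B (line p.1 p.2)].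
Proof. exact: (line_measurable e_span). Qed.

Lemma missed_measure_measurable k :
  measurable_fun setT (missed_measure k : borel G -> \bar R).
Proof.
pose Q : set (borel G * measurableTypeR R) :=
  (setT `*` `]0, k.+1%:R^-1[%classic) `\` [set p | B (line p.1 p.2)].
have mQ : measurable Q by apply: measurableD => //; apply: measurableX.
have := measurable_fun_xsection leb mQ.
rewrite (_ : _ \o _ = missed_measure k)//; apply/funext => x /=.
rewrite /missed_measure; congr (leb _); apply/seteqP; split=> t; rewrite /xsection /= inE /Q /= in_itv /=.
  by move=> [[_ ?] ?].
by move=> [? ?]; split.
Qed.

(** [N] is built from the measurable functions [missed_measure k]. On each line it avoids the
    density points of the trace of [B], so [haar_null_lines] applies. *)
Lemma density_exceptional : exists N : set (borel G), [/\ measurable N, mu N = 0%E &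
  forall x, B x -> ~ N x -> rarely_missed (missed_measure^~ x)].
Proof.
pose U j k : set (borel G) := [set x | ((j.+1%:R^-1 * k.+1%:R^-1)%:E < missed_measure k x)%E].
pose N : set (borel G) := B `&` \bigcup_j \bigcap_m \bigcup_(k in [set k | (m <= k)%N]) U j k.
have mN : measurable N.
  apply: measurableI => //; apply: bigcupT_measurable => j; apply: bigcapT_measurable => m.
  apply: bigcup_measurable => k _; rewrite -[U j k]setTI.
  exact: emeasurable_fun_o_infty (missed_measure_measurable k) _.
have NP x : B x -> ~ N x -> rarely_missed (missed_measure^~ x).
  move=> Bx nN j; apply: contrapT => nm; apply: nN; split=> //; exists j => // m _.
  apply: contrapT => nk; apply: nm; exists m => k mk; rewrite leNgt; apply/negP => lt.
  by apply: nk; exists k.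
have PN x : N x -> ~ rarely_missed (missed_measure^~ x).
  move=> [_ [j _ Hj]] /(_ j) [m Hm]; have [k /= mk] := Hj m I.
  by rewrite /U /= ltNge Hm.
exists N; split=> //; apply: (haar_null_lines hmu e_span (zeta := zeta)) => // x.
pose E : set (measurableTypeR R) := [set t | B (line x t)].
have mE : measurable E.
  rewrite (_ : E = xsection [set p : borel G * measurableTypeR R | B (line p.1 p.2)] x).
    exact: measurable_xsection.
  by apply/seteqP; split=> t; rewrite /xsection /= inE.
apply: lebesgue_negligible0; apply: negligibleS (density_right mE) => t /= [_ Nt] H.
have Et : E t by case: Nt.
apply: (PN _ Nt); have := H Et; rewrite /rarely_missed => + j => /(_ j) [m Hm].
exists m => k /Hm; rewrite /missed_measure /E /=.
rewrite (_ : [set t0 | 0 < t0 < k.+1%:R^-1 /\ ~ B (line x (t + t0))] =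
  [set t0 | 0 < t0 < k.+1%:R^-1 /\ ~ B (gmul (gmul x (t *: zeta)) (t0 *: zeta))])//.
by apply/seteqP; split=> r /=; rewrite gmul_line_line.
Qed.

Context {Y : completeNormedModType R} (F : G -> Y) (S : set Y) (K : R).
Hypotheses (S_sub : linear_subspace S) (S_closed : closed S) (rnp : radon_nikodym_property S).
Hypotheses (K_ge0 : 0 <= K) (FS : forall y, B y -> S (F y)).
Hypothesis F_cont : forall y, B y -> F @ within B (nbhs (y : G)) --> F y.
Hypothesis F_lip : forall x t t', B (line x t) -> B (line x t') ->
  `|F (line x t) - F (line x t')| <= K * `|t - t'|.

(** For positive parameters, the distance between two difference quotients multiplied by [t * t'];
    no inverses enter the continuity argument. *)
Definition quotient_gap (x : G) (t t' : R) : R :=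
  `|t' *: (F (line x t) - F x) - t *: (F (line x t') - F x)|.

(* The points without a derivative along zeta need not form a measurable set; whether
   the section of gap_set near the origin is null is a measurable condition on x. *)
Definition gap_set (eps : R) : set (borel G * (measurableTypeR R * measurableTypeR R)) :=
  [set p | [/\ B p.1, B (line p.1 p.2.1), B (line p.1 p.2.2), 0 < p.2.1 /\ 0 < p.2.2 &
           eps * p.2.1 * p.2.2 < quotient_gap p.1 p.2.1 p.2.2]].

Let T := (G * (R * R))%type.

Lemma gap_set_measurable eps : measurable (gap_set eps).
Proof.
pose h1 (p : T) : G := p.1.
pose h2 (p : T) : G := line p.1 p.2.1.
pose h3 (p : T) : G := line p.1 p.2.2.
have c1 : continuous h1 by move=> p; exact: cvg_fst.
have c21 : continuous (fun p : T => p.2.1).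
  by move=> p; apply: (@continuous_comp _ _ _ snd fst); [exact: cvg_snd|exact: cvg_fst].
have c22 : continuous (fun p : T => p.2.2).
  by move=> p; apply: (@continuous_comp _ _ _ snd snd); [exact: cvg_snd|exact: cvg_snd].
have c2 : continuous h2.
  move=> p; apply: (@continuous_comp _ _ _ (fun p : T => (p.1, p.2.1) : G * R)
    (fun q : G * R => gmul q.1 (q.2 *: zeta))); last exact: line_continuous.
  by apply: (@cvg_pair _ _ _ (nbhs p) (nbhs p.1) (nbhs p.2.1)); [exact: c1|exact: c21].
have c3 : continuous h3.
  move=> p; apply: (@continuous_comp _ _ _ (fun p : T => (p.1, p.2.2) : G * R)
    (fun q : G * R => gmul q.1 (q.2 *: zeta))); last exact: line_continuous.
  by apply: (@cvg_pair _ _ _ (nbhs p) (nbhs p.1) (nbhs p.2.2)); [exact: c1|exact: c22].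
pose Om : set T := [set p | [/\ B (h1 p), B (h2 p), B (h3 p) & 0 < p.2.1 /\ 0 < p.2.2]].
have mpre (h : T -> G) : continuous h ->
    measurable (h @^-1` B : set (borel G * (measurableTypeR R * measurableTypeR R))).
  move=> ch; have mh : measurable_fun setT
      (h : borel G * (measurableTypeR R * measurableTypeR R) -> borel G).
    apply: borel_measurable_fun => O oO; apply: (open_measurable_GRR e_span).
    by move/continuousP : ch; apply.
  by rewrite -[_ @^-1` _]setTI; exact: mh.
have mpos (h : T -> R) : continuous h ->
    measurable ([set p | 0 < h p] : set (borel G * (measurableTypeR R * measurableTypeR R))).
  move=> ch; apply: (open_measurable_GRR e_span).
  by move/continuousP : ch => /(_ _ (@open_gt _ (0 : R))).
have mOm : measurable (Om : set (borel G * (measurableTypeR R * measurableTypeR R))).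
  rewrite (_ : Om = (h1 @^-1` B `&` h2 @^-1` B) `&` (h3 @^-1` B `&`
      ([set p | 0 < p.2.1] `&` [set p | 0 < p.2.2]))).
    apply: measurableI; first by apply: measurableI; exact: mpre.
    apply: measurableI; first exact: mpre.
    by apply: measurableI; exact: mpos.
  by apply/seteqP; split=> [p [? ? ? []]|p [[? ?] [? []]]].
pose Psi (p : T) : R := quotient_gap p.1 p.2.1 p.2.2 - eps * p.2.1 * p.2.2.
have cPsi p : Om p -> Psi @ within Om (nbhs p) --> Psi p.
  move=> Omp; have [B1 B2 B3 _] := Omp.
  have FF : Filter (within Om (nbhs p)) by exact: within_filter.
  have cin (X : topologicalType) (h : T -> X) : continuous h ->
      h @ within Om (nbhs p) --> h p.
    by move=> ch; apply: cvg_trans (ch p); apply: cvg_app; exact: cvg_within.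
  have cF (h : T -> G) : continuous h -> (forall q, Om q -> B (h q)) ->
      (F \o h) @ within Om (nbhs p) --> F (h p).
    move=> ch hB; apply: cvg_trans (F_cont (hB _ Omp)).
    move=> A; rewrite /within /= => nA.
    change (nbhs p [set q | Om q -> A (F (h q))]).
    have := ch p _ nA; change (nbhs p [set q | B (h q) -> A (F (h q))] ->
      nbhs p [set q | Om q -> A (F (h q))]).
    by apply: filterS => q HA Omq; apply: HA; exact: hB.
  have cF1 := cF _ c1 (fun q (H : Om q) => let: And4 H1 _ _ _ := H in H1).
  have cF2 := cF _ c2 (fun q (H : Om q) => let: And4 _ H1 _ _ := H in H1).
  have cF3 := cF _ c3 (fun q (H : Om q) => let: And4 _ _ H1 _ := H in H1).
  have i1 := cin _ _ c21; have i2 := cin _ _ c22.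
  have g1 : (eps * q.2.1 * q.2.2) @[q --> within Om (nbhs p)] --> eps * p.2.1 * p.2.2.
    by apply: cvgM i2; apply: cvgM i1; exact: cvg_cst.
  have g2 : (quotient_gap q.1 q.2.1 q.2.2) @[q --> within Om (nbhs p)] -->
      quotient_gap p.1 p.2.1 p.2.2.
    apply: cvg_norm.
    exact: (cvgB (cvgZ i2 (cvgB cF2 cF1)) (cvgZ i1 (cvgB cF3 cF1))).
  exact: (cvgB g2 g1).
(* [F] is continuous only relative to [B], so the strict inequality makes [gap_set] relatively open
   in the measurable set [Om]; [V] collects the open sets that witness this. *)
pose V : set T := \bigcup_(O in [set O | open O /\ O `&` Om `<=` gap_set eps]) O.
have oV : open V by apply: bigcup_open => O [].
have -> : gap_set eps = V `&` Om.
  apply/seteqP; split=> [p Wp|p [[U [_ OW] Op] Omp]]; last exact: OW.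
  have Omp : Om p by case: Wp.
  split=> //; have Pp : 0 < Psi p by rewrite subr_gt0; case: Wp.
  have : within Om (nbhs p) [set q | 0 < Psi q].
    exact: (cPsi p Omp [set u | 0 < u] (open_nbhs_nbhs (conj (@open_gt _ 0) Pp))).
  rewrite /within /= nbhsE => -[U [oU Up] sO]; exists U => //; split=> // q [Oq Omq].
  have := sO q Oq Omq; rewrite /Psi subr_gt0 => ?.
  by have [? ? ? ?] := Omq.
by apply: measurableI => //; exact: (open_measurable_GRR e_span).
Qed.

Let leb2 : {sigma_finite_measure set (measurableTypeR R * measurableTypeR R)%type -> \bar R} :=
  sigma_finite_of (plane_sigma_finite R).

Definition small_gap_set eps k := gap_set eps `&`
  (setT `*` (`]0, k.+1%:R^-1[%classic `*` `]0, k.+1%:R^-1[%classic)).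

(** Where the derivative along the line exists, the section of the gap set near the origin is empty,
    hence null. Almost every parameter of each line in the trace of [B] is of this kind, so the
    measurable set [N] is null. *)
Lemma derivative_exceptional eps : 0 < eps -> exists N : set (borel G),
  [/\ measurable N, mu N = 0%E &
  forall x, B x -> ~ N x -> exists k, measurable (xsection (small_gap_set eps k) x) /\
    (leb \x leb)%E (xsection (small_gap_set eps k) x) = 0%E].
Proof.
move=> eps0.
have mW k : measurable (small_gap_set eps k).
  apply: measurableI; first exact: gap_set_measurable.
  by apply: measurableX => //; apply: measurableX.
pose N : set (borel G) := B `&` \bigcap_k [set x | (0 < leb2 (xsection (small_gap_set eps k) x))%E].
have mN : measurable N.
  apply: measurableI => //; apply: bigcapT_measurable => k; rewrite -[X in measurable X]setTI.
  exact: emeasurable_fun_o_infty (measurable_fun_xsection leb2 (mW k)) _.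
exists N; split=> //; last first.
  move=> x Bx nN; apply: contrapT => nk; apply: nN; split=> // k _ /=.
  rewrite lt_neqAle measure_ge0.
  rewrite andbT eq_sym; apply/eqP => H; apply: nk; exists k; split=> //.
  exact: measurable_xsection.
apply: (haar_null_lines hmu e_span (zeta := zeta)) => // x.
pose E : set R := [set t | B (line x t)].
have lipE : forall t t', E t -> E t' -> `|F (line x t) - F (line x t')| <= K * `|t - t'|.
  by move=> t t'; exact: F_lip.
have SE t : E t -> S (F (line x t)) by exact: FS.
apply: lebesgue_negligible0.
apply: negligibleS (rnp_ae_derivative S_sub S_closed K_ge0 rnp lipE SE) => t /= [t01 Nt] H.
have [BNt Nk] := Nt; have [v Sv Hv] := H t01 BNt.
(* Two difference quotients within [eps / 3] of [v] differ by less than [eps]. *)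
have e3 : 0 < eps / 3 by rewrite divr_gt0.
have [del del0 Hdel] := Hv _ e3.
pose k := Num.trunc del^-1.
have kdel : k.+1%:R^-1 < del by rewrite invf_plt ?posrE// truncnS_gt.
have := Nk k I; rewrite /= (_ : xsection _ _ = set0) ?measure0 ?ltxx//.
apply/seteqP; split=> // -[r r']; rewrite /xsection /= inE => -[[_ Br Br' _ +] [_ []]] /=.
rewrite !in_itv /= => gap /andP[r0 rk] /andP[r'0 r'k].
have {}Br : B (line x (t + r)) by rewrite -gmul_line_line.
have {}Br' : B (line x (t + r')) by rewrite -gmul_line_line.
have h1 : `|F (line x (t + r)) - F (line x t) - r *: v| <= eps / 3 * r.
  have := Hdel r; rewrite gtr0_norm// r0 (lt_trans rk)// => /(_ isT); exact.
have h2 : `|F (line x (t + r')) - F (line x t) - r' *: v| <= eps / 3 * r'.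
  have := Hdel r'; rewrite gtr0_norm// r'0 (lt_trans r'k)// => /(_ isT); exact.
move: gap; rewrite /quotient_gap -[line _ r]/(gmul _ _) -[line _ r']/(gmul _ _) !gmul_line_line.
rewrite ltNge => /negP; apply.
move: (F (line x (t + r)) - F (line x t)) h1 => a h1.
move: (F (line x (t + r')) - F (line x t)) h2 => b h2.
have -> : r' *: a - r *: b = r' *: (a - r *: v) - r *: (b - r' *: v).
  by rewrite !scalerBr !scalerA (mulrC r' r) opprB addrA subrK.
apply: (le_trans (ler_normB _ _)); rewrite !normrZ !gtr0_norm//.
have := ler_wpM2l (ltW r'0) h1; have := ler_wpM2l (ltW r0) h2.
have : 0 < eps * r * r' by rewrite !mulr_gt0.
move: (`|_|) (`|_|) => A1 A2; nra.
Qed.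

End exceptional_sets.

(** * One-sided derivatives from density and null gaps *)

Section line_derivatives.
Context {R : realType}.
Local Notation leb := (@lebesgue_measure R).
Variable E : set R.
Hypothesis mE : measurable (E : set (measurableTypeR R)).
Hypothesis dens : rarely_missed (fun k => leb [set t | 0 < t < k.+1%:R^-1 /\ ~ E t]).

(** Passes from the radii 1/(k+1) to all [t]: with [k.+1] the integer part of 1/t, the radius lies
    between t and 2t, and the 2 in the choice of [j] pays for the loss. *)
Lemma missed_bound (eps : R) : 0 < eps -> exists2 del, 0 < del &
  forall t, 0 < t < del -> (leb [set r : R | (0 < r < t)%R /\ ~ E r] <= (eps * t)%:E)%E.
Proof.
move=> eps0; pose j := Num.trunc (2 / eps).
have jeps : 2 * j.+1%:R^-1 < eps.
  rewrite ltr_pdivrMr// mulrC -ltr_pdivrMr//; exact: truncnS_gt.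
have [m Hm] := dens j; exists m.+1%:R^-1; first by rewrite invr_gt0.
move=> t /andP[t0 tm].
have tinv : m.+1%:R < t^-1 by rewrite invf_pgt ?posrE.
have m1t : 1 < t^-1 by apply: le_lt_trans tinv; rewrite ler1n.
pose k := (Num.trunc t^-1).-1.
have trunc0 : (0 < Num.trunc t^-1)%N by rewrite truncn_gt0 ltW.
have kE : k.+1 = Num.trunc t^-1 by rewrite /k prednK.
have /andP[k1 k2] : k.+1%:R <= t^-1 < k.+2%:R.
  by rewrite kE truncn_itv// ltW// invr_gt0.
have mk : (m <= k)%N.
  by rewrite -ltnS -ltnS -(ltr_nat R); apply: lt_trans tinv k2.
apply: le_trans (le_trans _ (Hm k mk)) _.
  apply: lebesgue_measure_mono => r /= [/andP[r0 rt] nE]; split=> //.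
  rewrite r0 /=; apply: (lt_le_trans rt).
  by rewrite -(invrK t) lef_pV2 ?posrE ?invr_gt0.
rewrite lee_fin.
have kt : k.+1%:R^-1 <= 2 * t.
  rewrite -[t]invrK -[2]invrK -invfM lef_pV2 ?posrE ?divr_gt0 ?invr_gt0//.
  rewrite mulrC ler_pdivrMr//; apply: (le_trans (ltW k2)).
  by rewrite -natrM ler_nat; lia.
have j0 : 0 < j.+1%:R^-1 :> R by rewrite invr_gt0.
apply: le_trans (ler_wpM2l (ltW j0) kt) _; rewrite mulrA (mulrC _ 2) ler_pM2r//; exact: ltW.
Qed.

(** Up to t (1 + eta) the set [E] misses at most measure eta t / 2, half the length of the interval
    from t to t (1 + eta). *)
Lemma near_positive (eta : R) : 0 < eta -> exists2 del, 0 < del &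
  forall t, 0 < t < del -> leb [set r | t < r < t * (1 + eta) /\ E r] != 0%E.
Proof.
move=> eta0; have e0 : 0 < eta / (2 * (1 + eta)) by rewrite divr_gt0// mulr_gt0//; lra.
have [del del0 Hdel] := missed_bound e0.
exists (del / (1 + eta)); first by rewrite divr_gt0//; lra.
move=> t /andP[t0 tdel]; apply/eqP => S0.
have tq : t * (1 + eta) < del by rewrite -ltr_pdivlMr//; lra.
have tq0 : 0 < t * (1 + eta) by rewrite mulr_gt0//; lra.
have := Hdel (t * (1 + eta)); rewrite tq0 tq => /(_ isT); apply/negP; rewrite -ltNge.
have -> : eta / (2 * (1 + eta)) * (t * (1 + eta)) = eta * t / 2.
  by field; apply/eqP; lra.
have mI a b : measurable ([set r | a < r < b] : set (measurableTypeR R)).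
  by rewrite (_ : [set r | _] = `]a, b[%classic)//; apply/seteqP; split=> r /=; rewrite in_itv.
have Itv : leb [set r | t < r < t * (1 + eta)] = (eta * t)%:E.
  rewrite (_ : [set r | _] = `]t, (t * (1 + eta))[%classic); last first.
    by apply/seteqP; split=> r /=; rewrite in_itv.
  rewrite lebesgue_measure_itv /= lte_fin ltr_pMr// ltrDl eta0 -EFinB; congr EFin; ring.
have mS : measurable ([set r | t < r < t * (1 + eta) /\ E r] : set (measurableTypeR R)).
  exact: (measurableI _ _ (mI _ _) mE).
have mM : measurable ([set r | 0 < r < t * (1 + eta) /\ ~ E r] : set (measurableTypeR R)).
  exact: (measurableD (mI _ _) mE).
have : (leb ([set r | (t < r < t * (1 + eta))%R /\ E r] `|`
      [set r | (0 < r < t * (1 + eta))%R /\ ~ E r]) <=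
    leb [set r | (t < r < t * (1 + eta))%R /\ E r] +
    leb [set r | (0 < r < t * (1 + eta))%R /\ ~ E r])%E by exact: measureU2.
rewrite S0 add0e.
apply: lt_le_trans; apply: (@lt_le_trans _ _ (eta * t)%:E).
  by rewrite lte_fin; have := mulr_gt0 eta0 t0; lra.
rewrite -Itv; apply: lebesgue_measure_mono => r /= /andP[r1 r2].
by have [Er|nEr] := pselect (E r); [left; rewrite r1 r2|right; rewrite r2 (lt_trans t0)].
Qed.

Context {Y : completeNormedModType R} (S : set Y) (phi : R -> Y) (T : set R) (K : R).
Hypotheses (S_sub : linear_subspace S) (S_closed : closed S).
Hypotheses (K_ge0 : 0 <= K) (ET : E `<=` T) (T0 : T 0) (phiS : forall t, T t -> S (phi t)).
Hypothesis phi_lip : forall t t', T t -> T t' -> `|phi t - phi t'| <= K * `|t - t'|.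
Hypothesis small_gaps : forall eps, 0 < eps -> exists del, exists W : set (measurableTypeR R * measurableTypeR R),
  [/\ 0 < del, measurable W, (leb \x leb)%E W = 0%E &
    forall r r', 0 < r < del -> 0 < r' < del -> E r -> E r' ->
    eps * r * r' < `|r' *: (phi r - phi 0) - r *: (phi r' - phi 0)| -> W (r, r')].

Let q t := t^-1 *: (phi t - phi 0).

Lemma quotient_near (eta t r : R) : 0 < t -> t < r < t * (1 + eta) -> T t -> T r ->
  `|q t - q r| <= 2 * K * eta.
Proof.
move=> t0 /andP[tr rt] Tt Tr; have r0 : 0 < r := lt_trans t0 tr.
have -> : q t - q r = r^-1 *: (phi t - phi r) + (t^-1 - r^-1) *: (phi t - phi 0).
  rewrite /q scalerBl addrCA -scalerBr; congr (_ + _).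
  by rewrite -scalerN !opprB [in RHS]addrC subrKA.
have h1 := phi_lip Tt Tr; have h2 := phi_lip Tt T0.
apply: (le_trans (ler_normD _ _)); rewrite !normrZ.
have ir : 0 < r^-1 by rewrite invr_gt0.
have itr : r^-1 < t^-1 by rewrite ltf_pV2 ?posrE.
rewrite (gtr0_norm ir) (@gtr0_norm _ (t^-1 - r^-1)) ?subr_gt0//.
rewrite subr0 gtr0_norm// in h2; rewrite (distrC t) gtr0_norm ?subr_gt0// in h1.
have rr : r^-1 * (r - t) <= eta.
  rewrite mulrC ler_pdivrMr//; nra.
have -> : 2 * K * eta = K * eta + K * eta by ring.
apply: lerD.
  apply: (le_trans (ler_wpM2l (ltW ir) h1)); rewrite mulrCA; exact: ler_wpM2l.
apply: (@le_trans _ _ ((t^-1 - r^-1) * (K * t))).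
  by apply: ler_wpM2l; rewrite // subr_ge0 ltW.
have -> : (t^-1 - r^-1) * (K * t) = K * (r^-1 * (r - t)).
  by field; rewrite !gt_eqF.
exact: ler_wpM2l.
Qed.

(** The gaps are controlled only for pairs in [E] outside a null set, while the claim is about all
    of [T]. Both parameters are replaced by slightly larger ones in [E]; a product of two sets of
    positive measure is not contained in [W], so the new pair can avoid it, and the Lipschitz bound
    controls the replacement. *)
Lemma quotient_cauchy (eps : R) : 0 < eps -> exists2 del, 0 < del &
  forall t t', 0 < t < del -> 0 < t' < del -> T t -> T t' -> `|q t - q t'| <= eps.
Proof.
move=> eps0; have K1 : 0 < K + 1 by rewrite ltr_wpDl.
(* Chosen so that the two replacement errors [2 * K * eta] add up to at most [eps / 2]. *)
pose eta := eps / (8 * (K + 1)).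
have eta0 : 0 < eta by rewrite divr_gt0// mulr_gt0.
have Keta : 4 * K * eta <= eps / 2.
  rewrite /eta mulrA ler_pdivrMr ?mulr_gt0// (_ : eps / 2 * _ = 4 * K * eps + 4 * eps); last by field.
  by rewrite lerDl mulr_ge0// ltW.
have e2 : 0 < eps / 2 by rewrite divr_gt0.
have [d1 [W [d10 mW W0 HW]]] := small_gaps e2.
have [d2 d20 H2] := near_positive eta0.
exists (Num.min (d1 / (1 + eta)) d2).
  by rewrite lt_min d20 divr_gt0//; lra.
move=> t t'; rewrite !lt_min => /and3P[t0 td1 td2] /and3P[t'0 t'd1 t'd2] Tt Tt'.
pose I u : set (measurableTypeR R) := [set r | u < r < u * (1 + eta) /\ E r].
have mI u : measurable (I u).
  rewrite (_ : I u = `]u, (u * (1 + eta))[%classic `&` E); first exact: measurableI.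
  by apply/seteqP; split=> r; rewrite /I /= in_itv.
have pos u : 0 < u -> u < d2 -> leb (I u) != 0%E by move=> u0 ud; apply: H2; rewrite u0.
have := @product_measure1E _ _ _ _ _ leb leb _ _ (mI t) (mI t') => IE.
have : exists p, (I t `*` I t') p /\ ~ W p.
  apply: contrapT => nex.
  have sub : I t `*` I t' `<=` W.
    by move=> p Ip; apply: contrapT => nW; apply: nex; exists p.
  have Z : (leb \x leb)%E (I t `*` I t') = 0%E.
    have mII := measurableX (mI t) (mI t').
    exact: (@subset_measure0 _ _ _ (leb \x leb)%E _ _ mII mW sub W0).
  move: Z; rewrite IE => /eqP; rewrite mule_eq0 (negbTE (pos _ t0 td2)).
  by rewrite (negbTE (pos _ t'0 t'd2)).
move=> [[r r'] [[[/andP[tr rt] Er] [/andP[tr' rt'] Er']] nW]] /=.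
simpl in *.
have bnd u v : 0 < u -> u < d1 / (1 + eta) -> u < v -> v < u * (1 + eta) -> 0 < v < d1.
  move=> u0 ud uv vu; rewrite (lt_trans u0 uv) (lt_trans vu)//= -ltr_pdivlMr//; lra.
have rr' : `|q r - q r'| <= eps / 2.
  have b := bnd _ _ t0 td1 tr rt; have b' := bnd _ _ t'0 t'd1 tr' rt'.
  have := fun H => nW (HW _ _ b b' Er Er' H); move=> /negP; rewrite -leNgt.
  have /andP[r0 _] := b; have /andP[r'0 _] := b'.
  have -> : r' *: (phi r - phi 0) - r *: (phi r' - phi 0) = (r * r') *: (q r - q r').
    rewrite /q [RHS]scalerBr !scalerA (mulrAC r) mulfV ?gt_eqF// mul1r.
    by rewrite mulfK ?gt_eqF.
  rewrite normrZ gtr0_norm ?mulr_gt0// -mulrA [_ / 2 * _]mulrC ler_pM2l ?mulr_gt0//.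
have h1 : `|q t - q r| <= 2 * K * eta by apply: quotient_near (ET Er); rewrite ?tr.
have h2 : `|q t' - q r'| <= 2 * K * eta by apply: quotient_near (ET Er'); rewrite ?tr'.
have -> : q t - q t' = (q t - q r) + (q r - q r') - (q t' - q r').
  by rewrite addrA subrK opprB addrA subrK.
apply: (le_trans (ler_normB _ _)); have := ler_normD (q t - q r) (q r - q r').
lra.
Qed.

(** The derivative is the limit of the difference quotients along the parameters of [T] tending to 0
    from the right, a filter that is proper by [near_positive]. *)
Lemma line_derivative_exists : exists2 v, S v &
  forall eps, 0 < eps -> exists2 del, 0 < del &
  forall r, 0 < r < del -> T r -> `|phi r - phi 0 - r *: v| <= eps * r.
Proof.
pose Fl : set_system R := within T (at_right (0 : R)).
have FlF : Filter Fl by exact: within_filter.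
have Fl_in (del : R) (P : set R) : 0 < del -> (forall t, 0 < t < del -> T t -> P t) -> Fl P.
  move=> del0 H; rewrite /Fl /within /=.
  near=> t => Tt; apply: H => //; apply/andP; split; near: t.
    exact: nbhs_right_gt.
  exact: nbhs_right_lt.
have Fl_ex (P : set R) (del : R) : 0 < del -> Fl P -> exists t, [/\ 0 < t < del, T t & P t].
  move=> del0; rewrite /Fl /within /at_right /within /= => /nbhs_ballP[e /= e0 He].
  have [d2 d20 H2] := near_positive ltr01.
  pose u := Num.min (Num.min del e) d2 / 3.
  have m0 : 0 < Num.min (Num.min del e) d2 by rewrite !lt_min del0 e0.
  have u0 : 0 < u by rewrite divr_gt0.
  have um : u * 2 < Num.min (Num.min del e) d2 by rewrite /u; lra.
  move: (um); rewrite !lt_min => /andP[/andP[udel ue] ud2].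
  have : leb [set r | u < r < u * (1 + 1) /\ E r] != 0%E by apply: H2; rewrite u0; lra.
  have [-> |/set0P[r /= [/andP[ur ru] Er]] _] := eqVneq [set r | u < r < u * (1 + 1) /\ E r] set0.
    by rewrite measure0 eqxx.
  have r0 : 0 < r := lt_trans u0 ur.
  exists r; split; [by rewrite r0; lra|exact: ET|].
  apply: He => //; last exact: ET.
  by rewrite -ball_normE /= sub0r normrN gtr0_norm//; lra.
have FlP : ProperFilter Fl.
  by apply: Build_ProperFilter_ex => P /(Fl_ex _ _ ltr01)[t [_ _ Pt]]; exists t.
have qC : cvg (q @ Fl).
  apply/cauchy_cvgP; apply: cauchy_exP => eps eps0.
  have [del del0 H] := quotient_cauchy (divr_gt0 eps0 (ltr0n _ 2)).
  have [t0 [t0d Tt0 _]] := Fl_ex setT del del0 filterT.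
  exists (q t0); rewrite /nbhs /=; apply: (Fl_in del) => // t td Tt.
  rewrite -ball_normE /=; apply: (le_lt_trans (H _ _ t0d td Tt0 Tt)).
  by lra.
pose v := lim (q @ Fl).
exists v.
  apply: (@closed_cvg _ _ Fl _ q S S_closed _ v qC).
  apply: (Fl_in 1) => // t _ Tt; rewrite /q; case: S_sub => S0 Slin.
  have := Slin t^-1 _ _ (Slin (-1) _ _ (phiS T0) (phiS Tt)) S0.
  by rewrite addr0 scaleN1r addrC.
move=> eps eps0.
have [del del0 H] := quotient_cauchy eps0.
exists del => // r rd Tr; have /andP[r0 _] := rd.
have qv : `|q r - v| <= eps.
  have cv : (`|q r - q t|) @[t --> Fl] --> `|q r - v|.
    by apply: cvg_norm; apply: cvgB => //; exact: cvg_cst.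
  apply: (@closed_cvg _ _ Fl _ _ [set x | x <= eps] (@closed_le _ eps) _ _ cv).
  by apply: (Fl_in del) => // t td Tt; exact: H.
have -> : phi r - phi 0 - r *: v = r *: (q r - v).
  by rewrite scalerBr /q scalerA mulfV ?gt_eqF// scale1r.
by rewrite normrZ gtr0_norm// mulrC ler_pM2r.
Unshelve. all: by end_near. Qed.

End line_derivatives.

(** * Density and approximating points in a direction *)

Section directions.
Context {R : realType} {s : nat} {G : banach_homogeneous_group R s}.
Variables (A : set G) (x zeta : G).
Hypothesis lz : layer G 1 zeta.

Lemma dense_in_direction_rarely_missed (E : set R) :
  rarely_missed (fun k => lebesgue_measure [set t | 0 < t < k.+1%:R^-1 /\ ~ E t]) ->
  (forall t, E t -> A (gmul x (t *: zeta))) -> dense_in_direction A x zeta.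
Proof.
move=> dens EA.
have bound (eps : R) : 0 < eps -> \forall t \near (0 : R)^'+,
    (lebesgue_measure (missed A x zeta t) * (t^-1)%:E <= eps%:E)%E.
  move=> eps0; have [del del0 Hdel] := missed_bound dens eps0.
  near=> t; have t0 : 0 < t by near: t; exact: nbhs_right_gt.
  have tdel : t < del by near: t; exact: nbhs_right_lt.
  rewrite -lee_pdivlMr ?invr_gt0// -EFinM invrK.
  apply: le_trans (Hdel t _); last by rewrite t0.
  apply: lebesgue_measure_mono => r /= [rt nA]; split=> // Er; apply: nA.
  by rewrite dilation_layer1//; exact: EA.
have ge0 t : 0 < t -> (0 <= lebesgue_measure (missed A x zeta t) * (t^-1)%:E)%E.
  by move=> t0; rewrite mule_ge0// lee_fin invr_ge0 ltW.
apply/fine_cvgP; split.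
  near=> t; rewrite ge0_fin_numE; last by apply: ge0; near: t; exact: nbhs_right_gt.
  apply: (@le_lt_trans _ _ 1%:E); last exact: ltry.
  by near: t; exact: bound.
apply/cvgrPdist_le => eps eps0; near=> t.
have t0 : 0 < t by near: t; exact: nbhs_right_gt.
have : (lebesgue_measure (missed A x zeta t) * (t^-1)%:E <= eps%:E)%E by near: t; exact: bound.
have := ge0 t t0; rewrite /=.
case: (_ * _)%E => //= r; rewrite !lee_fin => r0 re.
by rewrite sub0r normrN ger0_norm.
Unshelve. all: by end_near. Qed.

Hypothesis Ax : A x.
Hypothesis near_points : forall eta : R, 0 < eta -> exists2 delta : R, 0 < delta &
  forall t, 0 < t < delta -> exists2 r, t < r < t * (1 + eta) & A (gmul x (r *: zeta)).
Variables (d : G -> G -> R) (hd : homogeneous_distance d).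

(** One choice has to serve all tolerances. For each [t] it takes a point of the line beyond [t]
    whose parameter is within [t ^+ 2] of the infimum of such parameters, an error negligible
    against [t]. *)
Lemma approximating_exists : exists z, approximating d A x zeta z.
Proof.
pose E : set R := [set r | A (gmul x (r *: zeta))].
have near_inf t : 0 < t -> exists r, E r /\
    forall r0, t < r0 -> E r0 -> t < r < r0 + t ^+ 2.
  move=> t0; have [[r0 [tr0 Er0]]|none] := pselect (exists r0, t < r0 /\ E r0); last first.
    (* When [A] has no point of the line beyond [t], the point [x] itself is taken, as the
       approximating points must lie in [A] for every [t > 0]. *)
    exists 0; split; first by rewrite /E /= scale0r gmulx0.
    by move=> r0 tr0 Er0; case: none; exists r0.
  have hl : has_lbound [set r | t < r /\ E r] by exists t => r [/ltW].
  have t20 : 0 < t ^+ 2 by rewrite exprn_gt0.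
  have [|r [tr Er] rinf] := @inf_adherent _ [set r | t < r /\ E r] _ t20.
    by split=> //; exists r0.
  exists r; split=> // r1 tr1 Er1; rewrite tr /=; apply: (lt_le_trans rinf).
  by rewrite lerD2r; apply: ge_inf.
have /choice[r Hr] : forall t, exists rt, 0 < t -> E rt /\
    forall r0, t < r0 -> E r0 -> t < rt < r0 + t ^+ 2.
  move=> t; have [/near_inf[r Hr]|nt] := pselect (0 < t); first by exists r.
  by exists 0.
exists (fun t => r t *: zeta); split=> [t /Hr[]//|].
set D := d 0 zeta.
have D0 : 0 <= D := hdist_ge0 hd _ _.
apply/cvgrPdist_le => eps eps0; pose eta := eps / (2 * (D + 1)).
have D1 : 0 < D + 1 by rewrite ltr_wpDl.
have eta0 : 0 < eta by rewrite divr_gt0// mulr_gt0.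
have [del del0 Hdel] := near_points eta0.
near=> t.
have t0 : 0 < t by near: t; exact: nbhs_right_gt.
have tdel : t < del by near: t; exact: nbhs_right_lt.
have teta : t < eta by near: t; exact: nbhs_right_lt.
have [|r0 /andP[tr0 r0t] Er0] := Hdel t; first by rewrite t0.
have [_ /(_ r0 tr0 Er0) /andP[r1 r2]] := Hr t t0.
rewrite dilation_layer1// -[r t *: zeta]gmul0x -[t *: zeta]gmul0x (hdist_line hd)// -/D.
rewrite sub0r normrN normrM normfV (gtr0_norm t0) ger0_norm; last by rewrite mulr_ge0.
rewrite gtr0_norm ?subr_gt0// ler_pdivrMr//.
have h : r t - t <= t * (2 * eta) by nra.
apply: (le_trans (ler_wpM2r D0 h)).
have -> : t * (2 * eta) * D = t * (eps * D / (D + 1)).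
  by rewrite /eta; field; rewrite gt_eqF.
rewrite mulrC ler_pM2r// ler_pdivrMr//; have := mulr_ge0 (ltW eps0) D0; lra.
Unshelve. all: by end_near. Qed.

End directions.

Section derivative.
Context {R : realType} {s nu : nat}.
Context (G : banach_homogeneous_group R s) (M : banach_homogeneous_group R nu).
Variables (d : G -> G -> R) (A : set G) (f : G -> M) (x zeta : G) (v : M) (C : R).
Hypothesis lz : layer G 1 zeta.

Lemma directional_derivativeP :
  (forall N : nat, (0 < N)%N ->
    exists2 delta : R, 0 < delta & forall (t : R) (w : G), 0 < t < delta ->
    A (gmul x w) -> d w (t *: zeta) <= t / N%:R ->
    `|dilation t^-1 (gmul (- f x) (f (gmul x w))) - v| <= C / N%:R) ->
  directional_derivative d A f x zeta v.
Proof.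
move=> H z [Az zt]; apply/cvgrPdist_le => eps eps0.
pose N := (Num.trunc (C / eps)).+1.
have N0 : 0 < N%:R :> R by [].
have CN : C / N%:R <= eps.
  by rewrite ler_pdivrMr// mulrC -ler_pdivrMr//; exact/ltW/truncnS_gt.
have [del del0 Hdel] := H N isT.
near=> t.
have t0 : 0 < t by near: t; exact: nbhs_right_gt.
have tdel : t < del by near: t; exact: nbhs_right_lt.
have dz : d (z t) (dilation t zeta) / t <= N%:R^-1.
  have : `|0 - d (z t) (dilation t zeta) / t| <= N%:R^-1.
    near: t; move/cvgrPdist_le : zt; apply; by rewrite invr_gt0.
  by rewrite sub0r normrN; apply: le_trans; exact: ler_norm.
rewrite distrC; apply: le_trans CN; apply: Hdel; [by rewrite t0|exact: Az|].
by rewrite -(dilation_layer1 t lz) mulrC -ler_pdivrMr.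
Unshelve. all: by end_near. Qed.

End derivative.

Theorem theorem2p16 (R : realType) (s nu : nat)
  (G : banach_homogeneous_group R s) (M : banach_homogeneous_group R nu)
  (d : G -> G -> R) (sigma : nat -> R)
  (mu : {measure set (borel G) -> \bar R})
  (A : set G) (zeta : G) (f : G -> M) :
  stratified G ->
  homogeneous_distance d ->
  norm_constants M sigma ->
  haar_measure mu ->
  radon_nikodym_property (layer M 1) ->
  completed_algebra_gen mu A ->
  layer G 1 zeta -> zeta != 0 ->
  lipschitz_map d (homogeneous_norm_dist sigma) A f ->
  {ae mu, forall x : G, A x ->
    dense_in_direction A x zeta /\
    differentiable_in_direction d A f x zeta}.
Proof.
(* [A] is the union of a Borel set [B] and a negligible set [N0]: Fubini is applied to [B], while
   the derivative is taken along all of [A]. *)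
move=> [[n [e e_span]] bracket_span _] hd [sigma1 sigma_gt0 _] hmu rnp [B mB [N0 nN0 AE]] lz z0 [L f_lipL].
have nu1 : (1 <= 1 <= nu)%N by rewrite (@step_gt0 _ _ M).
have BA : B `<=` A by rewrite -AE; exact: subsetUl.
pose K0 := Num.max L 0; have K0_ge0 : 0 <= K0 by rewrite le_max lexx orbT.
have f_lip y y' : A y -> A y' -> homogeneous_norm_dist sigma (f y) (f y') <= K0 * d y y'.
  move=> Ay Ay'; apply: (le_trans (f_lipL _ _ Ay Ay')).
  by apply: ler_wpM2r; [exact: hdist_ge0|rewrite le_max lexx].
pose F (y : G) : M := layer_proj 1 (f y).
have F_lip y y' : A y -> A y' -> `|F y - F y'| <= K0 * d y y'.
  move=> Ay Ay'; rewrite (hdist_sym hd) distrC distrC.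
  exact: le_trans (proj1_dist sigma1 sigma_gt0 _ _) (f_lip _ _ Ay' Ay).
pose K := K0 * d 0 zeta; have K_ge0 : 0 <= K by rewrite mulr_ge0 ?hdist_ge0.
have F_line x t t' : A (gmul x (t *: zeta)) -> A (gmul x (t' *: zeta)) ->
    `|F (gmul x (t *: zeta)) - F (gmul x (t' *: zeta))| <= K * `|t - t'|.
  move=> At At'; apply: (le_trans (F_lip _ _ At At')).
  by rewrite (hdist_line hd)// mulrCA mulrC -mulrA.
have FS y : layer M 1 (F y) by exact: proj_layer.
(* The Borel structure comes from the norm, so the Lipschitz bound in terms of [d] yields continuity
   of [F] only through [hdist0_continuous]. *)
have F_cont y : B y -> F @ within B (nbhs (y : G)) --> F y.
  move=> By; apply/cvgrPdist_le => eps eps0.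
  have cd : d 0 (gmul (- y) z) @[z --> (y : G)] --> 0.
    have c1 : gmul (- y) z @[z --> (y : G)] --> (0 : G).
      by rewrite -(gmulNx y); exact: gmul_continuousr.
    exact: cvg_comp c1 (hdist0_continuous hd e_span bracket_span).
  have e1 : 0 < eps / (K0 + 1) by rewrite divr_gt0// ltr_wpDl.
  have /cvgrPdist_le /(_ _ e1) := cd.
  rewrite /within; apply: filterS => z; rewrite sub0r normrN => dz Bz.
  apply: (le_trans (F_lip _ _ (BA _ By) (BA _ Bz))).
  rewrite -(hdist_gmul hd _ _ (- y)) gmulNx.
  have d0 := hdist_ge0 hd 0 (gmul (- y) z).
  move: dz; rewrite ger0_norm// ler_pdivlMr ?ltr_wpDl//; apply: le_trans.
  by rewrite mulrC ler_wpM2l// lerDl.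
have [N1 [mN1 N10 HN1]] := density_exceptional hmu e_span zeta mB.
(* Countably many tolerances suffice, so that the union of the exceptional sets stays negligible. *)
have /choice[N2 HN2] : forall j, exists N : set (borel G), [/\ measurable N, mu N = 0%E &
    forall x, B x -> ~ N x -> exists k,
      measurable (xsection (small_gap_set B zeta F j.+1%:R^-1 k) x) /\
      (@product_measure1 _ _ (measurableTypeR R) (measurableTypeR R) R
        lebesgue_measure lebesgue_measure)
        (xsection (small_gap_set B zeta F j.+1%:R^-1 k) x) = 0%E].
  move=> j; have j0 : 0 < j.+1%:R^-1 :> R by rewrite invr_gt0.
  apply: (@derivative_exceptional _ _ _ mu hmu _ e e_span B zeta mB M F (layer M 1) K
    (layer_subspace M nu1) (@layer_closed _ _ M 1%N nu1) rnp K_ge0 (fun y _ => FS y) F_cont _ _ j0).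
  by move=> x t t' Bt Bt'; apply: F_line; exact: BA.
have : mu.-negligible (N0 `|` N1 `|` \bigcup_j N2 j).
  apply: negligibleU; first by apply: negligibleU => //; apply/negligibleP.
  by apply: negligible_bigcup => j; have [? ? _] := HN2 j; apply/negligibleP.
apply: negligibleS => x /= nP; apply: contrapT => nN; apply: nP => Ax.
have Bx : B x.
  by move: Ax; rewrite -AE => -[//|N0x]; case: nN; left; left.
have dens := HN1 x Bx (fun H => nN (or_introl (or_intror H))).
pose E : set R := [set t | B (gmul x (t *: zeta))].
pose T : set R := [set t | A (gmul x (t *: zeta))].
have ET : E `<=` T by move=> t; exact: BA.
have T0 : T 0 by rewrite /T /= scale0r gmulx0.
have mE : measurable (E : set (measurableTypeR R)).
  rewrite (_ : E = xsection [set p : borel G * measurableTypeR R | B (gmul p.1 (p.2 *: zeta))] x).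
    by apply: measurable_xsection; exact: (line_measurable e_span).
  by apply/seteqP; split=> t; rewrite /xsection /= inE.
have densE : rarely_missed (fun k => lebesgue_measure [set t | 0 < t < k.+1%:R^-1 /\ ~ E t]).
  exact: dens.
have [v lv Hv] : exists2 v, layer M 1 v & forall eps, 0 < eps -> exists2 del, 0 < del &
    forall r, 0 < r < del -> T r ->
    `|F (gmul x (r *: zeta)) - F (gmul x (0 *: zeta)) - r *: v| <= eps * r.
  apply: (@line_derivative_exists _ E mE densE _ (layer M 1)
    (fun t => F (gmul x (t *: zeta))) T K) => //.
  - exact: layer_subspace.
  - exact: layer_closed.
  - by move=> t t' Tt Tt'; exact: F_line.
  move=> eps eps0; pose j := Num.trunc eps^-1.
  have jeps : j.+1%:R^-1 < eps by rewrite invf_plt ?posrE// truncnS_gt.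
  have [_ _ /(_ x Bx)[|k [mW W0]]] := HN2 j; first by move=> H; apply: nN; right; exists j.
  exists k.+1%:R^-1, (xsection (small_gap_set B zeta F j.+1%:R^-1 k) x).
  split=> // r r' /andP[r0 rk] /andP[r'0 r'k] Er Er' gap.
  rewrite /xsection /= inE; split; last by rewrite /= !in_itv /= r0 rk r'0 r'k.
  split=> //; rewrite /quotient_gap /=.
  rewrite scale0r gmulx0 in gap; apply: le_lt_trans gap.
  by rewrite -!mulrA ler_wpM2r ?mulr_ge0 ?ltW.
have near_points (eta : R) : 0 < eta -> exists2 delta : R, 0 < delta &
    forall t, 0 < t < delta -> exists2 r, t < r < t * (1 + eta) & A (gmul x (r *: zeta)).
  move=> eta0; have [del del0 Hdel] := near_positive mE densE eta0.
  exists del => // t /Hdel; have [-> |/set0P[r [tr Er]] _] := eqVneq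
      [set r | t < r < t * (1 + eta) /\ E r] set0; first by rewrite measure0 eqxx.
  by exists r => //; exact: BA.
split; first exact: (dense_in_direction_rarely_missed lz densE).
split=> //; first exact: (approximating_exists lz Ax near_points hd).
exists v; rewrite scale0r gmulx0 in Hv.
have [C C0 HC] := pansu_chain hd sigma1 sigma_gt0 lz K0_ge0 f_lip Ax near_points Hv.
exact: (directional_derivativeP lz HC).
Qed.
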